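(* Let $(\mathcal S,\mathcal B)$ be a measurable space, $n\ge2$, and let $\{X_i^{(1)}\}_{i=1}^n$ and $\{X_i^{(2)}\}_{i=1}^n$ be independent copies of a sequence $X_1,\dots,X_n$ of i.i.d. $\mathcal S$-valued random variables. For each $(i_1,i_2)\in I_n^2$ let $H_{i_1,i_2}:\mathcal S\times\mathcal S\to\mathbb H^d$ be measurable kernels which are permutation-symmetric ($H_{i_1,i_2}(x_1,x_2)=H_{i_2,i_1}(x_2,x_1)$ for all $x_1,x_2$ and $i_1\neq i_2$) and degenerate ($\mathbb E H_{i_1,i_2}(x,X_1)=0$ for all $x\in\mathcal S$). Let $U_n=\sum_{(i_1,i_2)\in I_n^2}H_{i_1,i_2}(X_{i_1},X_{i_2})$. Let $\widetilde G\in\mathbb H^{nd}$ be the random block matrix whose $(i,j)$-th $d\times d$ block is $H_{i,j}(X_i^{(1)},X_j^{(2)})$ for $i\ne j$ and $0$ for $i=j$. Then for all $q\ge1$ and $r=\max(q,\log(ed))$, \begin{align*} \big(\mathbb E\|U_n\|^{2q}\big)^{1/2q} &\le 4\Big(\mathbb E\Big\|\sum_{(i_1,i_2)\in I_n^2}H_{i_1,i_2}\big(X^{(1)}_{i_1},X^{(2)}_{i_2}\big)\Big\|^{2q}\Big)^{1/2q}\\ &\le \frac{128}{\sqrt e}\Bigg[16\,r^{3/2}\Big(\mathbb E\max_{i_1}\Big\|\sum_{i_2:i_2\ne i_1}H^2_{i_1,i_2}\big(X^{(1)}_{i_1},X^{(2)}_{i_2}\big)\Big\|^q\Big)^{1/(2q)}\\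 &\qquad + r\Big\|\sum_{(i_1,i_2)\in I_n^2}\mathbb E H^2_{i_1,i_2}\big(X^{(1)}_{i_1},X^{(2)}_{i_2}\big)\Big\|^{1/2} + r\Big(\mathbb E\big\|\mathbb E_2\widetilde G\widetilde G^\ast\big\|^q\Big)^{1/2q}\Bigg]. \end{align*}
   Context: $\mathbb H^d$ denotes the set of $d\times d$ complex Hermitian matrices; $\|\cdot\|$ is the spectral norm; $A^\ast$ is the conjugate transpose. $I_n^2=\{(i_1,i_2):1\le i_1,i_2\le n,\ i_1\ne i_2\}$. $\mathbb E_2[\cdot]$ denotes expectation with respect to $\{X_i^{(2)}\}_{i=1}^n$ only, i.e. conditionally on all other random variables. *)

(* Defs.v *)
From HB Require Import structures.
From mathcomp Require Import all_boot all_order all_algebra.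
From mathcomp Require Import all_classical all_reals all_analysis.
From mathcomp.real_closed Require Import complex.

Set Implicit Arguments.
Unset Strict Implicit.
Unset Printing Implicit Defensive.

Import Order.TTheory GRing.Theory Num.Theory.
Local Open Scope classical_set_scope.
Local Open Scope ring_scope.

Section Defs.
Context {R : realType}.

Definition cnorm2 (z : R[i]) : R := complex.Re z ^+ 2 + complex.Im z ^+ 2.

Definition cconj (z : R[i]) : R[i] := Complex (complex.Re z) (- complex.Im z).

Definition vnorm m (v : 'cV[R[i]]_m) : R := Num.sqrt (\sum_(k < m) cnorm2 (v k ord0)).

Definition specnorm m (A : 'M[R[i]]_m) : R :=
  sup [set vnorm (A *m v) | v in [set v : 'cV[R[i]]_m | vnorm v <= 1]].

Definition adjmx m n (A : 'M[R[i]]_(m, n)) : 'M[R[i]]_(n, m) :=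
  \matrix_(i, j) cconj (A j i).

Definition hermitian_mx m (A : 'M[R[i]]_m) : Prop := adjmx A = A.

Section Meas.
Context {dT : measure_display} {T : measurableType dT}.

Definition cexpect (mu : {measure set T -> \bar R}) (f : T -> R[i]) : R[i] :=
  Complex (Rintegral mu setT (fun x => complex.Re (f x))) (Rintegral mu setT (fun x => complex.Im (f x))).

Definition cintegrable (mu : {measure set T -> \bar R}) (f : T -> R[i]) : Prop :=
  mu.-integrable setT (fun x => (complex.Re (f x))%:E) /\
  mu.-integrable setT (fun x => (complex.Im (f x))%:E).

Definition mx_expect (mu : {measure set T -> \bar R}) m n
  (F : T -> 'M[R[i]]_(m, n)) : 'M[R[i]]_(m, n) :=
  \matrix_(a, b) cexpect mu (fun x => F x a b).

Definition mx_integrable (mu : {measure set T -> \bar R}) m n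
  (F : T -> 'M[R[i]]_(m, n)) : Prop :=
  forall a b, cintegrable mu (fun x => F x a b).

Definition mx_measurable m n (F : T -> 'M[R[i]]_(m, n)) : Prop :=
  forall a b, measurable_fun setT (fun x => complex.Re (F x a b)) /\
              measurable_fun setT (fun x => complex.Im (F x a b)).
End Meas.

Section Prob.
Context {dO dS : measure_display} {O : measurableType dO} {S : measurableType dS}.

Definition has_law (P : probability O R) (Y : O -> S) (mu : probability S R) : Prop :=
  forall A, measurable A -> P (Y @^-1` A) = mu A.

Definition mutually_independent (P : probability O R) (I : finType) (Y : I -> O -> S) : Prop :=
  forall B : I -> set S, (forall k, measurable (B k)) ->
    P (\bigcap_(k in [set: I]) (Y k @^-1` B k)) = (\prod_(k : I) P (Y k @^-1` B k))%E.
End Prob.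

End Defs.

(* Main.v *)
(** Decoupling: if [J] is a uniformly random set of indices, a pair [i <> j] satisfies
    [i \in J], [j \notin J] with probability 1/4; the pairs with this property see disjoint
    groups of variables, so replacing one group by an independent copy and restoring the
    missing terms by conditional Jensen (degeneracy) costs no more than the factor 4.

    The decoupled sum is symmetrized in each family of variables, again by Jensen, and the
    resulting Rademacher chaos is bounded by two applications of a matrix Khintchine
    inequality, the second one to the Hermitian dilation of the block rows. Khintchine itself
    is an integration by parts on the trace of an even power; the dimension enters only
    through the trace, and is absorbed by [d <= exp (r - 1)]. What remains is the moment of
    [N^2 = max (||G G^*||, ||sum H^2||)].

    Both Gram matrices are compared with their (partial) expectations. Each deviation is
    a symmetrized sum of squares, and Khintchine with Cauchy-Schwarz bounds it by a multiple
    of [sqrt r * T1 * ||N||_(2q)]. This quadratic inequality in [||N||_(2q)] is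
    solved for it. *)
Require Import Defs.
From HB Require Import structures.
From mathcomp Require Import all_boot all_order all_algebra.
From mathcomp Require Import all_classical all_reals all_analysis.
From mathcomp.real_closed Require Import complex.
From mathcomp Require Import measurable_realfun ring lra zify.
Import Order.TTheory GRing.Theory Num.Theory.
Local Open Scope classical_set_scope.
Local Open Scope ring_scope.
Set Implicit Arguments.
Unset Strict Implicit.
Unset Printing Implicit Defensive.

(** * Real inner product on complex matrices *)

Section RealInnerProduct.
Context {R : realType}.
Local Notation C := R[i].

(** Nothing is diagonalised: matrices are handled through the real inner product [ip], and
    eigenvalue arguments become Cauchy-Schwarz along the powers of a Hermitian matrix. Hence even
    integer powers; a real exponent [q <= r] is reached from the integer ceiling of [r] by
    concavity. The kernel is assumed integrable only in each section, so no moment is known to be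
    finite. Estimates are made in the extended reals, and an infinite right-hand side is trivial. If
    [T1] is finite, a crude bound with a factor depending on [n] and [d] makes the moment of [N]
    finite, which is what allows the quadratic inequality to be solved. The dilation has size
    [d + n d], but Khintchine sees only the trace of the sum of squares, at most [2 d N^2]; so [n]
    never enters the final bound. Constants: decoupling gives 4, symmetrizing two families gives
    [2 * 2], the two uses of Khintchine together give [9/2 r], and
    [4 * 4 * 9/2 = 72 <= 128 / sqrt e]. Three deviations contribute [2 * sqrt (9/2 r)] each, and
    [6 * sqrt (9/2) <= 16]. *)

Lemma cconjE : @cconj R = @conjc R.
Proof. by apply/funext => -[]. Qed.

Lemma adjmxE m n (A : 'M[C]_(m, n)) : adjmx A = (map_mx (@conjc R) A)^T.
Proof. by apply/matrixP => i j; rewrite !mxE cconjE. Qed.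

Lemma adjmxK m n (A : 'M[C]_(m, n)) : adjmx (adjmx A) = A.
Proof. by apply/matrixP => i j; rewrite !mxE cconjE conjcK. Qed.

Lemma adjmxM m n p (A : 'M[C]_(m, n)) (B : 'M[C]_(n, p)) :
  adjmx (A *m B) = adjmx B *m adjmx A.
Proof. by rewrite !adjmxE map_mxM trmx_mul. Qed.

Lemma adjmxD m n (A B : 'M[C]_(m, n)) : adjmx (A + B) = adjmx A + adjmx B.
Proof. by rewrite !adjmxE map_mxD linearD. Qed.

Lemma adjmxN m n (A : 'M[C]_(m, n)) : adjmx (- A) = - adjmx A.
Proof. by rewrite !adjmxE map_mxN linearN. Qed.

Lemma adjmx0 m n : adjmx (0 : 'M[C]_(m, n)) = 0.
Proof. by rewrite adjmxE map_mx0 trmx0. Qed.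

Lemma adjmx1 m : adjmx (1%:M : 'M[C]_m) = 1%:M.
Proof. by rewrite adjmxE map_mx1 trmx1. Qed.

(** The real part of the Frobenius inner product: its values are ordered, [ip v v] is the squared
    Euclidean norm of a column, and cyclicity of the trace moves factors across as adjoints. *)
Definition ip m n (A B : 'M[C]_(m, n)) : R := complex.Re (\tr (adjmx A *m B)).

Lemma ipE m n (A B : 'M[C]_(m, n)) : ip A B =
  \sum_i \sum_j (complex.Re (A i j) * complex.Re (B i j) +
                 complex.Im (A i j) * complex.Im (B i j)).
Proof.
rewrite /ip /mxtrace raddf_sum exchange_big /=; apply: eq_bigr => j _.
rewrite mxE raddf_sum; apply: eq_bigr => i _ /=.
by rewrite !mxE; case: (A i j) (B i j) => a b [c e] /=; ring.
Qed.

Lemma ipC m n (A B : 'M[C]_(m, n)) : ip A B = ip B A.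
Proof.
rewrite !ipE; apply: eq_bigr => i _; apply: eq_bigr => j _.
by rewrite ![complex.Re (A i j) * _]mulrC ![complex.Im (A i j) * _]mulrC.
Qed.

Lemma ipDr m n (A B D : 'M[C]_(m, n)) : ip A (B + D) = ip A B + ip A D.
Proof. by rewrite /ip mulmxDr !raddfD. Qed.

Lemma ipNr m n (A B : 'M[C]_(m, n)) : ip A (- B) = - ip A B.
Proof. by rewrite /ip mulmxN !raddfN. Qed.

Lemma ip0r m n (A : 'M[C]_(m, n)) : ip A 0 = 0.
Proof. by rewrite /ip mulmx0 !raddf0. Qed.

Lemma ipDl m n (A B D : 'M[C]_(m, n)) : ip (A + B) D = ip A D + ip B D.
Proof. by rewrite ipC ipDr !(ipC D). Qed.

Lemma ipNl m n (A B : 'M[C]_(m, n)) : ip (- A) B = - ip A B.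
Proof. by rewrite ipC ipNr ipC. Qed.

Lemma ip_sumr m n I (r : seq I) (P : pred I) (A : 'M[C]_(m, n)) F :
  ip A (\sum_(i <- r | P i) F i) = \sum_(i <- r | P i) ip A (F i).
Proof. exact: (big_morph _ (ipDr A) (ip0r A)). Qed.

Lemma ip_suml m n I (r : seq I) (P : pred I) (A : 'M[C]_(m, n)) F :
  ip (\sum_(i <- r | P i) F i) A = \sum_(i <- r | P i) ip (F i) A.
Proof. by rewrite ipC ip_sumr; apply: eq_bigr => i _; rewrite ipC. Qed.

Lemma ip_ge0 m n (A : 'M[C]_(m, n)) : 0 <= ip A A.
Proof.
rewrite ipE; apply: sumr_ge0 => i _; apply: sumr_ge0 => j _.
by rewrite addr_ge0 // -expr2 sqr_ge0.
Qed.

Lemma ip_mull m n p (A : 'M[C]_(m, n)) (B : 'M[C]_(n, p)) D :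
  ip (A *m B) D = ip B (adjmx A *m D).
Proof. by rewrite /ip adjmxM mulmxA. Qed.

Lemma ip_mulr m n p (A : 'M[C]_(m, n)) (B : 'M[C]_(n, p)) D :
  ip (A *m B) D = ip A (D *m adjmx B).
Proof. by rewrite /ip adjmxM -mulmxA mxtrace_mulC mulmxA. Qed.

Lemma ip_adj m n (A B : 'M[C]_(m, n)) : ip (adjmx A) (adjmx B) = ip A B.
Proof. by rewrite ipC /ip adjmxK mxtrace_mulC. Qed.

Lemma ipZr m n (s : R) (A B : 'M[C]_(m, n)) : ip A (s%:C%C *: B) = s * ip A B.
Proof.
rewrite /ip -scalemxAr linearZ /=.
by case: (\tr _) => a b /=; ring.
Qed.

Lemma ipZl m n (s : R) (A B : 'M[C]_(m, n)) : ip (s%:C%C *: A) B = s * ip A B.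
Proof. by rewrite ipC ipZr ipC. Qed.

Lemma ip_CS m n (A B : 'M[C]_(m, n)) : ip A B ^+ 2 <= ip A A * ip B B.
Proof.
have h t : 0 <= ip A A * t ^+ 2 + 2 * t * ip A B + ip B B.
  have := ip_ge0 (t%:C%C *: A + B).
  by rewrite ipDl !ipDr !ipZl !ipZr (ipC B A) => /le_trans; apply; lra.
have [A0|A0] := eqVneq (ip A A) 0.
  rewrite A0 mul0r; have [->|AB0] := eqVneq (ip A B) 0; first by rewrite expr0n.
  (* When [ip A A = 0] the quadratic in [h] is affine in [t]; at this [t] its value would be
     [-1]. *)
  have := h (- (ip B B + 1) / (2 * ip A B)).
  rewrite A0 mul0r add0r.
  have -> : 2 * (- (ip B B + 1) / (2 * ip A B)) * ip A B = - (ip B B + 1).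
    by field.
  by lra.
have Ap : 0 < ip A A by rewrite lt_def A0 ip_ge0.
have := h (- ip A B / ip A A).
have -> : ip A A * (- ip A B / ip A A) ^+ 2 + 2 * (- ip A B / ip A A) * ip A B + ip B B
  = ip B B - ip A B ^+ 2 / ip A A by field.
by rewrite subr_ge0 ler_pdivrMr // mulrC.
Qed.

Lemma ip_AMGM m n (A B : 'M[C]_(m, n)) : 2 * ip A B <= ip A A + ip B B.
Proof.
have := ip_ge0 (A - B).
by rewrite ipDl !ipDr !ipNl !ipNr (ipC B A); lra.
Qed.

Lemma vnormE m (v : 'cV[C]_m) : vnorm v = Num.sqrt (ip v v).
Proof.
rewrite /vnorm ipE; congr Num.sqrt; apply: eq_bigr => i _.
by rewrite big_ord1 /cnorm2 !expr2.
Qed.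

Lemma vnorm_ge0 m (v : 'cV[C]_m) : 0 <= vnorm v.
Proof. exact: sqrtr_ge0. Qed.

Lemma sqr_vnorm m (v : 'cV[C]_m) : vnorm v ^+ 2 = ip v v.
Proof. by rewrite vnormE sqr_sqrtr // ip_ge0. Qed.

Lemma le_vnorm m k (v : 'cV[C]_m) (w : 'cV[C]_k) c : 0 <= c ->
  (vnorm w <= c * vnorm v) = (ip w w <= c ^+ 2 * ip v v).
Proof.
move=> c0; rewrite -!sqr_vnorm -exprMn ler_sqr // nnegrE ?vnorm_ge0 //.
by rewrite mulr_ge0 ?vnorm_ge0.
Qed.

Lemma ip_mulmx_le m n p (A : 'M[C]_(m, n)) (B : 'M[C]_(n, p)) :
  ip (A *m B) (A *m B) <= ip A A * ip B B.
Proof.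
rewrite [leLHS]ipE [ip A A]ipE mulr_suml; apply: ler_sum => i _.
have -> : ip B B = \sum_j ip (col j B) (col j B).
  rewrite ipE exchange_big /=; apply: eq_bigr => j _; rewrite ipE.
  by apply: eq_bigr => k _; rewrite big_ord1 !mxE.
rewrite mulr_sumr; apply: ler_sum => j _.
pose a : 'cV[C]_n := (adjmx A) *m delta_mx i ord0.
have aE k : a k ord0 = cconj (A i k).
  rewrite /a !mxE (bigD1 i) //= big1 ?addr0 ?mxE ?eqxx ?mulr1 // => l li.
  by rewrite !mxE (negPf li) mulr0.
have -> : \sum_j (complex.Re (A i j) * complex.Re (A i j)
   + complex.Im (A i j) * complex.Im (A i j)) = ip a a.
  by rewrite ipE; apply: eq_bigr => k _; rewrite big_ord1 aE /=; ring.
have h (u : C) : u = \tr (adjmx a *m col j B) ->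
   complex.Re u * complex.Re u + complex.Im u * complex.Im u
     <= ip a a * ip (col j B) (col j B).
  move=> uE.
  (* [s] is [u] itself: scaling [a] by it turns the complex entry into the real number [|u|^2], so
     the real Cauchy-Schwarz inequality yields the complex one. *)
  pose s : C := Complex (complex.Re u) (complex.Im u).
  have E1 : ip (s *: a) (col j B) =
     complex.Re u * complex.Re u + complex.Im u * complex.Im u.
    rewrite /ip; have -> : adjmx (s *: a) = conjc s *: adjmx a.
      by rewrite !adjmxE map_mxZ linearZ.
    rewrite -scalemxAl linearZ /= -uE /s; case: (u) => x y /=; ring.
  have E2 : ip (s *: a) (s *: a) =
     (complex.Re u * complex.Re u + complex.Im u * complex.Im u) * ip a a.
    rewrite !ipE mulr_sumr; apply: eq_bigr => k _; rewrite !big_ord1 !mxE /s.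
    by case: (\sum_(_ < _) _) => x y /=; ring.
  have := ip_CS (s *: a) (col j B); rewrite E1 E2.
  set N := complex.Re u * _ + _ => h.
  have [N0|N0] := eqVneq N 0; first by rewrite N0 mulr_ge0 ?ip_ge0.
  have Np : 0 < N by rewrite lt_def N0 addr_ge0 // -expr2 sqr_ge0.
  by move: h; rewrite expr2 -mulrA ler_pM2l.
apply: h; rewrite /mxtrace big_ord1 !mxE; apply: eq_bigr => k _.
by rewrite [adjmx a _ _]mxE aE !mxE cconjE conjcK.
Qed.

End RealInnerProduct.

(** * Spectral norm *)

Section SpectralNorm.
Context {R : realType}.
Local Notation C := R[i].

Lemma specnorm_has_sup m (A : 'M[C]_m) :
  has_sup [set vnorm (A *m v) | v in [set v : 'cV[C]_m | vnorm v <= 1]].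
Proof.
split.
  exists (vnorm (A *m (0 : 'cV[C]_m))), 0 => //=.
  by rewrite vnormE ip0r sqrtr0 ler01.
exists (Num.sqrt (ip A A)) => _ [v /= v1 <-].
rewrite vnormE ler_sqrt ?ip_ge0 // (le_trans (ip_mulmx_le _ _)) //.
rewrite ler_piMr ?ip_ge0 // -sqr_vnorm -[leRHS](expr1n _ 2).
by rewrite ler_sqr // ?nnegrE ?vnorm_ge0.
Qed.

Lemma specnorm_ge0 m (A : 'M[C]_m) : 0 <= specnorm A.
Proof.
apply: (le_trans (vnorm_ge0 (A *m (0 : 'cV[C]_m)))).
apply: ub_le_sup; first exact: (specnorm_has_sup A).2.
by exists 0 => //=; rewrite vnormE ip0r sqrtr0 ler01.
Qed.

Lemma ip_eq0_mul m n p (A : 'M[C]_(m, n)) (B : 'M[C]_(n, p)) :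
  ip B B = 0 -> ip (A *m B) (A *m B) = 0.
Proof.
by move=> B0; apply/le_anti; rewrite ip_ge0 (le_trans (ip_mulmx_le _ _)) ?B0 ?mulr0.
Qed.

Lemma ip_mul_specnorm m (A : 'M[C]_m) (v : 'cV[C]_m) :
  ip (A *m v) (A *m v) <= specnorm A ^+ 2 * ip v v.
Proof.
rewrite -le_vnorm ?specnorm_ge0 //.
have [v0|v0] := eqVneq (vnorm v) 0.
  by rewrite v0 mulr0 vnormE ip_eq0_mul ?sqrtr0 // -sqr_vnorm v0 expr0n.
have vp : 0 < vnorm v by rewrite lt_def v0 vnorm_ge0.
have scal k (w : 'cV[C]_k) : vnorm ((vnorm v)^-1%:C%C *: w) = (vnorm v)^-1 * vnorm w.
  rewrite [LHS]vnormE ipZl ipZr mulrA -expr2 sqrtrM ?sqr_ge0 // -vnormE.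
  by rewrite sqrtr_sqr ger0_norm // invr_ge0 vnorm_ge0.
rewrite -ler_pdivrMr // mulrC -scal scalemxAr.
apply: ub_le_sup; first exact: (specnorm_has_sup A).2.
by exists ((vnorm v)^-1%:C%C *: v) => //=; rewrite scal mulVf.
Qed.

Lemma specnorm_le m (A : 'M[C]_m) (M : R) : 0 <= M ->
  (forall v : 'cV[C]_m, ip (A *m v) (A *m v) <= M ^+ 2 * ip v v) -> specnorm A <= M.
Proof.
move=> M0 h; apply: ge_sup; first exact: (specnorm_has_sup A).1.
move=> _ [v /= v1 <-]; have := h v; rewrite -le_vnorm // => /le_trans; apply.
by rewrite ler_piMr.
Qed.

Lemma ip_mulmx_specnorm m n (A : 'M[C]_m) (B : 'M[C]_(m, n)) :
  ip (A *m B) (A *m B) <= specnorm A ^+ 2 * ip B B.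
Proof.
have ipcol k l (D : 'M[C]_(k, l)) : ip D D = \sum_j ip (col j D) (col j D).
  rewrite ipE exchange_big /=; apply: eq_bigr => j _; rewrite ipE.
  by apply: eq_bigr => i _; rewrite big_ord1 !mxE.
rewrite !ipcol mulr_sumr; apply: ler_sum => j _.
by rewrite colE -mulmxA -colE ip_mul_specnorm.
Qed.

Lemma specnorm0 m : specnorm (0 : 'M[C]_m) = 0.
Proof.
apply/le_anti; rewrite specnorm_ge0 andbT; apply: specnorm_le => // v.
by rewrite mul0mx ip0r mulr_ge0 ?ip_ge0 ?sqr_ge0.
Qed.

Lemma specnormN m (A : 'M[C]_m) : specnorm (- A) = specnorm A.
Proof.
have le B : specnorm (- B) <= @specnorm R m B.
  apply: specnorm_le => [|v]; first exact: specnorm_ge0.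
  by rewrite mulNmx ipNl ipNr opprK ip_mul_specnorm.
by apply/le_anti; rewrite le -{1}(opprK A) le.
Qed.

Lemma vnormD m (v w : 'cV[C]_m) : vnorm (v + w) <= vnorm v + vnorm w.
Proof.
rewrite -(@ler_sqr R) ?nnegrE ?addr_ge0 ?vnorm_ge0 // sqrrD !sqr_vnorm.
rewrite ipDl !ipDr (ipC w v) -subr_ge0.
set a := ip v v; set b := ip w w; set c := ip v w.
have -> : a + (vnorm v * vnorm w) *+ 2 + b - (a + c + (c + b)) =
   2 * (vnorm v * vnorm w - c) by ring.
rewrite mulr_ge0 // subr_ge0 (le_trans (ler_norm _)) // -(@ler_sqr R) ?nnegrE //.
  by rewrite real_normK ?num_real // exprMn !sqr_vnorm ip_CS.
by rewrite mulr_ge0 ?vnorm_ge0.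
Qed.

Lemma specnormD m (A B : 'M[C]_m) : specnorm (A + B) <= specnorm A + specnorm B.
Proof.
apply: specnorm_le => [|v]; first by rewrite addr_ge0 ?specnorm_ge0.
rewrite -le_vnorm ?addr_ge0 ?specnorm_ge0 // mulmxDl (le_trans (vnormD _ _)) //.
by rewrite mulrDl lerD // le_vnorm ?specnorm_ge0 // ip_mul_specnorm.
Qed.

Lemma specnormB m (A B : 'M[C]_m) : specnorm (A - B) <= specnorm A + specnorm B.
Proof. by rewrite -(specnormN B) specnormD. Qed.

Lemma specnorm_sum m I (r : seq I) (P : pred I) (F : I -> 'M[C]_m) :
  specnorm (\sum_(i <- r | P i) F i) <= \sum_(i <- r | P i) specnorm (F i).
Proof.
elim/big_rec2: _ => [|i y A _ h]; first by rewrite specnorm0.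
by rewrite (le_trans (specnormD _ _)) // lerD2l.
Qed.

Lemma specnormZ m (s : R) (A : 'M[C]_m) : 0 <= s ->
  specnorm (s%:C%C *: A) <= s * specnorm A.
Proof.
move=> s0; apply: specnorm_le => [|v]; first by rewrite mulr_ge0 ?specnorm_ge0.
rewrite -scalemxAl ipZl ipZr.
have := ler_wpM2l s0 (ler_wpM2l s0 (ip_mul_specnorm A v)).
by move=> /le_trans; apply; rewrite exprMn expr2 -!mulrA.
Qed.

Lemma ip_quad_specnorm m (A : 'M[C]_m) (v : 'cV[C]_m) :
  ip v (A *m v) <= specnorm A * ip v v.
Proof.
rewrite (le_trans (ler_norm _)) // -(@ler_sqr R) ?nnegrE ?mulr_ge0 ?ip_ge0 ?specnorm_ge0 //.
rewrite real_normK ?num_real // (le_trans (ip_CS _ _)) // exprMn [X in _ <= _ * X]expr2.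
by rewrite mulrCA ler_wpM2l ?ip_ge0 // ip_mul_specnorm.
Qed.

(** Replaces the spectral theorem. With [w = A v], positivity of the form at [w - t v] gives a
    quadratic in [t]; at [t = M] the bounds on [<v, A v>] and [<w, A w>] turn into one on [<w, w>].
    For [M = 0] the choice [t = 1] is made instead. *)
Lemma specnorm_psd_le m (A : 'M[C]_m) (M : R) : 0 <= M -> hermitian_mx A ->
  (forall v : 'cV[C]_m, 0 <= ip v (A *m v)) ->
  (forall v : 'cV[C]_m, ip v (A *m v) <= M * ip v v) -> specnorm A <= M.
Proof.
move=> M0 hA A0 AM; apply: specnorm_le => // v.
set w := A *m v.
have hs (u u' : 'cV[C]_m) : ip u (A *m u') = ip u' (A *m u).
  by rewrite ipC ip_mull hA.
have h t : 0 <= ip v w * t ^+ 2 - 2 * t * ip w w + ip w (A *m w).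
  have := A0 ((- t)%:C%C *: v + w); rewrite mulmxDr ipDl !ipDr -scalemxAr !ipZl !ipZr.
  by rewrite (hs v w) -/w => /le_trans; apply; lra.
have [w0|w0] := eqVneq (ip w w) 0; first by rewrite w0 mulr_ge0 ?ip_ge0 ?sqr_ge0.
have wp : 0 < ip w w by rewrite lt_def w0 ip_ge0.
have [M00|M00] := eqVneq M 0.
  have vw : ip v w = 0 by apply/le_anti; rewrite A0 (le_trans (AM v)) // M00 mul0r.
  have := h 1; have := AM w; rewrite M00 vw mul0r; lra.
have Mp : 0 < M by rewrite lt_def M00.
have := h M; have := AM w; have := AM v; rewrite -/w => a b c.
have a2 : ip v w * M ^+ 2 <= M * ip v v * M ^+ 2 by rewrite ler_wpM2r ?sqr_ge0.
have : M * ip w w <= M * (M ^+ 2 * ip v v) by lra.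
by rewrite ler_pM2l.
Qed.

Lemma ip_quad_gram_le m n (B : 'M[C]_(m, n)) (v : 'cV[C]_n) :
  ip (B *m v) (B *m v) <= specnorm (adjmx B *m B) * ip v v.
Proof. by rewrite ip_mull mulmxA ip_quad_specnorm. Qed.

Lemma hermitian_gram m n (B : 'M[C]_(m, n)) : hermitian_mx (adjmx B *m B).
Proof. by rewrite /hermitian_mx adjmxM adjmxK. Qed.

Lemma specnorm_gram_le m n (B : 'M[C]_(m, n)) (M : R) : 0 <= M ->
  (forall v : 'cV[C]_n, ip (B *m v) (B *m v) <= M * ip v v) ->
  specnorm (adjmx B *m B) <= M.
Proof.
move=> M0 h; apply: specnorm_psd_le => //; first exact: hermitian_gram.
- by move=> v; rewrite -mulmxA -(adjmxK B) -ip_mull adjmxK ip_ge0.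
- by move=> v; rewrite -mulmxA -(adjmxK B) -ip_mull adjmxK h.
Qed.

(* [||B^* w||^2 = <w, B B^* w> <= ||w|| ||B (B^* w)||]. *)
Lemma ip_adj_le m n (B : 'M[C]_(m, n)) (M : R) : 0 <= M ->
  (forall v : 'cV[C]_n, ip (B *m v) (B *m v) <= M * ip v v) ->
  forall w : 'cV[C]_m, ip (adjmx B *m w) (adjmx B *m w) <= M * ip w w.
Proof.
move=> M0 h w; set u := adjmx B *m w.
have E : ip u u = ip w (B *m u) by rewrite {1}/u ip_mull adjmxK.
have [u0|u0] := eqVneq (ip u u) 0; first by rewrite u0 mulr_ge0 ?ip_ge0.
have up : 0 < ip u u by rewrite lt_def u0 ip_ge0.
rewrite -(ler_pM2r up) -expr2 {1}E (le_trans (ip_CS _ _)) // mulrAC mulrC.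
by rewrite ler_wpM2r ?ip_ge0.
Qed.

Lemma specnorm_gramC m n (B : 'M[C]_(m, n)) :
  specnorm (B *m adjmx B) <= specnorm (adjmx B *m B).
Proof.
rewrite -{1}(adjmxK B); apply: specnorm_gram_le; first exact: specnorm_ge0.
by apply: ip_adj_le; [exact: specnorm_ge0|exact: ip_quad_gram_le].
Qed.

End SpectralNorm.

(** * Trace inequalities *)

Section TraceInequalities.
Context {R : realType}.
Local Notation C := R[i].

Lemma hermitian_exp m (A : 'M[C]_m) k : hermitian_mx A -> hermitian_mx (A ^+ k).
Proof.
rewrite /hermitian_mx => hA; elim: k => [|k IH]; first exact: adjmx1.
by rewrite {1}exprS adjmxM IH hA exprSr.
Qed.

Lemma hermitianD m (A B : 'M[C]_m) :
  hermitian_mx A -> hermitian_mx B -> hermitian_mx (A + B).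
Proof. by rewrite /hermitian_mx adjmxD => -> ->. Qed.

Lemma hermitianN m (A : 'M[C]_m) : hermitian_mx A -> hermitian_mx (- A).
Proof. by rewrite /hermitian_mx adjmxN => ->. Qed.

Lemma hermitian0 m : hermitian_mx (0 : 'M[C]_m).
Proof. exact: adjmx0. Qed.

Lemma hermitian_sum m I (r : seq I) (P : pred I) (F : I -> 'M[C]_m) :
  (forall i, P i -> hermitian_mx (F i)) -> hermitian_mx (\sum_(i <- r | P i) F i).
Proof.
move=> h; elim/big_ind: _ => //; [exact: hermitian0|exact: hermitianD].
Qed.

Lemma hermitian_sign m (b : bool) (A : 'M[C]_m) :
  hermitian_mx A -> hermitian_mx ((-1) ^+ b *: A).
Proof. by move=> h; rewrite scaler_sign; case: b => //; exact: hermitianN. Qed.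

(** The ratios [a k.+1 / a k] are nondecreasing, hence all at least [a 1]. They are written as
    products because terms may vanish. *)
Lemma log_convex_le (a : nat -> R) p : (forall k, 0 <= a k) ->
  (forall k, a k.+1 ^+ 2 <= a k * a k.+2) -> a 0%N = 1 -> a 1%N ^+ p <= a p.
Proof.
move=> a0 ac a01.
have ratio k : a 1%N * a k <= a k.+1.
  elim: k => [|k IH]; first by rewrite a01 mulr1.
  have [z|z] := eqVneq (a k.+1) 0; first by rewrite z mulr0.
  have p1 : 0 < a k.+1 by rewrite lt_def z a0.
  have pk : 0 < a k.
    rewrite lt_def a0 andbT; apply: contra_neq z => z.
    have := ac k; rewrite z mul0r => h; apply/eqP; rewrite -sqrf_eq0.
    by apply/eqP/le_anti; rewrite h sqr_ge0.
  rewrite -(ler_pM2l pk); apply: le_trans (ac k).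
  by rewrite expr2 mulrA ler_wpM2r // [a k * _]mulrC.
elim: p => [|p IH]; first by rewrite expr0 a01.
by rewrite exprS (le_trans _ (ratio p)) // ler_wpM2l.
Qed.

(** The right-hand side is the trace of [A^(2p)]. By Cauchy-Schwarz the sequence
    [||A^k v||^2 / ||v||^2] is log-convex, so its [p]-th term dominates the [p]-th power of its
    first; [M] is the [2p]-th root of the trace. *)
Lemma specnorm_exp_le m (A : 'M[C]_m) p : (0 < p)%N -> hermitian_mx A ->
  specnorm A ^+ p.*2 <= ip (A ^+ p) (A ^+ p).
Proof.
move=> p0 hA; set K := ip _ _.
have K0 : 0 <= K by exact: ip_ge0.
pose M := K `^ (p.*2%:R)^-1.
have M0 : 0 <= M by exact: powR_ge0.
have MK : M ^+ p.*2 = K.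
  by rewrite -powR_mulrn // -powRrM mulVf ?powRr1 // pnatr_eq0 double_eq0 -lt0n.
rewrite -MK lerXn2r ?nnegrE ?specnorm_ge0 //; apply: specnorm_le => // v.
have [v0|v0] := eqVneq (ip v v) 0; first by rewrite v0 mulr0 ip_eq0_mul.
have vp : 0 < ip v v by rewrite lt_def v0 ip_ge0.
pose a k := ip (A ^+ k *m v) (A ^+ k *m v) / ip v v.
have a0 k : 0 <= a k by rewrite divr_ge0 ?ip_ge0.
have hk k : adjmx (A ^+ k) = A ^+ k by exact: hermitian_exp.
have ac k : a k.+1 ^+ 2 <= a k * a k.+2.
  rewrite /a exprMn [in leRHS]mulrACA -[X in _ <= _ * X]expr2 ler_wpM2r ?sqr_ge0 //.
  have -> : ip (A ^+ k.+1 *m v) (A ^+ k.+1 *m v) = ip (A ^+ k *m v) (A ^+ k.+2 *m v).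
    have E l : A ^+ l.+1 *m v = A *m (A ^+ l *m v) by rewrite mulmxA exprS.
    by rewrite {1}E ip_mull hA -E.
  exact: ip_CS.
have a00 : a 0%N = 1 by rewrite /a expr0 mul1mx divff.
have := log_convex_le p a0 ac a00; rewrite /a expr1 => h.
rewrite -ler_pdivrMr //; set x := _ / _ in h *.
have x0 : 0 <= x by rewrite divr_ge0 ?ip_ge0.
rewrite -(ler_pXn2r p0) ?nnegrE ?exprn_ge0 // -exprM mul2n MK (le_trans h) //.
by rewrite ler_pdivrMr // ip_mulmx_le.
Qed.

Lemma sum_odd_even (f : nat -> R) s :
  \sum_(k < s.*2.+1) f k = \sum_(b < s.+1) f b.*2 + \sum_(b < s) f b.*2.+1.
Proof.
elim: s => [|s IH]; first by rewrite !big_ord_recr !big_ord0 /= double0 addr0.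
by rewrite doubleS 2!big_ord_recr /= IH [in RHS]big_ord_recr [X in _ = _ + X]big_ord_recr /= doubleS; ring.
Qed.

(** A discrete Hermite-Hadamard inequality: the average over [0..2s] is at most the average of the
    two ends. The hypothesis compares with even points only, because that is what AM-GM supplies; it
    makes [g] convex on the even points. *)
Lemma midconvex_sum_le (f : nat -> R) s :
  (forall a c, (a <= s)%N -> (c <= s)%N -> 2 * f (a + c)%N <= f a.*2 + f c.*2) ->
  2 * (\sum_(k < s.*2.+1) f k) <= s.*2.+1%:R * (f 0%N + f s.*2).
Proof.
move=> h; pose g b := f b.*2; pose e b := g b.+1 - g b.
have gc b : (b.+1 < s)%N -> e b <= e b.+1.
  move=> bs; have := h b b.+2; rewrite /e /g addnS addnS -addnn !doubleS => H.
  have := H (ltnW (ltnW bs)) bs; rewrite addnn; lra.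
have em i j : (i <= j)%N -> (j < s)%N -> e i <= e j.
  elim: j => [|j IH]; first by rewrite leqn0 => /eqP ->.
  rewrite leq_eqVlt => /predU1P[->//|ij] js.
  by rewrite (le_trans (IH ij (ltnW js))) // gc.
have tel b k : \sum_(i < b) e (k + i)%N = g (k + b)%N - g k.
  elim: b => [|b IH]; first by rewrite big_ord0 addn0 subrr.
  by rewrite big_ord_recr /= IH /e addnS; ring.
have gs b : (b <= s)%N -> g b + g (s - b)%N <= g 0%N + g s.
  move=> bs; have := tel b 0%N; have := tel b (s - b)%N; rewrite subnK // add0n.
  have : \sum_(i < b) e (0 + i)%N <= \sum_(i < b) e (s - b + i)%N.
    apply: ler_sum => i _; apply: em; first by rewrite add0n leq_addl.
    by rewrite -[ltnRHS](subnK bs) ltn_add2l.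
  by lra.
have G : 2 * (\sum_(b < s.+1) g b) <= s.+1%:R * (g 0%N + g s).
  have -> : s.+1%:R * (g 0%N + g s) = \sum_(b < s.+1) (g 0%N + g s).
    by rewrite sumr_const card_ord mulr_natl.
  rewrite mulr_natl mulr2n {2}(reindex_inj rev_ord_inj) /= -big_split /=.
  by apply: ler_sum => i _; rewrite subSS gs // -ltnS.
(* An odd point is at most the mean of its even neighbours, so the odd sum is bounded by the
   trapezoidal sum of [g]. *)
have O : 2 * (\sum_(b < s) f b.*2.+1) <= 2 * (\sum_(b < s.+1) g b) - (g 0%N + g s).
  have -> : 2 * (\sum_(b < s.+1) g b) - (g 0%N + g s) = \sum_(b < s) (g b + g b.+1).
    rewrite big_split /= mulr_natl mulr2n {1}big_ord_recr big_ord_recl /=.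
    by rewrite /bump /=; set a := \sum_(_ < _) _; set b := \sum_(_ < _) _; ring.
  rewrite mulr_sumr; apply: ler_sum => b _; have := h b b.+1 (ltnW (ltn_ord b)) (ltn_ord b).
  by rewrite addnS addnn.
set S := \sum_(b < s.+1) g b in G O.
have E : \sum_(b < s.+1) f b.*2 = S by [].
have -> : s.*2.+1%:R = 2 * s%:R + 1 :> R by rewrite -natr1 -mul2n natrM.
move: G O; rewrite sum_odd_even E -natr1 -[f s.*2]/(g s) -[f 0%N]/(g 0%N).
set U := \sum_(b < s) _; set P := g 0%N + g s; lra.
Qed.

End TraceInequalities.

(** * Rademacher sums *)

Section Khintchine.
Context {R : realType}.
Local Notation C := R[i].

(** AM-GM for the inner product of [W^a A Y^(p-a)] and [W^c A Y^(p-c)] is exactly midpoint convexity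
    in [k] of the summand, so only the extreme terms, where [W] or [Y] is absent, survive. *)
Lemma ip_sandwich_le m (A W Y : 'M[C]_m) p :
  hermitian_mx A -> hermitian_mx W -> hermitian_mx Y ->
  2 * (\sum_(k < p.*2.+1) ip A (W ^+ k *m A *m Y ^+ (p.*2 - k))) <=
  p.*2.+1%:R * (ip (A *m Y ^+ p) (A *m Y ^+ p) + ip (A *m W ^+ p) (A *m W ^+ p)).
Proof.
move=> hA hW hY.
have hWk k : adjmx (W ^+ k) = W ^+ k by exact: hermitian_exp.
have hYk k : adjmx (Y ^+ k) = Y ^+ k by exact: hermitian_exp.
have F a b c e : ip (W ^+ a *m A *m Y ^+ b) (W ^+ c *m A *m Y ^+ e) =
    ip A (W ^+ (a + c) *m A *m Y ^+ (b + e)).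
  rewrite ip_mulr hYk ip_mull hWk; congr (ip A _).
  have D (Z : 'M[C]_m) k l : Z ^+ (k + l) = Z ^+ k *m Z ^+ l by exact: exprD.
  by rewrite (addnC b) !D !mulmxA.
pose f k := ip A (W ^+ k *m A *m Y ^+ (p.*2 - k)).
have f0 : f 0%N = ip (A *m Y ^+ p) (A *m Y ^+ p).
  by have := F 0 p 0 p; rewrite /f subn0 -addnn add0n !mul1mx.
have f1 : f p.*2 = ip (A *m W ^+ p) (A *m W ^+ p).
  have := F p 0 p 0; rewrite /f subnn -addnn add0n !mulmx1 => <-.
  have aW : adjmx (W ^+ p *m A) = A *m W ^+ p by rewrite adjmxM hWk hA.
  by rewrite -aW ip_adj.
rewrite -f0 -f1; apply: midconvex_sum_le => a c ap cp.
have fE : f (a + c)%N = ip (W ^+ a *m A *m Y ^+ (p - a)) (W ^+ c *m A *m Y ^+ (p - c)).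
  by rewrite F /f; congr (ip A (_ *m _ *m Y ^+ _)); lia.
have fD b : (b <= p)%N ->
    f b.*2 = ip (W ^+ b *m A *m Y ^+ (p - b)) (W ^+ b *m A *m Y ^+ (p - b)).
  move=> bp; rewrite F /f addnn; congr (ip A (_ *m _ *m Y ^+ _)); lia.
by rewrite fE !fD // ip_AMGM.
Qed.

Lemma exprB_telescope m (W Y : 'M[C]_m) k : W ^+ k.+1 - Y ^+ k.+1 =
  \sum_(i < k.+1) W ^+ i *m (W - Y) *m Y ^+ (k - i).
Proof.
elim: k => [|k IH]; first by rewrite big_ord1 subnn !expr0 mul1mx mulmx1 !expr1.
rewrite big_ord_recl subn0 expr0 mul1mx.
under eq_bigr => i _.
  rewrite /= /bump /= add1n subSS exprS -!mulmxA.
  over.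
rewrite -mulmx_sumr; under eq_bigr do rewrite mulmxA.
rewrite -IH mulmxBr mulmxBl -[W *m W ^+ _]exprS -[Y *m Y ^+ _]exprS.
by rewrite [in RHS]addrC addrA subrK.
Qed.

Definition rad n m (A : 'I_n -> 'M[C]_m) (e : {ffun 'I_n -> bool}) :=
  \sum_i (-1) ^+ e i *: A i.

Definition flip n (i : 'I_n) (e : {ffun 'I_n -> bool}) : {ffun 'I_n -> bool} :=
  [ffun j => (j == i) (+) e j].

Lemma flipK n (i : 'I_n) : involutive (flip i).
Proof. by move=> e; apply/ffunP => j; rewrite !ffunE addbA addbb. Qed.

Lemma hermitian_rad n m (A : 'I_n -> 'M[C]_m) e :
  (forall i, hermitian_mx (A i)) -> hermitian_mx (rad A e).
Proof. by move=> hA; apply: hermitian_sum => i _; exact: hermitian_sign. Qed.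

Lemma rad_flip n m (A : 'I_n -> 'M[C]_m) i e :
  rad A e - rad A (flip i e) = 2%:R *: ((-1) ^+ e i *: A i).
Proof.
rewrite /rad (bigD1 i) //= [X in _ - X](bigD1 i) //= ffunE eqxx /=.
rewrite [X in _ - (_ + X)](eq_bigr (fun j => (-1) ^+ e j *: A j)) => [|j ji].
  rewrite signrN scaleNr opprD opprK addrACA subrr addr0.
  by rewrite scaler_nat mulr2n.
by rewrite ffunE (negPf ji).
Qed.

(** Integration by parts: one factor [X] is expanded into its summands, and flipping the sign [e i]
    turns the [i]-th term into a difference of two powers of order [2p + 1]. It telescopes into
    [2p + 1] sandwiches, whence the factor. *)
Lemma rad_moment_step n m (A : 'I_n -> 'M[C]_m) p :
  (forall i, hermitian_mx (A i)) ->
  \sum_(e : {ffun 'I_n -> bool}) ip (rad A e ^+ p.+1) (rad A e ^+ p.+1) <=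
  p.*2.+1%:R * \sum_(e : {ffun 'I_n -> bool}) \sum_i ip (A i *m rad A e ^+ p) (A i *m rad A e ^+ p).
Proof.
move=> hA; pose X := rad A.
have hX e : hermitian_mx (X e) by exact: hermitian_rad.
have hXk e k : adjmx (X e ^+ k) = X e ^+ k by exact: hermitian_exp.
have E e : ip (X e ^+ p.+1) (X e ^+ p.+1) =
    \sum_i ip ((-1) ^+ e i *: A i) (X e ^+ p.*2.+1).
  rewrite -ip_suml -/(X e) {1}exprSr -[X e ^+ p * _]/(X e ^+ p *m X e) ip_mull hXk.
  by rewrite -[_ *m _]/(X e ^+ p * X e ^+ p.+1) -exprD addnS addnn.
rewrite -/X (eq_bigr _ (fun e _ => E e)) exchange_big /= [in leRHS]exchange_big /=.
rewrite mulr_sumr; apply: ler_sum => i _.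
(* Averaging [e] with [flip i e] negates the outer sign, which produces the difference of powers;
   the outer sign then cancels against the one from [rad_flip]. *)
have sym : 2 * (\sum_(e : {ffun 'I_n -> bool}) ip ((-1) ^+ e i *: A i) (X e ^+ p.*2.+1)) =
   \sum_(e : {ffun 'I_n -> bool}) 2 * \sum_(k < p.*2.+1) ip (A i) (X e ^+ k *m A i *m X (flip i e) ^+ (p.*2 - k)).
  rewrite mulr_natl mulr2n {2}(reindex_inj (inv_inj (flipK i))) -big_split /=.
  apply: eq_bigr => e _.
  have -> : (-1) ^+ flip i e i *: A i = - ((-1) ^+ e i *: A i).
    by rewrite ffunE eqxx signrN scaleNr.
  rewrite ipNl -ipNr -ipDr exprB_telescope ip_sumr mulr_sumr; apply: eq_bigr => k _.
  rewrite rad_flip; set s := (-1) ^+ e i; set Z := X e ^+ k.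
  rewrite -2!scalemxAr -2!scalemxAl.
  have -> : (2%:R : C) = (2%:R : R)%:C%C by rewrite rmorph_nat.
  rewrite ipZr; congr (_ * _).
  rewrite /s !scaler_sign; case: (e i) => //.
  by rewrite ipNl ipNr opprK.
have : 2 * (\sum_(e : {ffun 'I_n -> bool}) ip ((-1) ^+ e i *: A i) (X e ^+ p.*2.+1)) <=
   2 * (p.*2.+1%:R * \sum_(e : {ffun 'I_n -> bool}) ip (A i *m X e ^+ p) (A i *m X e ^+ p)).
  (* Both end terms have the same sum over sign vectors, by the change of variable [flip i]. *)
  rewrite sym; apply: (@le_trans _ _ (\sum_(e : {ffun 'I_n -> bool}) p.*2.+1%:R *
    (ip (A i *m X (flip i e) ^+ p) (A i *m X (flip i e) ^+ p) +
     ip (A i *m X e ^+ p) (A i *m X e ^+ p)))).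
    by apply: ler_sum => e _; exact: ip_sandwich_le.
  rewrite -mulr_sumr big_split /=.
  rewrite [X in _ * (_ + X)](reindex_inj (inv_inj (flipK i))) /=.
  rewrite [X in 2 * (_ * X)](reindex_inj (inv_inj (flipK i))) /=.
  by rewrite [leRHS]mulrCA (mulr_natl _ 2) [in leRHS]mulr2n.
by rewrite ler_pM2l.
Qed.

Lemma ipcolE m n (D : 'M[C]_(m, n)) : ip D D = \sum_j ip (col j D) (col j D).
Proof.
rewrite ipE exchange_big /=; apply: eq_bigr => j _; rewrite ipE.
by apply: eq_bigr => i _; rewrite big_ord1 !mxE.
Qed.

Lemma sum_ip_mulmx_le (I : finType) m k (A : I -> 'M[C]_m) (M : R) (B : 'M[C]_(m, k)) :
  (forall v : 'cV[C]_m, \sum_i ip (A i *m v) (A i *m v) <= M * ip v v) ->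
  \sum_i ip (A i *m B) (A i *m B) <= M * ip B B.
Proof.
move=> h; rewrite [ip B B]ipcolE mulr_sumr.
under eq_bigr do rewrite ipcolE; rewrite exchange_big /=; apply: ler_sum => j _.
by under eq_bigr do rewrite colE -mulmxA -colE; exact: h.
Qed.

(** Each step but the last costs a factor [M]; the remaining trace is kept as it is instead of being
    bounded by [m * M], since for the dilation the size [m] is far larger than the trace
    warrants. *)
Lemma rad_moment n m (A : 'I_n -> 'M[C]_m) (M : R) p :
  (forall i, hermitian_mx (A i)) -> 0 <= M ->
  (forall v : 'cV[C]_m, \sum_i ip (A i *m v) (A i *m v) <= M * ip v v) ->
  \sum_(e : {ffun 'I_n -> bool}) ip (rad A e ^+ p.+1) (rad A e ^+ p.+1) <=
  (\prod_(i < p.+1) i.*2.+1%:R) * M ^+ p *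
    \sum_(e : {ffun 'I_n -> bool}) \sum_i ip (A i) (A i).
Proof.
move=> hA M0 hM; elim: p => [|p IH].
  rewrite big_ord1 expr0 !mulr1 mul1r (le_trans (rad_moment_step 0 hA)) //.
  by rewrite mul1r; under eq_bigr do under eq_bigr do rewrite expr0 mulmx1.
apply: (le_trans (rad_moment_step p.+1 hA)).
rewrite big_ord_recr /= exprS [_ * p.+1.*2.+1%:R]mulrC -!mulrA ler_wpM2l //.
apply: (@le_trans _ _ (M * \sum_(e : {ffun 'I_n -> bool}) ip (rad A e ^+ p.+1) (rad A e ^+ p.+1))).
  by rewrite mulr_sumr; apply: ler_sum => e _; exact: sum_ip_mulmx_le.
by rewrite [leRHS]mulrCA ler_wpM2l // mulrA.
Qed.

End Khintchine.

(** * Numerical inequalities *)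

Section Numeric.
Context {R : realType}.

(** From [exp (-1/8) >= 7/8], raised to the eighth power: [(8/7)^8 < 3]. *)
Lemma expR1_le3 : expR 1 <= 3 :> R.
Proof.
have h8 : expR (8^-1) <= 8 / 7 :> R.
  have := expR_ge1Dx (- (8^-1) : R); rewrite expRN => h.
  have p := expR_gt0 (8^-1 : R).
  rewrite -(@ler_pM2r _ (expR 8^-1)^-1) ?invr_gt0 // divff ?gt_eqF //.
  by rewrite -ler_pdivrMl //; lra.
have -> : expR 1 = expR 8^-1 ^+ 8 :> R by rewrite -expRM_natl mulfV.
apply: (@le_trans _ _ ((8 / 7) ^+ 8)); first by rewrite lerXn2r ?nnegrE ?expR_ge0 //; lra.
by lra.
Qed.

(** Pairing [i] with [p - 1 - i] in the squared product, [(2i + 1) (2p - (2i + 1)) <= p^2]. *)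
Lemma prod_odd_le p : \prod_(i < p) i.*2.+1%:R <= p%:R ^+ p :> R.
Proof.
set P := \prod_(i < p) _.
have P0 : 0 <= P by apply: prodr_ge0.
rewrite -(@ler_sqr R) ?nnegrE ?exprn_ge0 // expr2 {2}/P (reindex_inj rev_ord_inj) /=.
rewrite /P -big_split /= -exprM mulnC exprM -[X in _ ^+ X]card_ord -prodr_const.
apply: ler_prod => i _; rewrite mulr_ge0 //=.
have -> : (p - i.+1).*2.+1%:R = 2 * p%:R - i.*2.+1%:R :> R.
  apply/eqP; rewrite eq_sym subr_eq -natrM -natrD eqr_nat; apply/eqP.
  have := ltn_ord i; lia.
have := sqr_ge0 (i.*2.+1%:R - p%:R : R); lra.
Qed.

(** One factor 3 per power bounds [e] and absorbs both [d] and the rounding of [r] up to [p]; the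
    other factor [3/2] absorbs the leading 2, as [(3/2)^p >= 2] for [p >= 2]. *)
Lemma khintchine_constant (d p : nat) (r : R) : 1 <= r -> r <= p%:R -> p%:R < r + 1 ->
  d%:R <= expR (r - 1) ->
  2 * d%:R * (\prod_(i < p) i.*2.+1%:R) <= (9 / 2 * r) ^+ p.
Proof.
move=> r1 rp pr dr; have r0 : 0 < r by lra.
(* For [p = 1] the slack [(3/2)^p] does not cover the factor 2; but then [r = 1], so [d <= 1]. *)
have [p1|p1] := leqP p 1.
  have p1E : p = 1%N by apply/eqP; rewrite eqn_leq p1 -(ltr_nat R) (lt_le_trans ltr01) // (le_trans r1).
  have r1E : r = 1 by apply/le_anti; rewrite r1 andbT (le_trans rp) // p1E.
  move: dr; rewrite r1E p1E subrr expR0 big_ord1 expr1 /= double0; lra.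
have ppos : 0 < p%:R :> R by lra.
have step : d%:R * p%:R ^+ p <= 3 ^+ p * r ^+ p.
  have -> : p%:R ^+ p = (p%:R / r) ^+ p * r ^+ p by rewrite -exprMn divfK ?gt_eqF.
  rewrite mulrA ler_wpM2r ?exprn_ge0 ?(ltW r0) //.
  have h : (p%:R / r) ^+ p <= expR (p%:R * (p%:R / r - 1)).
    rewrite expRM_natl lerXn2r ?nnegrE ?divr_ge0 ?(ltW r0) ?expR_ge0 //.
    by have := expR_ge1Dx (p%:R / r - 1); lra.
  apply: (@le_trans _ _ (expR (r - 1) * expR (p%:R * (p%:R / r - 1)))).
    by apply: ler_pM => //; apply: exprn_ge0; rewrite divr_ge0 // ltW.
  rewrite -expRD; apply: (@le_trans _ _ (expR p%:R)); last first.
    rewrite -[p%:R]mulr1 expRM_natl lerXn2r ?nnegrE ?expR_ge0 //; exact: expR1_le3.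
  rewrite ler_expR.
  (* Since [0 <= p - r < 1 <= r], the last term is at most 1 and the exponent at most [p]. *)
  have -> : r - 1 + p%:R * (p%:R / r - 1) = p%:R - 1 + (p%:R - r) ^+ 2 / r.
    by field; rewrite gt_eqF.
  have : (p%:R - r) ^+ 2 / r <= 1.
    rewrite ler_pdivrMr // mul1r (le_trans _ r1) // expr2 mulr_ile1 //; lra.
  lra.
apply: (@le_trans _ _ (2 * (d%:R * p%:R ^+ p))).
  by rewrite -mulrA !ler_wpM2l // prod_odd_le.
apply: (@le_trans _ _ (2 * (3 ^+ p * r ^+ p))); first by rewrite ler_wpM2l.
rewrite exprMn mulrA ler_wpM2r ?exprn_ge0 ?(ltW r0) //.
have -> : (9 / 2 : R) = 3 / 2 * 3 by lra.
rewrite exprMn ler_wpM2r ?exprn_ge0 // -(subnK p1) exprD.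
apply: (@le_trans _ _ (1 * (3 / 2) ^+ 2)); first by lra.
by rewrite ler_wpM2r ?sqr_ge0 // exprn_ege1 //; lra.
Qed.

(** Young's inequality for [u^s] and 1 with exponents [1/s] and [1/(1 - s)]; geometrically, the
    tangent of a concave power at 1. *)
Lemma powR_bernoulli (u s : R) : 0 <= u -> 0 < s -> s <= 1 -> u `^ s <= 1 + s * (u - 1).
Proof.
move=> u0 s0; rewrite le_eqVlt => /predU1P[->|s1]; first by rewrite powRr1 //; lra.
have := @conjugate_powR R (u `^ s) 1 s^-1 (1 - s)^-1 (powR_ge0 _ _) ler01.
rewrite !invr_gt0 subr_gt0 !invrK => /(_ s0 s1); rewrite subrKC => /(_ erefl).
by rewrite mulr1 -powRrM mulfV ?gt_eqF // powRr1 // powR1; lra.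
Qed.

(** Jensen for a concave power of a finite average. The tangent is taken at the upper bound [a] and
    not at the mean, so monotonicity is built in. *)
Lemma sum_powR_le (E : finType) (t : E -> R) (a s : R) : 0 < s -> s <= 1 -> 0 <= a ->
  (forall e, 0 <= t e) -> \sum_e t e <= #|E|%:R * a ->
  \sum_e t e `^ s <= #|E|%:R * a `^ s.
Proof.
move=> s0 s1 a0 t0 h; have [az|az] := eqVneq a 0.
  have tz e : t e = 0.
    apply/le_anti; rewrite t0 andbT (le_trans _ (le_trans h _)) ?az ?mulr0 //.
    by rewrite (bigD1 e) //= lerDl sumr_ge0.
  rewrite big1 ?mulr_ge0 ?powR_ge0 // => e _.
  by rewrite tz powR0 // gt_eqF.
have ap : 0 < a by rewrite lt_def az.
apply: (@le_trans _ _ (\sum_e a `^ s * (1 + s * (t e / a - 1)))).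
  apply: ler_sum => e _.
  have {1}-> : t e = a * (t e / a) by rewrite mulrC divfK.
  by rewrite powRM ?divr_ge0 // ler_wpM2l ?powR_ge0 // powR_bernoulli // divr_ge0.
rewrite -mulr_sumr mulrC ler_wpM2r ?powR_ge0 // big_split /= sumr_const.
rewrite -mulr_sumr sumrB sumr_const -mulr_suml -[1 *+ _]/(#|E|%:R).
by rewrite gerDl pmulr_rle0 // subr_le0 ler_pdivrMr.
Qed.

End Numeric.

(** * Moments of Rademacher sums and chaoses *)

Section RademacherBounds.
Context {R : realType}.
Local Notation C := R[i].

Lemma nat_ceil (r : R) : 1 <= r -> exists p : nat, r <= p.+1%:R /\ p.+1%:R < r + 1.
Proof.
move=> r1; have := truncn_itv (le_trans ler01 r1 : 0 <= r).
set k := Num.Def.truncn r => /andP[k1 k2].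
(* An integral [r] is its own ceiling; taking the next integer would violate the strict bound
   [p + 1 < r + 1]. *)
have [kr|kr] := eqVneq k%:R r; last first.
  exists k; rewrite ltW //; split => //; rewrite -natr1 ltrD2r.
  by rewrite lt_def eq_sym kr.
have : (0 < k)%N by rewrite -(ltr_nat R) kr (lt_le_trans ltr01).
case: k kr {k1 k2} => // k kr _; exists k; rewrite kr; split => //; lra.
Qed.

Lemma ip_unit d : ip (1%:M : 'M[C]_d) 1%:M = d%:R.
Proof. by rewrite /ip adjmx1 mul1mx mxtrace1 raddfMn. Qed.

Lemma sum_ip_trace_le (I : finType) m (A : I -> 'M[C]_m) (M : R) :
  (forall v : 'cV[C]_m, \sum_i ip (A i *m v) (A i *m v) <= M * ip v v) ->
  \sum_i ip (A i) (A i) <= m%:R * M.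
Proof.
move=> /(sum_ip_mulmx_le 1%:M); rewrite ip_unit mulrC.
by under eq_bigr do rewrite mulmx1.
Qed.

Variables (d : nat) (r : R).
Hypotheses (r1 : 1 <= r) (dr : d%:R <= expR (r - 1)).

(** The moment bound is used at the integer ceiling of [r] and brought down to [q] by concavity. The
    trace hypothesis carries [d], not the size [m], and the 2 in it leaves room for dilations. *)
Lemma rad_khintchine n m (A : 'I_n -> 'M[C]_m) (M q : R) :
  (forall i, hermitian_mx (A i)) -> 0 <= M -> 0 < q -> q <= r ->
  (forall v : 'cV[C]_m, \sum_i ip (A i *m v) (A i *m v) <= M * ip v v) ->
  \sum_i ip (A i) (A i) <= 2 * d%:R * M ->
  \sum_(e : {ffun 'I_n -> bool}) specnorm (rad A e) `^ (2 * q) <=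
  #|{ffun 'I_n -> bool}|%:R * (9 / 2 * r * M) `^ q.
Proof.
move=> hA M0 q0 qr hM hT.
have r0 : 0 < r by lra.
have [p [rp pr]] := nat_ceil r1.
have K0 : 0 <= 9 / 2 * r * M by rewrite mulr_ge0 // mulr_ge0 ?(ltW r0) //; lra.
have pp : 0 < p.+1%:R :> R by [].
have K := @sum_powR_le R _ (fun e => specnorm (rad A e) ^+ p.+1.*2)
   ((9 / 2 * r * M) ^+ p.+1) (q / p.+1%:R).
rewrite (_ : (_ `^ q) = ((9 / 2 * r * M) ^+ p.+1) `^ (q / p.+1%:R)); last first.
  by rewrite -powR_mulrn // -powRrM mulrCA mulfV ?mulr1 // gt_eqF.
rewrite (eq_bigr (fun e => (specnorm (rad A e) ^+ p.+1.*2) `^ (q / p.+1%:R))); last first.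
  move=> e _; rewrite -powR_mulrn ?specnorm_ge0 // -powRrM -mul2n natrM -mulrA.
  by rewrite (mulrCA p.+1%:R) mulfV ?mulr1 // gt_eqF.
apply: K => //.
- by rewrite divr_gt0.
- by rewrite ler_pdivrMr // mul1r (le_trans qr).
- exact: exprn_ge0.
- by move=> e; rewrite exprn_ge0 ?specnorm_ge0.
apply: (@le_trans _ _ (\sum_e ip (rad A e ^+ p.+1) (rad A e ^+ p.+1))).
  by apply: ler_sum => e _; apply: specnorm_exp_le => //; exact: hermitian_rad.
apply: (le_trans (rad_moment p hA M0 hM)).
rewrite sumr_const mulrnAr -mulr_natl ler_wpM2l //.
have P0 : 0 <= \prod_(i < p.+1) i.*2.+1%:R :> R by apply: prodr_ge0.
apply: (@le_trans _ _ ((\prod_(i < p.+1) i.*2.+1%:R) * M ^+ p * (2 * d%:R * M))).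
  by apply: ler_wpM2l => //; rewrite mulr_ge0 ?exprn_ge0.
rewrite [leRHS]exprMn (_ : _ * _ * (2 * d%:R * M) =
  (2 * d%:R * (\prod_(i < p.+1) i.*2.+1%:R)) * M ^+ p.+1); last by rewrite exprS; ring.
by rewrite ler_wpM2r ?exprn_ge0 // khintchine_constant.
Qed.

(** Since [(B^* B)^2 <= kap B^* B], the squares of the Gram matrices sum to at most [kap * L].
    Khintchine bounds the norm by the root of this, hence the exponent [q / 2]. *)
Lemma rad_gram_khintchine n m k (B : 'I_n -> 'M[C]_(k, m)) (kap L q : R) :
  0 <= kap -> 0 <= L -> 0 < q -> q <= r ->
  (forall j, specnorm (adjmx (B j) *m B j) <= kap) ->
  (forall v : 'cV[C]_m, \sum_j ip (B j *m v) (B j *m v) <= L * ip v v) ->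
  \sum_j ip (B j) (B j) <= 2 * d%:R * L ->
  \sum_(e : {ffun 'I_n -> bool}) specnorm (rad (fun j => adjmx (B j) *m B j) e) `^ q <=
  #|{ffun 'I_n -> bool}|%:R * (9 / 2 * r * (kap * L)) `^ (q / 2).
Proof.
move=> kap0 L0 q0 qr hkap hL hT.
have kapB j l (D : 'M[C]_(k, l)) : ip (adjmx (B j) *m D) (adjmx (B j) *m D) <= kap * ip D D.
  rewrite [ip D D]ipcolE [leLHS]ipcolE mulr_sumr; apply: ler_sum => c _.
  rewrite colE -mulmxA -colE; apply: ip_adj_le => // v.
  by rewrite (le_trans (ip_quad_gram_le _ _)) // ler_wpM2r ?ip_ge0.
have {1}-> : q = 2 * (q / 2) by field.
apply: rad_khintchine; rewrite ?mulr_ge0 ?divr_gt0 //; try lra.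
- by move=> j; exact: hermitian_gram.
- move=> v; apply: (@le_trans _ _ (\sum_j kap * ip (B j *m v) (B j *m v))).
    by apply: ler_sum => j _; rewrite -mulmxA kapB.
  by rewrite -mulr_sumr -mulrA ler_wpM2l.
- apply: (@le_trans _ _ (\sum_j kap * ip (B j) (B j))).
    by apply: ler_sum => j _; exact: kapB.
  by rewrite -mulr_sumr mulrCA ler_wpM2l.
Qed.

Lemma adjmx_mxcol n k l (F : 'I_n -> 'M[C]_(k, l)) :
  adjmx (\mxcol_i F i : 'M[C]_(\sum_(i < n) k, l)) = \mxrow_i adjmx (F i).
Proof. by apply/matrixP => i j; rewrite !mxE. Qed.

Lemma adjmx_mxrow n k l (F : 'I_n -> 'M[C]_(k, l)) :
  adjmx (\mxrow_i F i : 'M[C]_(k, \sum_(i < n) l)) = \mxcol_i adjmx (F i).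
Proof. by apply/matrixP => i j; rewrite !mxE. Qed.

Lemma ip_mxcol n k l (F : 'I_n -> 'M[C]_(k, l)) :
  ip (\mxcol_i F i : 'M[C]_(\sum_(i < n) k, l)) (\mxcol_i F i) = \sum_i ip (F i) (F i).
Proof. by rewrite /ip adjmx_mxcol mul_mxrow_mxcol (raddf_sum mxtrace) raddf_sum. Qed.

Lemma ip_mxrow n k l (F : 'I_n -> 'M[C]_(k, l)) :
  ip (\mxrow_i F i : 'M[C]_(k, \sum_(i < n) l)) (\mxrow_i F i) = \sum_i ip (F i) (F i).
Proof.
rewrite -ip_adj adjmx_mxrow ip_mxcol; apply: eq_bigr => i _; exact: ip_adj.
Qed.

Lemma ip_col_mx k1 k2 l (A : 'M[C]_(k1, l)) (B : 'M[C]_(k2, l)) :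
  ip (col_mx A B) (col_mx A B) = ip A A + ip B B.
Proof.
rewrite /ip (_ : adjmx (col_mx A B) = row_mx (adjmx A) (adjmx B)).
  by rewrite mul_row_col !raddfD.
by rewrite !adjmxE map_col_mx tr_col_mx.
Qed.

Section Chaos.
Variables (n : nat) (H : 'I_n -> 'I_n -> 'M[C]_d).
Hypothesis hH : forall i j, hermitian_mx (H i j).

(** [X i] is the Hermitian dilation of the [i]-th block row. Applied to [(v, 0)], the signed sum of
    the [X i] stacks the matrices [rad (H^~ j) e] acting on [v]; so its norm controls the variance
    of the chaos in the second family of signs. *)
Let B i : 'M[C]_(d, \sum_(j < n) d) := \mxrow_j H i j.
Let X i : 'M[C]_(d + \sum_(j < n) d) := block_mx 0 (B i) (adjmx (B i)) 0.

Let adjB i : adjmx (B i) = \mxcol_j H i j.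
Proof. by rewrite adjmx_mxrow; apply: eq_mxcol => j; exact: hH. Qed.

Let hX i : hermitian_mx (X i).
Proof.
rewrite /hermitian_mx /X adjmxE map_block_mx tr_block_mx -!adjmxE.
by rewrite adjmxK adjmx0 adjmx0.
Qed.

Let radX e (v : 'cV[C]_d) : rad X e *m col_mx v 0 =
  col_mx 0 (\mxcol_j (rad (H^~ j) e *m v)).
Proof.
rewrite /rad mulmx_suml.
transitivity (\sum_i col_mx (0 : 'cV[C]_d) ((-1) ^+ e i *: ((\mxcol_j H i j) *m v))).
  apply: eq_bigr => i _.
  by rewrite -scalemxAl mul_block_col !mulmx0 mul0mx !addr0 scale_col_mx scaler0 adjB.
have col0D : {morph (fun D : 'cV[C]_(\sum_(j < n) d) => col_mx (0 : 'cV[C]_d) D) : x y / x + y}.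
  by move=> x y; rewrite add_col_mx addr0.
rewrite -(big_morph _ col0D (col_mx0 _ _ _ _)); congr col_mx.
rewrite (eq_mxcol (fun j => mulmx_suml _ _ _ _)) mxcol_sum; apply: eq_bigr => i _.
by rewrite mxcol_mul; apply/matrixP => a b; rewrite [LHS]mxE [in LHS]mxE [RHS]mxE -scalemxAl [RHS]mxE.
Qed.

(** Given [e], Khintchine in [e'] has variance parameter [||rad X e||^2], and Khintchine in [e]
    bounds the moment of that. The two hypotheses on [N] are the two diagonal blocks of the sum of
    the [X i] squared. *)
Lemma rad_chaos (N q : R) : 0 <= N -> 0 < q -> q <= r ->
  (forall v : 'cV[C]_d, \sum_i \sum_j ip (H i j *m v) (H i j *m v) <= N * ip v v) ->
  (forall v : 'cV[C]_(\sum_(i < n) d), ip ((\mxblock_(i < n, j < n) H i j : 'M[C]_(\sum_(i < n) d)) *m v)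
    ((\mxblock_(i < n, j < n) H i j : 'M[C]_(\sum_(i < n) d)) *m v) <= N * ip v v) ->
  \sum_(e : {ffun 'I_n -> bool}) \sum_(e' : {ffun 'I_n -> bool})
     specnorm (rad (fun j => rad (H^~ j) e) e') `^ (2 * q) <=
  #|{ffun 'I_n -> bool}|%:R ^+ 2 * ((9 / 2 * r) ^+ 2 * N) `^ q.
Proof.
move=> N0 q0 qr h1 h2; have c0 : 0 <= 9 / 2 * r by lra.
have outer : \sum_(e : {ffun 'I_n -> bool}) specnorm (rad X e) `^ (2 * q) <=
  #|{ffun 'I_n -> bool}|%:R * (9 / 2 * r * N) `^ q.
  apply: rad_khintchine => //.
    move=> v; rewrite -(vsubmxK v); set v1 := usubmx v; set v2 := dsubmx v.
    under eq_bigr => i _.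
      rewrite mul_block_col !mul0mx add0r addr0 ip_col_mx addrC.
      over.
    rewrite big_split /= ip_col_mx mulrDr lerD //.
      apply: le_trans (h1 v1); apply: ler_sum => i _.
      by rewrite adjB mxcol_mul ip_mxcol.
    by apply: le_trans (h2 v2); rewrite mxblockEv mxcol_mul ip_mxcol.
  have iX i : ip (X i) (X i) = 2 * \sum_j ip (H i j) (H i j).
    rewrite /ip hX /X mulmx_block !mul0mx !mulmx0 !add0r !addr0 mxtrace_block raddfD /=.
    have -> : complex.Re (\tr (B i *m adjmx (B i))) = ip (adjmx (B i)) (adjmx (B i)).
      by rewrite /ip adjmxK.
    by rewrite -/(ip (B i) (B i)) ip_adj ip_mxrow -mulr2n mulr_natl.
  under eq_bigr do rewrite iX.
  (* The trace of the squared dilations is twice that of all [H i j] squared, which are matrices of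
     size [d]; this removes [n]. *)
  rewrite -mulr_sumr -mulrA ler_wpM2l // pair_big_dep /=.
  apply: (@sum_ip_trace_le _ _ (fun p => H p.1 p.2)) => v.
  by apply: le_trans (h1 v); rewrite pair_big_dep.
have inner e : \sum_(e' : {ffun 'I_n -> bool})
     specnorm (rad (fun j => rad (H^~ j) e) e') `^ (2 * q) <=
     #|{ffun 'I_n -> bool}|%:R * ((9 / 2 * r) `^ q * specnorm (rad X e) `^ (2 * q)).
  rewrite (_ : _ `^ q * _ = (9 / 2 * r * specnorm (rad X e) ^+ 2) `^ q); last first.
    by rewrite [in RHS]powRM ?sqr_ge0 // powRrM (powR_mulrn 2) ?specnorm_ge0.
  have hv (v : 'cV[C]_d) : \sum_j ip (rad (H^~ j) e *m v) (rad (H^~ j) e *m v) <=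
      specnorm (rad X e) ^+ 2 * ip v v.
    have := ip_mul_specnorm (rad X e) (col_mx v 0).
    by rewrite radX !ip_col_mx !ip0r addr0 add0r ip_mxcol.
  apply: rad_khintchine => //.
  - by move=> j; apply: hermitian_rad.
  - exact: sqr_ge0.
  - apply: (le_trans (sum_ip_trace_le hv)); rewrite ler_wpM2r ?sqr_ge0 //.
    by have := ler0n R d; lra.
apply: (le_trans (ler_sum _ (fun e _ => inner e))).
rewrite -mulr_sumr -mulr_sumr [in leRHS](expr2 #|_|%:R) -[leRHS]mulrA ler_wpM2l //.
apply: (@le_trans _ _ ((9 / 2 * r) `^ q * (#|{ffun 'I_n -> bool}|%:R * (9 / 2 * r * N) `^ q))).
  by rewrite ler_wpM2l ?powR_ge0.
rewrite (_ : (9 / 2 * r) ^+ 2 * N = (9 / 2 * r) * (9 / 2 * r * N)); last by ring.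
rewrite [X in _ <= _ * X]powRM ?(mulr_ge0 c0 N0) //.
by rewrite mulrCA.
Qed.

End Chaos.
End RademacherBounds.

(** * Measurability and expectation of random matrices *)

Section MatrixMeasurability.
Context {R : realType} {dT : measure_display} {T : measurableType dT}.
Local Notation C := R[i].

Lemma mx_measurable_cst m n (A : 'M[C]_(m, n)) : mx_measurable (fun _ : T => A).
Proof. by move=> a b; split. Qed.

Lemma mx_measurableD m n (F G : T -> 'M[C]_(m, n)) :
  mx_measurable F -> mx_measurable G -> mx_measurable (fun x => F x + G x).
Proof.
move=> mF mG a b; have [F1 F2] := mF a b; have [G1 G2] := mG a b.
split.
  rewrite (_ : (fun x => _) = (fun x => complex.Re (F x a b)) \+ (fun x => complex.Re (G x a b))).
    exact: measurable_funD.
  by apply/funext => x; rewrite mxE /= raddfD.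
rewrite (_ : (fun x => _) = (fun x => complex.Im (F x a b)) \+ (fun x => complex.Im (G x a b))).
  exact: measurable_funD.
by apply/funext => x; rewrite mxE /= raddfD.
Qed.

Lemma mx_measurable_sum m n I (s : seq I) (P : pred I) (F : I -> T -> 'M[C]_(m, n)) :
  (forall i, P i -> mx_measurable (F i)) ->
  mx_measurable (fun x => \sum_(i <- s | P i) F i x).
Proof.
move=> mF; elim: s => [|i s IH].
  have -> : (fun x : T => \sum_(i <- [::] | P i) F i x) = (fun=> 0).
    by apply/funext => x; rewrite big_nil.
  exact: mx_measurable_cst.
have -> : (fun x : T => \sum_(j <- i :: s | P j) F j x) =
    (fun x => if P i then F i x + \sum_(j <- s | P j) F j x else \sum_(j <- s | P j) F j x).
  by apply/funext => x; rewrite big_cons.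
by have := mF i; case: (P i) => // mFi; apply: mx_measurableD => //; exact: mFi.
Qed.

Lemma mx_measurableM m n p (F : T -> 'M[C]_(m, n)) (G : T -> 'M[C]_(n, p)) :
  mx_measurable F -> mx_measurable G -> mx_measurable (fun x => F x *m G x).
Proof.
move=> mF mG.
have -> : (fun x => F x *m G x) =
    (fun x => \sum_k \matrix_(a, b) (F x a k * G x k b)).
  apply/funext => x; apply/matrixP => a b; rewrite !mxE summxE.
  by apply: eq_bigr => k _; rewrite mxE.
apply: mx_measurable_sum => k _ a b.
have [F1 F2] := mF a k; have [G1 G2] := mG k b.
split.
  rewrite (_ : (fun x => _) = (fun x => complex.Re (F x a k)) \* (fun x => complex.Re (G x k b))
    \- (fun x => complex.Im (F x a k)) \* (fun x => complex.Im (G x k b))).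
    by apply: measurable_funB; exact: measurable_funM.
  by apply/funext => x; rewrite mxE /=; case: (F x a k) (G x k b) => ? ? [].
rewrite (_ : (fun x => _) = (fun x => complex.Re (F x a k)) \* (fun x => complex.Im (G x k b))
    \+ (fun x => complex.Im (F x a k)) \* (fun x => complex.Re (G x k b))).
  by apply: measurable_funD; exact: measurable_funM.
by apply/funext => x; rewrite mxE /=; case: (F x a k) (G x k b) => ? ? [].
Qed.

Lemma mx_measurable_adj m n (F : T -> 'M[C]_(m, n)) :
  mx_measurable F -> mx_measurable (fun x => adjmx (F x)).
Proof.
move=> mF a b; have [F1 F2] := mF b a; split.
  by rewrite (_ : (fun x => _) = fun x => complex.Re (F x b a)) //;
     apply/funext => x; rewrite mxE.
rewrite (_ : (fun x => _) = -%R \o fun x => complex.Im (F x b a)).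
  exact: measurableT_comp.
by apply/funext => x; rewrite mxE.
Qed.

Lemma mx_measurableN m n (F : T -> 'M[C]_(m, n)) :
  mx_measurable F -> mx_measurable (fun x => - F x).
Proof.
move=> mF a b; have [F1 F2] := mF a b; split.
  rewrite (_ : (fun x => _) = -%R \o fun x => complex.Re (F x a b)).
    exact: measurableT_comp.
  by apply/funext => x; rewrite mxE raddfN.
rewrite (_ : (fun x => _) = -%R \o fun x => complex.Im (F x a b)).
  exact: measurableT_comp.
by apply/funext => x; rewrite mxE raddfN.
Qed.

Lemma mx_measurableB m n (F G : T -> 'M[C]_(m, n)) :
  mx_measurable F -> mx_measurable G -> mx_measurable (fun x => F x - G x).
Proof. by move=> mF mG; apply: mx_measurableD => //; exact: mx_measurableN. Qed.

Lemma mx_measurable_sign m n (b : bool) (F : T -> 'M[C]_(m, n)) :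
  mx_measurable F -> mx_measurable (fun x => (-1) ^+ b *: F x).
Proof.
move=> mF; under eq_fun do rewrite scaler_sign.
by case: b => //; exact: mx_measurableN.
Qed.

Lemma mx_measurable_rad n m (A : 'I_n -> T -> 'M[C]_m) e :
  (forall i, mx_measurable (A i)) -> mx_measurable (fun x => rad (A^~ x) e).
Proof. by move=> mA; apply: mx_measurable_sum => i _; exact: mx_measurable_sign. Qed.

Lemma mx_measurable_comp d' (T' : measurableType d') m n (F : T -> 'M[C]_(m, n)) (g : T' -> T) :
  mx_measurable F -> measurable_fun setT g -> mx_measurable (F \o g).
Proof.
move=> mF mg a b; have [F1 F2] := mF a b.
by split; [exact: (measurableT_comp F1 mg)|exact: (measurableT_comp F2 mg)].
Qed.

Lemma measurable_ip m n (F G : T -> 'M[C]_(m, n)) :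
  mx_measurable F -> mx_measurable G -> measurable_fun setT (fun x => ip (F x) (G x)).
Proof.
move=> mF mG; under eq_fun do rewrite ipE.
apply: measurable_sum => a; apply: measurable_sum => b.
have [F1 F2] := mF a b; have [G1 G2] := mG a b.
by apply: measurable_funD; exact: measurable_funM.
Qed.

Lemma mx_measurableX m (F : T -> 'M[C]_m) k :
  mx_measurable F -> mx_measurable (fun x => F x ^+ k).
Proof.
move=> mF; elim: k => [|k IH]; first exact: mx_measurable_cst.
by under eq_fun do rewrite exprS; exact: mx_measurableM.
Qed.

Lemma ip_exp_le m (A : 'M[C]_m) k : ip (A ^+ k) (A ^+ k) <= m%:R * specnorm A ^+ k.*2.
Proof.
elim: k => [|k IH]; first by rewrite !expr0 mulr1 ip_unit.
rewrite exprS -[A * _]/(A *m _) (le_trans (ip_mulmx_specnorm _ _)) //.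
by rewrite (le_trans (ler_wpM2l (sqr_ge0 _) IH)) // mulrCA -exprD.
Qed.

(** The norm is a supremum over an uncountable ball; this describes its superlevel sets by countably
    many polynomial conditions on the entries. The trace of [A^(2k)] lies between [||A||^(2k)] and
    [m ||A||^(2k)], and [(||A|| / c)^(2k)] eventually exceeds [m]. *)
Lemma specnorm_gt_exists m (A : 'M[C]_m) (c : R) : hermitian_mx A -> 0 <= c ->
  c < specnorm A <-> exists k, m%:R * c ^+ k.+1.*2 < ip (A ^+ k.+1) (A ^+ k.+1).
Proof.
move=> hA c0; split=> [cA|[k h]]; last first.
  rewrite ltNge; apply/negP => h'; move: h; rewrite ltNge => /negP; apply.
  apply: (le_trans (ip_exp_le _ _)); rewrite ler_wpM2l // lerXn2r ?nnegrE //.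
  exact: specnorm_ge0.
suff [k hk] : exists k, m%:R * c ^+ k.+1.*2 < specnorm A ^+ k.+1.*2.
  by exists k; rewrite (lt_le_trans hk) // specnorm_exp_le.
have s0 : 0 < specnorm A by rewrite (le_lt_trans c0).
have [cz|cz] := eqVneq c 0.
  by exists 0%N; rewrite cz expr0n /= mulr0 exprn_gt0.
have cp : 0 < c by rewrite lt_def cz.
pose u := specnorm A / c - 1.
have up : 0 < u by rewrite subr_gt0 ltr_pdivlMr // mul1r.
pose k := Num.bound (m%:R / u); exists k.
have mk : m%:R < k%:R * u.
  rewrite -ltr_pdivrMr //; exact: archi_boundP (divr_ge0 (ler0n _ _) (ltW up)).
rewrite -ltr_pdivlMr ?exprn_gt0 // -expr_div_n.
have -> : specnorm A / c = 1 + u by rewrite /u addrC subrK.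
have bern j : 1 + j%:R * u <= (1 + u) ^+ j.
  elim: j => [|j IH]; first by rewrite mul0r addr0 expr0.
  rewrite exprS; apply: (@le_trans _ _ ((1 + u) * (1 + j%:R * u))); last first.
    by rewrite ler_wpM2l //; lra.
  rewrite -natr1; have := mulr_ge0 (ler0n R j) (sqr_ge0 u); lra.
apply: (lt_le_trans mk); apply: le_trans (bern _).
have : (k%:R : R) <= k.+1.*2%:R by rewrite ler_nat; lia.
by move=> kk; have := ler_wpM2r (ltW up) kk; lra.
Qed.

Lemma measurable_specnorm_hermitian m (F : T -> 'M[C]_m) :
  (forall x, hermitian_mx (F x)) -> mx_measurable F ->
  measurable_fun setT (fun x => specnorm (F x)).
Proof.
move=> hF mF mD; apply: (measurability _ (RGenOInfty.measurableE R)) => //.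
move=> _ [_ [c ->] <-]; rewrite setTI.
have [c0|c0] := ltP c 0.
  rewrite (_ : _ @^-1` _ = setT) //; apply/seteqP; split => // x _ /=.
  by rewrite in_itv /= andbT (lt_le_trans c0) // specnorm_ge0.
rewrite (_ : _ @^-1` _ = \bigcup_k
  ((fun x => ip (F x ^+ k.+1) (F x ^+ k.+1)) @^-1` `]m%:R * c ^+ k.+1.*2, +oo[)).
  apply: bigcupT_measurable => k; rewrite -[X in measurable X]setTI.
  by apply: measurable_ip => //; exact: mx_measurableX.
apply/seteqP; split => x /=.
  by rewrite in_itv /= andbT => /(specnorm_gt_exists (hF x) c0)[k hk]; exists k => //=;
    rewrite in_itv /= hk.
move=> [k _ /=]; rewrite in_itv /= andbT => hk.
by rewrite in_itv /= andbT; apply/(specnorm_gt_exists (hF x) c0); exists k.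
Qed.

(** Reduces the measurability of the norm to the Hermitian case. *)
Lemma specnorm_sqrt_gram m (A : 'M[C]_m) : specnorm A = Num.sqrt (specnorm (adjmx A *m A)).
Proof.
apply/le_anti/andP; split.
  apply: specnorm_le => [|v]; first exact: sqrtr_ge0.
  by rewrite sqr_sqrtr ?specnorm_ge0 // ip_quad_gram_le.
rewrite -[leRHS]ger0_norm ?specnorm_ge0 // -sqrtr_sqr ler_sqrt ?sqr_ge0 //.
by apply: specnorm_gram_le; [exact: sqr_ge0|exact: ip_mul_specnorm].
Qed.

Lemma measurable_specnorm m (F : T -> 'M[C]_m) :
  mx_measurable F -> measurable_fun setT (fun x => specnorm (F x)).
Proof.
move=> mF.
have -> : (fun x => specnorm (F x)) =
    (@powR R ^~ 2^-1) \o (fun x => specnorm (adjmx (F x) *m F x)).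
  by apply/funext => x /=; rewrite powR12_sqrt ?specnorm_ge0 // -specnorm_sqrt_gram.
apply: measurableT_comp; first exact: measurable_powR.
apply: measurable_specnorm_hermitian => [x|]; first exact: hermitian_gram.
by apply: mx_measurableM => //; exact: mx_measurable_adj.
Qed.

Lemma measurable_specnorm_powR m (F : T -> 'M[C]_m) p :
  mx_measurable F -> measurable_fun setT (fun x => (specnorm (F x) `^ p)%:E).
Proof.
move=> mF; apply/measurable_EFinP.
apply: (measurableT_comp (f := @powR R ^~ p)); first exact: measurable_powR.
exact: measurable_specnorm.
Qed.

End MatrixMeasurability.

(** * Expectation of matrices and Jensen's inequality *)

Section MatrixExpectation.
Context {R : realType} {dT : measure_display} {T : measurableType dT}.
Local Notation C := R[i].
Implicit Types mu : {measure set T -> \bar R}.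

Lemma mx_integrable_measurable mu m n (F : T -> 'M[C]_(m, n)) :
  mx_integrable mu F -> mx_measurable F.
Proof.
move=> iF a b; have [i1 i2] := iF a b.
by split; apply/measurable_EFinP; [exact: measurable_int i1|exact: measurable_int i2].
Qed.

Lemma integrable_sum_EFin mu I (s : seq I) (f : I -> T -> R) :
  (forall i, mu.-integrable setT (EFin \o f i)) ->
  mu.-integrable setT (fun x => (\sum_(i <- s) f i x)%:E).
Proof.
move=> h; rewrite (_ : (fun x => _) = fun x => (\sum_(i <- s) (EFin \o f i) x)%E).
  exact: integrable_sum.
by apply/funext => x; rewrite sumEFin.
Qed.

Lemma Rintegral_sum mu I (s : seq I) (f : I -> T -> R) :
  (forall i, mu.-integrable setT (EFin \o f i)) ->
  Rintegral mu setT (fun x => \sum_(i <- s) f i x) = \sum_(i <- s) Rintegral mu setT (f i).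
Proof.
move=> h; elim: s => [|i s IH].
  by under eq_Rintegral do rewrite big_nil; rewrite big_nil /Rintegral integral0.
under eq_Rintegral do rewrite big_cons.
rewrite RintegralD ?big_cons ?IH //; exact: integrable_sum_EFin.
Qed.

Lemma mx_integrableD mu m n (F G : T -> 'M[C]_(m, n)) :
  mx_integrable mu F -> mx_integrable mu G -> mx_integrable mu (fun x => F x + G x).
Proof.
move=> iF iG a b; have [F1 F2] := iF a b; have [G1 G2] := iG a b; split.
  apply: eq_integrable (integrableD measurableT F1 G1) => // x _ /=.
  by rewrite mxE -EFinD; case: (F x a b) (G x a b) => ? ? [].
apply: eq_integrable (integrableD measurableT F2 G2) => // x _ /=.
by rewrite mxE -EFinD; case: (F x a b) (G x a b) => ? ? [].
Qed.

Lemma mx_expectD mu m n (F G : T -> 'M[C]_(m, n)) :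
  mx_integrable mu F -> mx_integrable mu G ->
  mx_expect mu (fun x => F x + G x) = mx_expect mu F + mx_expect mu G.
Proof.
move=> iF iG; apply/matrixP => a b; have [F1 F2] := iF a b; have [G1 G2] := iG a b.
rewrite !mxE /cexpect; apply/eqP; rewrite eq_complex /=; apply/andP; split; apply/eqP.
  rewrite -RintegralD //; apply: eq_Rintegral => x _.
  by rewrite mxE; case: (F x a b) (G x a b) => ? ? [].
rewrite -RintegralD //; apply: eq_Rintegral => x _.
by rewrite mxE; case: (F x a b) (G x a b) => ? ? [].
Qed.

Lemma mx_integrable0 mu m n : mx_integrable mu (fun _ : T => 0 : 'M[C]_(m, n)).
Proof.
by move=> a b; split; apply: eq_integrable (integrable0 mu setT) => // x _; rewrite mxE.
Qed.

Lemma mx_expect0 mu m n : mx_expect mu (fun _ : T => 0 : 'M[C]_(m, n)) = 0.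
Proof.
apply/matrixP => a b; rewrite !mxE /cexpect; apply/eqP; rewrite eq_complex /=.
by rewrite /Rintegral integral0 eqxx.
Qed.

Lemma mx_integrableN mu m n (F : T -> 'M[C]_(m, n)) :
  mx_integrable mu F -> mx_integrable mu (fun x => - F x).
Proof.
move=> iF a b; have [F1 F2] := iF a b; split.
  by apply: eq_integrable (integrableN F1) => // x _ /=; rewrite mxE raddfN.
by apply: eq_integrable (integrableN F2) => // x _ /=; rewrite mxE raddfN.
Qed.

Lemma mx_expectN mu m n (F : T -> 'M[C]_(m, n)) :
  mx_integrable mu F -> mx_expect mu (fun x => - F x) = - mx_expect mu F.
Proof.
move=> iF; apply/eqP; rewrite -addr_eq0 -mx_expectD ?mx_expect0 //; last exact: mx_integrableN.
rewrite (_ : (fun x => _) = fun=> 0) ?mx_expect0 //.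
by apply/funext => x; rewrite addNr.
Qed.

Lemma mx_integrable_sign mu m n (b : bool) (F : T -> 'M[C]_(m, n)) :
  mx_integrable mu F -> mx_integrable mu (fun x => (-1) ^+ b *: F x).
Proof.
move=> iF; rewrite (_ : (fun x => _) = fun x => if b then - F x else F x).
  by case: b => //; exact: mx_integrableN.
by apply/funext => x; rewrite scaler_sign.
Qed.

Lemma mx_expect_sign mu m n (b : bool) (F : T -> 'M[C]_(m, n)) :
  mx_integrable mu F -> mx_expect mu (fun x => (-1) ^+ b *: F x) = (-1) ^+ b *: mx_expect mu F.
Proof.
move=> iF; rewrite (_ : (fun x => _) = fun x => if b then - F x else F x).
  by rewrite scaler_sign; case: b => //; exact: mx_expectN.
by apply/funext => x; rewrite scaler_sign.
Qed.

Lemma mx_integrable_sum mu m n I (s : seq I) (P : pred I) (F : I -> T -> 'M[C]_(m, n)) :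
  (forall i, P i -> mx_integrable mu (F i)) ->
  mx_integrable mu (fun x => \sum_(i <- s | P i) F i x).
Proof.
move=> iF; elim: s => [|i s IH].
  have -> : (fun x : T => \sum_(i <- [::] | P i) F i x) = (fun=> 0).
    by apply/funext => x; rewrite big_nil.
  exact: mx_integrable0.
have -> : (fun x : T => \sum_(j <- i :: s | P j) F j x) =
    (fun x => if P i then F i x + \sum_(j <- s | P j) F j x else \sum_(j <- s | P j) F j x).
  by apply/funext => x; rewrite big_cons.
by have := iF i; case: (P i) => // iFi; apply: mx_integrableD => //; exact: iFi.
Qed.

Lemma mx_expect_sum mu m n I (s : seq I) (P : pred I) (F : I -> T -> 'M[C]_(m, n)) :
  (forall i, P i -> mx_integrable mu (F i)) ->
  mx_expect mu (fun x => \sum_(i <- s | P i) F i x) = \sum_(i <- s | P i) mx_expect mu (F i).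
Proof.
move=> iF; elim: s => [|i s IH].
  have -> : (fun x : T => \sum_(i <- [::] | P i) F i x) = (fun=> 0).
    by apply/funext => x; rewrite big_nil.
  by rewrite mx_expect0 big_nil.
have -> : (fun x : T => \sum_(j <- i :: s | P j) F j x) =
    (fun x => if P i then F i x + \sum_(j <- s | P j) F j x else \sum_(j <- s | P j) F j x).
  by apply/funext => x; rewrite big_cons.
rewrite big_cons; have := iF i; case: (P i) => // iFi.
by rewrite mx_expectD ?IH //; [exact: iFi|exact: mx_integrable_sum].
Qed.

Lemma mx_integrable_cst (P : probability T R) m n (A : 'M[C]_(m, n)) :
  mx_integrable P (fun=> A).
Proof. by move=> a b; split; exact: finite_measure_integrable_cst. Qed.

Lemma mx_expect_cst (P : probability T R) m n (A : 'M[C]_(m, n)) :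
  mx_expect P (fun=> A) = A.
Proof.
have E (c : R) : Rintegral P setT (fun=> c) = c.
  by rewrite Rintegral_cst // [X in fine X](probability_setT P) mulr1.
by apply/matrixP => a b; rewrite mxE /cexpect !E; case: (A a b).
Qed.

Lemma integrable_ip mu m n (D : 'M[C]_(m, n)) (F : T -> 'M[C]_(m, n)) :
  mx_integrable mu F -> mu.-integrable setT (fun x => (ip D (F x))%:E).
Proof.
move=> iF; rewrite (_ : (fun x => _) = fun x => (\sum_a \sum_b
   (complex.Re (D a b) * complex.Re (F x a b) + complex.Im (D a b) * complex.Im (F x a b)))%:E).
  apply: integrable_sum_EFin => a; apply: integrable_sum_EFin => b.
  have [F1 F2] := iF a b.
  exact: (integrableD measurableT (integrableZl measurableT _ F1) (integrableZl measurableT _ F2)).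
by apply/funext => x; rewrite ipE.
Qed.

Lemma Rintegral_ip mu m n (D : 'M[C]_(m, n)) (F : T -> 'M[C]_(m, n)) :
  mx_integrable mu F -> Rintegral mu setT (fun x => ip D (F x)) = ip D (mx_expect mu F).
Proof.
move=> iF; under eq_Rintegral do rewrite ipE.
have i1 a b := integrableZl measurableT (complex.Re (D a b)) (iF a b).1.
have i2 a b := integrableZl measurableT (complex.Im (D a b)) (iF a b).2.
have i12 a b := integrableD measurableT (i1 a b) (i2 a b).
rewrite Rintegral_sum; last by move=> a; apply: integrable_sum_EFin => b; exact: i12.
rewrite ipE; apply: eq_bigr => a _; rewrite Rintegral_sum; last by move=> b; exact: i12.
apply: eq_bigr => b _; rewrite RintegralD //; [|exact: i1|exact: i2].
have [F1 F2] := iF a b.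
by rewrite !RintegralZl // mxE.
Qed.

Lemma specnorm_expect_le mu m (F : T -> 'M[C]_m) : mx_integrable mu F ->
  ((specnorm (mx_expect mu F))%:E <= \int[mu]_x (specnorm (F x))%:E)%E.
Proof.
move=> iF; have mF := mx_integrable_measurable iF.
have ms : measurable_fun setT (EFin \o (fun x => specnorm (F x))).
  by apply/measurable_EFinP; exact: measurable_specnorm.
set I := (\int[mu]_x _)%E.
have I0 : (0 <= I)%E by apply: integral_ge0 => x _; rewrite lee_fin specnorm_ge0.
have [->|Ioo] := eqVneq I +oo%E; first by rewrite leey.
have iS : mu.-integrable setT (EFin \o (fun x => specnorm (F x))).
  apply/integrableP; split => //; rewrite (_ : integral _ _ _ = I) ?ltey //.
  by apply: eq_integral => x _ /=; rewrite ger0_norm ?specnorm_ge0.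
have IE : I = (fine I)%:E by rewrite fineK // ge0_fin_numE // ltey.
rewrite IE lee_fin; set s := fine I.
have s0 : 0 <= s by exact: fine_ge0.
apply: specnorm_le => // v; set u := mx_expect mu F *m v.
have uE : ip u u = Rintegral mu setT (fun x => ip (u *m adjmx v) (F x)).
  by rewrite Rintegral_ip // ip_mulr adjmxK.
have ub : ip u u <= vnorm u * vnorm v * s.
  rewrite uE (_ : _ * s = Rintegral mu setT (fun x => vnorm u * vnorm v * specnorm (F x))).
    apply: le_Rintegral => //.
    - exact: integrable_ip.
    - exact: (integrableZl measurableT (vnorm u * vnorm v) iS).
    - move=> x _; rewrite ip_mulr adjmxK (le_trans (ler_norm _)) //.
      rewrite -(@ler_sqr R) ?nnegrE ?mulr_ge0 ?vnorm_ge0 ?specnorm_ge0 //.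
      rewrite real_normK ?num_real // (le_trans (ip_CS _ _)) // -mulrA exprMn sqr_vnorm.
      by rewrite ler_wpM2l ?ip_ge0 // mulrC exprMn sqr_vnorm ip_mul_specnorm.
  by rewrite RintegralZl.
rewrite -le_vnorm //; have [u0|u0] := eqVneq (vnorm u) 0.
  by rewrite u0 mulr_ge0 ?vnorm_ge0.
have up : 0 < vnorm u by rewrite lt_def u0 vnorm_ge0.
by move: ub; rewrite -sqr_vnorm expr2 -mulrA ler_pM2l // mulrC.
Qed.

(** Hölder against the constant 1; [p = 1] is separate because its conjugate exponent is
    infinite. *)
Lemma integral_powR_jensen (P : probability T R) (f : T -> R) p : 1 <= p ->
  (forall x, 0 <= f x) -> measurable_fun setT f ->
  ((\int[P]_x (f x)%:E) `^ p <= \int[P]_x (f x `^ p)%:E)%E.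
Proof.
move=> p1 f0 mf; have p0 : 0 < p by rewrite (lt_le_trans ltr01).
have If0 : (0 <= \int[P]_x (f x `^ p)%:E)%E.
  by apply: integral_ge0 => x _; rewrite lee_fin powR_ge0.
have I0 : (0 <= \int[P]_x (f x)%:E)%E by apply: integral_ge0 => x _; rewrite lee_fin.
move: p1; rewrite le_eqVlt => /predU1P[<-|p1].
  by rewrite poweRe1 //; under [leRHS]eq_integral do rewrite powRr1 //.
pose p' := p / (p - 1).
have p'0 : 0 < p' by rewrite divr_gt0 // subr_gt0.
have pp : p^-1 + p'^-1 = 1.
  by rewrite /p' invf_div; field; rewrite gt_eqF.
have := hoelder P mf (measurable_cst (1 : R)) p0 p'0 pp.
rewrite Lnorm1 (_ : EFin \o cst 1 = cst 1%E) // Lnorm_cst1 [X in (X `^ _)%E](probability_setT P) poweR1r mule1.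
rewrite (_ : integral _ _ _ = \int[P]_x (f x)%:E)%E; last first.
  by apply: eq_integral => x _ /=; rewrite mulr1 ger0_norm.
have E2 : (\int[P]_x (`|(EFin \o f) x| `^ p) = \int[P]_x (f x `^ p)%:E)%E.
  by apply: eq_integral => x _; rewrite gee0_abs ?lee_fin // poweR_EFin.
rewrite unlock E2.
move=> h; rewrite -[leRHS]poweRe1 // -(mulVf (lt0r_neq0 p0)) poweRrM.
by apply: gt0_ler_poweR => //; rewrite ?(ltW p0) ?in_itv /= ?leey ?I0 ?poweR_ge0.
Qed.

Lemma specnorm_powR_expect_le (P : probability T R) m (F : T -> 'M[C]_m) p : 1 <= p ->
  mx_integrable P F ->
  ((specnorm (mx_expect P F) `^ p)%:E <= \int[P]_x (specnorm (F x) `^ p)%:E)%E.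
Proof.
move=> p1 iF; have p0 : 0 < p by rewrite (lt_le_trans ltr01).
apply: le_trans (@integral_powR_jensen P (fun x => specnorm (F x)) p p1 _ _).
- rewrite -poweR_EFin; apply: gt0_ler_poweR; rewrite ?(ltW p0) //.
  + by rewrite in_itv /= leey lee_fin specnorm_ge0.
  + rewrite in_itv /= leey andbT; apply: integral_ge0 => x _.
    by rewrite lee_fin specnorm_ge0.
  + exact: specnorm_expect_le.
- by move=> x; exact: specnorm_ge0.
- exact/measurable_specnorm/mx_integrable_measurable/iF.
Qed.

Lemma entry_le_specnorm m (A : 'M[C]_m) a b :
  `|complex.Re (A a b)| <= specnorm A /\ `|complex.Im (A a b)| <= specnorm A.
Proof.
have h : cnorm2 (A a b) <= specnorm A ^+ 2.
  have := ip_mul_specnorm A (delta_mx b ord0).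
  rewrite -colE (_ : ip (delta_mx b ord0) (delta_mx b ord0) = 1 :> R); last first.
    rewrite ipE (bigD1 b) //= big_ord1 mxE !eqxx /= mulr0 addr0 mulr1.
    rewrite big1 ?addr0 // => i ib; rewrite big_ord1 mxE (negPf ib) /= !mulr0 addr0 //.
  rewrite mulr1 => /(le_trans _); apply; rewrite ipE (bigD1 a) //= big_ord1 mxE /cnorm2 !expr2.
  by rewrite lerDl sumr_ge0 // => i _; rewrite big_ord1 addr_ge0 // -expr2 sqr_ge0.
have S0 := specnorm_ge0 A.
have h1 := sqr_ge0 (complex.Re (A a b)); have h2 := sqr_ge0 (complex.Im (A a b)).
rewrite /cnorm2 in h.
by split; rewrite -(@ler_sqr R) ?nnegrE // real_normK ?num_real //; lra.
Qed.

Lemma mx_integrable_specnorm (P : probability T R) m (F : T -> 'M[C]_m) q : 1 <= q ->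
  mx_measurable F -> (\int[P]_x (specnorm (F x) `^ q)%:E < +oo)%E -> mx_integrable P F.
Proof.
move=> q1 mF h.
have i1 : P.-integrable setT (fun x => (1 + specnorm (F x) `^ q)%:E).
  apply: (@integrableD _ _ _ P setT _ (EFin \o cst 1) (fun x => (specnorm (F x) `^ q)%:E)) => //.
    exact: finite_measure_integrable_cst.
  apply/integrableP; split; first exact: measurable_specnorm_powR.
  rewrite (_ : integral _ _ _ = \int[P]_x (specnorm (F x) `^ q)%:E)%E //.
  by apply: eq_integral => x _ /=; rewrite ger0_norm // powR_ge0.
have b x : specnorm (F x) <= 1 + specnorm (F x) `^ q.
  have [s1|s1] := leP (specnorm (F x)) 1; first by rewrite (le_trans s1) // lerDl powR_ge0.
  by rewrite (le_trans (le1r_powR (ltW s1) q1)) // lerDr.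
move=> a c; have [m1 m2] := mF a c.
split; apply: le_integrable i1 => //; try exact/measurable_EFinP.
  move=> x _ /=; rewrite lee_fin (le_trans (entry_le_specnorm _ _ _).1) //.
  by rewrite (le_trans (b x)) // ler_norm.
move=> x _ /=; rewrite lee_fin (le_trans (entry_le_specnorm _ _ _).2) //.
by rewrite (le_trans (b x)) // ler_norm.
Qed.

End MatrixExpectation.

(** * Laws of i.i.d. families *)

Section TupleLaw.
Context {R : realType} {dS : measure_display} {S : measurableType dS} {n : nat}.

Definition tuple_rect (B : 'I_n -> set S) : set (n.-tuple S) :=
  [set t | forall i, B i (tnth t i)].

Lemma measurable_tuple_rect (B : 'I_n -> set S) :
  (forall i, measurable (B i)) -> measurable (tuple_rect B).
Proof.
move=> mB; rewrite (_ : tuple_rect B = \bigcap_(i in [set: 'I_n]) ((@tnth n S)^~ i @^-1` B i)).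
  apply: fin_bigcap_measurable => // i _; rewrite -[X in measurable X]setTI.
  exact: measurable_tnth.
by apply/seteqP; split => t /= h i; [move=> _; exact: h|exact: h].
Qed.

(** Rectangles are stable under intersection, which the generating coordinate preimages are not; so
    two measures on tuples need only be compared on rectangles. *)
Lemma measurable_tuple_generated :
  @measurable _ (n.-tuple S) = <<s [set tuple_rect B | B in [set B | forall i, measurable (B i)]] >>.
Proof.
apply/seteqP; split.
  apply: smallest_sub; first exact: smallest_sigma_algebra.
  rewrite -bigcup_seq => A [i _ [B mB <-]]; apply: sub_sigma_algebra.
  exists (fun j => if j == i then B else setT) => [j|]; first by case: ifP.
  rewrite setTI; apply/seteqP; split => t /=; first by move=> /(_ i); rewrite eqxx.
  by move=> h j; case: eqP => // ->.
apply: smallest_sub; first exact: sigma_algebra_measurable.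
by move=> _ [B mB <-]; exact: measurable_tuple_rect.
Qed.

Lemma tuple_measure_unique (m1 m2 : {measure set (n.-tuple S) -> \bar R}) :
  (m1 setT < +oo)%E ->
  (forall B, (forall i, measurable (B i)) -> m1 (tuple_rect B) = m2 (tuple_rect B)) ->
  forall A, measurable A -> m1 A = m2 A.
Proof.
move=> fin h; apply: (measure_unique
   [set tuple_rect B | B in [set B | forall i, measurable (B i)]] (fun=> setT)).
- exact: measurable_tuple_generated.
- move=> _ _ [B mB <-] [D mD <-]; exists (fun i => B i `&` D i).
    by move=> i; exact: measurableI.
  by apply/seteqP; split => t /=; [move=> BD; split => i; have [] := BD i|
    move=> [b e] i; split; [exact: b|exact: e]].
- by move=> _; exists (fun=> setT) => //; apply/seteqP; split.
- by rewrite bigcup_const //; exists 0%N.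
- by move=> _ [B mB <-]; exact: h.
- by move=> _.
Qed.

Definition mix (J : pred 'I_n) (x y : n.-tuple S) : n.-tuple S :=
  [tuple if J i then tnth x i else tnth y i | i < n].

Lemma tnth_mix J x y i : tnth (mix J x y) i = if J i then tnth x i else tnth y i.
Proof. by rewrite tnth_mktuple. Qed.

Lemma measurable_mix J : measurable_fun setT (fun z : n.-tuple S * n.-tuple S => mix J z.1 z.2).
Proof.
apply/measurable_fun_tnthP => i.
rewrite (_ : _ \o _ = fun z : n.-tuple S * n.-tuple S =>
   if J i then tnth z.1 i else tnth z.2 i).
  case: (J i).
    exact: (measurableT_comp (measurable_tnth i) measurable_fst).
  exact: (measurableT_comp (measurable_tnth i) measurable_snd).
by apply/funext => z /=; rewrite tnth_mix.
Qed.

Variable mu : probability S R.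

Definition iid_law (M : probability (n.-tuple S) R) :=
  forall B, (forall i, measurable (B i)) -> M (tuple_rect B) = (\prod_i mu (B i))%E.

Variable M : probability (n.-tuple S) R.
Hypothesis iidM : iid_law M.

(** Replacing any group of coordinates by those of an independent copy preserves the law. This
    carries both the decoupling and the conditional Jensen arguments. *)
Lemma mix_law J (f : n.-tuple S -> \bar R) : measurable_fun setT f -> (forall x, 0 <= f x)%E ->
  (\int[M]_x \int[M]_y f (mix J x y) = \int[M]_x f x)%E.
Proof.
move=> mf f0; have mm := measurable_mix J.
rewrite -(fubini_tonelli1 (fun z : n.-tuple S * n.-tuple S => f (mix J z.1 z.2))) //; last first.
  exact: measurableT_comp.
have := @ge0_integral_pushforward _ _ _ _ R _ mm (M \x M)%E setT f measurableT mf (fun y _ => f0 y).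
rewrite preimage_setT => <-; apply: eq_measure_integral => A mA _.
have rect B : (forall i, measurable (B i)) ->
   pushforward (M \x M)%E (fun z => mix J z.1 z.2) (tuple_rect B) = M (tuple_rect B).
  move=> mB; pose BJ b i := if J i == b then B i else setT.
  have mBJ b i : measurable (BJ b i) by rewrite /BJ; case: ifP.
  rewrite /pushforward.
  rewrite (_ : _ @^-1` _ = tuple_rect (BJ true) `*` tuple_rect (BJ false)).
    rewrite product_measure1E; [|exact: measurable_tuple_rect..].
    transitivity (M (tuple_rect (BJ true)) * M (tuple_rect (BJ false)))%E => //.
    rewrite !iidM // -big_split /=; apply: eq_bigr => i _; rewrite /BJ.
    by case: (J i) => /=; rewrite (probability_setT mu) ?mule1 ?mul1e.
  apply/seteqP; split => [[x y] /= h|[x y] /= [h1 h2] i].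
    by split => i; rewrite /BJ; have := h i; rewrite tnth_mix; case: (J i).
  by rewrite tnth_mix; have := h1 i; have := h2 i; rewrite /BJ; case: (J i).
move: A mA; apply: tuple_measure_unique => [|B mB]; last exact: rect.
rewrite /= /pushforward preimage_setT -setXTT product_measure1E //.
by rewrite (_ : (_ * _)%E = (M setT * M setT)%E) // !(probability_setT M) mule1 ltry.
Qed.

Lemma iid_marginal i (f : S -> \bar R) : measurable_fun setT f -> (forall x, 0 <= f x)%E ->
  (\int[M]_x f (tnth x i) = \int[mu]_s f s)%E.
Proof.
move=> mf f0; have mt := @measurable_tnth _ S n i.
have := @ge0_integral_pushforward _ _ _ _ R _ mt M setT f measurableT mf (fun y _ => f0 y).
rewrite preimage_setT => <-; apply: eq_measure_integral => A mA _.
rewrite /= /pushforward.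
pose B j := if j == i then A else [set: S].
have -> : (@tnth n S)^~ i @^-1` A = tuple_rect B.
  apply/seteqP; split => t /=; last by move=> /(_ i); rewrite /B eqxx.
  by move=> h j; rewrite /B; case: eqP => // ->.
rewrite iidM; last by move=> j; rewrite /B; case: ifP.
rewrite (bigD1 i) //= {1}/B eqxx big1 ?mule1 // => j ji.
by rewrite /B (negPf ji) (probability_setT mu).
Qed.

End TupleLaw.

(** * Laws of tuples and of pairs of independent tuples *)

Section Laws.
Context {R : realType} {dO dS : measure_display} {O : measurableType dO}
  {S : measurableType dS} {n : nat}.
Variables (P : probability O R) (mu : probability S R).

Definition tup (X : 'I_n -> O -> S) (w : O) : n.-tuple S := [tuple X i w | i < n].

Lemma measurable_tup X : (forall i, measurable_fun setT (X i)) -> measurable_fun setT (tup X).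
Proof.
move=> mX; apply/measurable_fun_tnthP => i.
by rewrite (_ : _ \o _ = X i) //; apply/funext => w /=; rewrite tnth_mktuple.
Qed.

Lemma tup_preimage_rect X (B : 'I_n -> set S) :
  tup X @^-1` tuple_rect B = \bigcap_(i in [set: 'I_n]) (X i @^-1` B i).
Proof.
apply/seteqP; split => w /= h i; first by move=> _; have := h i; rewrite tnth_mktuple.
by rewrite tnth_mktuple; exact: h.
Qed.

Lemma iid_tup X : (forall i, has_law P (X i) mu) -> mutually_independent P X ->
  forall B, (forall i, measurable (B i)) ->
    P (tup X @^-1` tuple_rect B) = (\prod_i mu (B i))%E.
Proof.
move=> lX iX B mB; rewrite tup_preimage_rect iX //.
by apply: eq_bigr => i _; exact: lX.
Qed.

Variable M : probability (n.-tuple S) R.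
Hypothesis iidM : iid_law mu M.

Lemma tup_law X (f : n.-tuple S -> \bar R) :
  (forall i, measurable_fun setT (X i)) -> (forall i, has_law P (X i) mu) ->
  mutually_independent P X -> measurable_fun setT f -> (forall x, 0 <= f x)%E ->
  (\int[P]_w f (tup X w) = \int[M]_x f x)%E.
Proof.
move=> mX lX iX mf f0; have mt := measurable_tup mX.
have := @ge0_integral_pushforward _ _ _ _ R _ mt P setT f measurableT mf (fun y _ => f0 y).
rewrite preimage_setT => <-; apply: eq_measure_integral => A mA _.
move: A mA; apply: tuple_measure_unique => [|B mB].
  by rewrite /= /pushforward preimage_setT (probability_setT P) ltry.
by rewrite /= /pushforward iid_tup // iidM.
Qed.

Variables X1 X2 : 'I_n -> O -> S.
Hypotheses (mX1 : forall i, measurable_fun setT (X1 i))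
  (mX2 : forall i, measurable_fun setT (X2 i))
  (lX1 : forall i, has_law P (X1 i) mu) (lX2 : forall i, has_law P (X2 i) mu)
  (iX : mutually_independent P
     (fun k : 'I_n + 'I_n => match k with inl i => X1 i | inr i => X2 i end)).

Lemma joint_rect B D : (forall i, measurable (B i)) -> (forall i, measurable (D i)) ->
  P (tup X1 @^-1` tuple_rect B `&` tup X2 @^-1` tuple_rect D) =
  (M (tuple_rect B) * M (tuple_rect D))%E.
Proof.
move=> mB mD; have := @iX (fun k => match k with inl i => B i | inr i => D i end) _.
rewrite (_ : bigcap _ _ = tup X1 @^-1` tuple_rect B `&` tup X2 @^-1` tuple_rect D); last first.
  rewrite !tup_preimage_rect; apply/seteqP; split => w /=.
    by move=> h; split => i _; [exact: (h (inl i))|exact: (h (inr i))].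
  by move=> [h1 h2] [i|i] _; [exact: h1|exact: h2].
move=> ->; last by case.
rewrite big_sumType /= !iidM //.
by congr (_ * _)%E; apply: eq_bigr => i _; [exact: lX1|exact: lX2].
Qed.

Lemma joint_law (f : n.-tuple S * n.-tuple S -> \bar R) :
  measurable_fun setT f -> (forall z, 0 <= f z)%E ->
  (\int[P]_w f (tup X1 w, tup X2 w) = \int[M \x M]_z f z)%E.
Proof.
move=> mf f0; have mt1 := measurable_tup mX1; have mt2 := measurable_tup mX2.
have mt : measurable_fun setT (fun w => (tup X1 w, tup X2 w)).
  exact: measurable_fun_pair.
have := @ge0_integral_pushforward _ _ _ _ R _ mt P setT f measurableT mf (fun y _ => f0 y).
rewrite preimage_setT => <-; apply: eq_measure_integral => A mA _.
have mpre Y E : measurable_fun setT (tup Y) -> measurable E -> measurable (tup Y @^-1` E).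
  by move=> mY mE; rewrite -[X in measurable X]setTI; exact: mY.
pose m' : {measure set (n.-tuple S * n.-tuple S) -> \bar R} :=
  pushforward P (fun w => (tup X1 w, tup X2 w)).
apply/esym/(@product_measure_unique _ _ _ _ _ M M (m' mt)) => // E F mE mF /=.
(* Rectangles are extended to measurable sets in one factor at a time: with the other event frozen,
   [P] restricted to it is compared with a multiple of [M]. *)
have half B : (forall i, measurable (B i)) ->
    P (tup X1 @^-1` tuple_rect B `&` tup X2 @^-1` F) = (M (tuple_rect B) * M F)%E.
  move=> mB; have mB1 := mpre X1 _ mt1 (measurable_tuple_rect mB).
  have MB : M (tuple_rect B) = (fine (M (tuple_rect B)))%:E.
    by rewrite fineK // fin_num_measure //; exact: measurable_tuple_rect.
  have MB0 : 0 <= fine (M (tuple_rect B)) by rewrite fine_ge0.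
  pose m1 : {measure set (n.-tuple S) -> \bar R} := pushforward (mrestr P mB1) (tup X2).
  pose m2 : {measure set (n.-tuple S) -> \bar R} := mscale (NngNum MB0) M.
  have E12 : m1 mt2 F = m2 F.
    apply: tuple_measure_unique mF => [|D mD].
      rewrite /m1 /= /pushforward /mrestr preimage_setT setTI.
      by rewrite (le_lt_trans (probability_le1 P mB1)) // ltry.
    rewrite /m1 /m2 /= /pushforward /mrestr /mscale /= -MB setIC.
    exact: joint_rect.
  by rewrite MB setIC; exact: E12.
have mF2 := mpre X2 _ mt2 mF.
have MF : M F = (fine (M F))%:E by rewrite fineK // fin_num_measure.
have MF0 : 0 <= fine (M F) by rewrite fine_ge0.
pose m1 : {measure set (n.-tuple S) -> \bar R} := pushforward (mrestr P mF2) (tup X1).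
pose m2 : {measure set (n.-tuple S) -> \bar R} := mscale (NngNum MF0) M.
have E12 : m1 mt1 E = m2 E.
  apply: tuple_measure_unique mE => [|D mD].
    rewrite /m1 /= /pushforward /mrestr preimage_setT setTI.
    by rewrite (le_lt_trans (probability_le1 P mF2)) // ltry.
  by rewrite /m1 /m2 /= /pushforward /mrestr /mscale /= -MF muleC half.
by rewrite muleC MF; exact: E12.
Qed.

End Laws.

(** * Sums of independent matrices *)

Section IndependentSums.
Context {R : realType} {dS : measure_display} {S : measurableType dS} {n : nat}.
Local Notation C := R[i].
Local Notation T := (n.-tuple S).
Variables (mu : probability S R) (M : probability T R).
Hypothesis iidM : iid_law mu M.

Lemma mx_measurable_tnth m k (Y : S -> 'M[C]_(m, k)) i :
  mx_measurable Y -> mx_measurable (fun x : T => Y (tnth x i)).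
Proof. by move=> mY; exact: (mx_measurable_comp mY (@measurable_tnth _ S n i)). Qed.

Lemma iid_integral i (f : S -> \bar R) : measurable_fun setT f ->
  (\int[M]_x f (tnth x i) = \int[mu]_s f s)%E.
Proof.
move=> mf; rewrite [LHS]integralE [RHS]integralE; congr (_ - _)%E.
  rewrite -(iid_marginal iidM i (f := f^\+%E)) //; last exact: measurable_funepos.
  by apply: eq_integral => x _; rewrite !funeposE.
rewrite -(iid_marginal iidM i (f := f^\-%E)) //; last exact: measurable_funeneg.
by apply: eq_integral => x _; rewrite !funenegE.
Qed.

Lemma iid_integrable i (f : S -> R) : mu.-integrable setT (EFin \o f) ->
  M.-integrable setT (fun x => (f (tnth x i))%:E).
Proof.
move=> /integrableP[mf fi]; apply/integrableP; split.
  exact: (measurableT_comp mf (@measurable_tnth _ S n i)).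
rewrite -(iid_marginal iidM i (f := fun s => `|(f s)%:E|%E)) // in fi.
exact: measurableT_comp mf.
Qed.

Lemma iid_mx_integrable i m k (Y : S -> 'M[C]_(m, k)) :
  mx_integrable mu Y -> mx_integrable M (fun x => Y (tnth x i)).
Proof.
by move=> iY a b; have [Y1 Y2] := iY a b; split;
  [exact: (iid_integrable i Y1)|exact: (iid_integrable i Y2)].
Qed.

Lemma iid_mx_expect i m k (Y : S -> 'M[C]_(m, k)) : mx_measurable Y ->
  mx_expect M (fun x => Y (tnth x i)) = mx_expect mu Y.
Proof.
move=> mY; apply/matrixP => a b; have [Y1 Y2] := mY a b; rewrite !mxE /cexpect /Rintegral.
rewrite (iid_integral i (f := fun s => (complex.Re (Y s a b))%:E)); last exact/measurable_EFinP.
by rewrite (iid_integral i (f := fun s => (complex.Im (Y s a b))%:E)) //; exact/measurable_EFinP.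
Qed.

(** Conditional Jensen: the sum is evaluated at [mix J x y], which has the law of a sample, and
    averaging over [y] replaces the terms outside [J] by their means. For centred terms this deletes
    them. *)
Lemma specnorm_drop m (Y : 'I_n -> S -> 'M[C]_m) (J : pred 'I_n) (p : R) : 1 <= p ->
  (forall j, mx_integrable mu (Y j)) ->
  (\int[M]_x (specnorm (\sum_j (if J j then Y j (tnth x j) else mx_expect mu (Y j))) `^ p)%:E <=
   \int[M]_x (specnorm (\sum_j Y j (tnth x j)) `^ p)%:E)%E.
Proof.
move=> p1 iY; have mY j := mx_integrable_measurable (iY j).
have mS : mx_measurable (fun x : T => \sum_j Y j (tnth x j)).
  by apply: mx_measurable_sum => j _; exact: mx_measurable_tnth.
rewrite -[leRHS](mix_law iidM J); last 2 first.
- exact: measurable_specnorm_powR.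
- by move=> x; rewrite lee_fin powR_ge0.
apply: ge0_le_integral => //.
- by move=> x _; rewrite lee_fin powR_ge0.
- apply: measurable_specnorm_powR; apply: mx_measurable_sum => j _.
  by case: (J j); [exact: mx_measurable_tnth|exact: mx_measurable_cst].
- apply: (measurable_fun_fubini_tonelli_F
    (fun z : T * T => (specnorm (\sum_j Y j (tnth (mix J z.1 z.2) j)) `^ p)%:E)).
    apply: (@measurable_specnorm_powR _ _ _ _ (fun z : T * T => \sum_j Y j (tnth (mix J z.1 z.2) j))).
    exact: (mx_measurable_comp mS (measurable_mix J)).
  by move=> z; rewrite lee_fin powR_ge0.
move=> x _.
have iF j : mx_integrable M (fun y => if J j then Y j (tnth x j) else Y j (tnth y j)).
  by case: (J j); [exact: mx_integrable_cst|exact: iid_mx_integrable].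
have E : mx_expect M (fun y => \sum_j Y j (tnth (mix J x y) j)) =
    \sum_j (if J j then Y j (tnth x j) else mx_expect mu (Y j)).
  rewrite (_ : (fun y => _) =
    fun y => \sum_j (if J j then Y j (tnth x j) else Y j (tnth y j))); last first.
    by apply/funext => y; apply: eq_bigr => j _; rewrite tnth_mix; case: (J j).
  rewrite mx_expect_sum //; apply: eq_bigr => j _.
  by case: (J j); [exact: mx_expect_cst|exact: iid_mx_expect].
rewrite -E; apply: specnorm_powR_expect_le => //.
rewrite (_ : (fun y => _) =
    fun y => \sum_j (if J j then Y j (tnth x j) else Y j (tnth y j))); last first.
  by apply/funext => y; apply: eq_bigr => j _; rewrite tnth_mix; case: (J j).
exact: mx_integrable_sum.
Qed.

Lemma powRD_le (a b p : R) : 1 <= p -> 0 <= a -> 0 <= b ->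
  (a + b) `^ p <= 2 `^ p / 2 * (a `^ p + b `^ p).
Proof.
move=> p1 a0 b0; have p0 : 0 < p by rewrite (lt_le_trans ltr01).
have h := @sum_powR_le R bool (fun c => if c then a `^ p else b `^ p)
  ((a `^ p + b `^ p) / 2) p^-1.
have c2 : #|{: bool}|%:R = 2 :> R by rewrite card_bool.
have s0 : 0 <= (a `^ p + b `^ p) / 2 by rewrite divr_ge0 // addr_ge0 // powR_ge0.
have {h} : a + b <= 2 * ((a `^ p + b `^ p) / 2) `^ p^-1.
  have := h _ _ s0 _ _; rewrite !big_bool /= c2 -!powRrM mulfV ?gt_eqF // !powRr1 //.
  apply; rewrite ?invr_gt0 ?invf_le1 //; last by lra.
  by case; rewrite powR_ge0.
move=> h; apply: (@le_trans _ _ ((2 * ((a `^ p + b `^ p) / 2) `^ p^-1) `^ p)).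
  by apply: ge0_ler_powR => //; rewrite ?nnegrE ?addr_ge0 ?mulr_ge0 ?powR_ge0 // ltW.
by rewrite powRM ?powR_ge0 // -powRrM mulVf ?gt_eqF // powRr1 // mulrA mulrAC.
Qed.

(** Valid for every fixed sign vector, without a second sample. The centred sum is the difference of
    two copies of the signed sum, one keeping the positive terms and one the negative, with means in
    the other places; each is dominated through [specnorm_drop]. *)
Lemma specnorm_symmetrize m (Y : 'I_n -> S -> 'M[C]_m) (e : {ffun 'I_n -> bool}) (p : R) :
  1 <= p -> (forall j, mx_integrable mu (Y j)) ->
  (\int[M]_x (specnorm (\sum_j (Y j (tnth x j) - mx_expect mu (Y j))) `^ p)%:E <=
   (2 `^ p)%:E * \int[M]_x (specnorm (rad (fun j => Y j (tnth x j)) e) `^ p)%:E)%E.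
Proof.
move=> p1 iY; pose Z j s := (-1) ^+ e j *: Y j s.
have iZ j : mx_integrable mu (Z j) by exact: mx_integrable_sign.
have mZ j := mx_integrable_measurable (iZ j).
pose W (J : pred 'I_n) (x : T) := \sum_j (if J j then Z j (tnth x j) else mx_expect mu (Z j)).
have mW J : mx_measurable (W J).
  apply: mx_measurable_sum => j _.
  by case: (J j); [exact: mx_measurable_tnth|exact: mx_measurable_cst].
have WE x : \sum_j (Y j (tnth x j) - mx_expect mu (Y j)) =
    W (fun j => ~~ e j) x - W (fun j => e j) x.
  rewrite /W -sumrB; apply: eq_bigr => j _.
  rewrite /Z mx_expect_sign // !scaler_sign; case: (e j) => //=.
  by rewrite opprK addrC.
have K0 : 0 <= 2 `^ p / 2 by rewrite divr_ge0 // powR_ge0.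
have K0E : (0 <= (2 `^ p / 2)%:E)%E by rewrite lee_fin.
have pos J x : (0 <= (specnorm (W J x) `^ p)%:E)%E by rewrite lee_fin powR_ge0.
apply: (@le_trans _ _ (\int[M]_x ((2 `^ p / 2)%:E * ((specnorm (W (fun j => ~~ e j) x) `^ p)%:E +
    (specnorm (W (fun j => e j) x) `^ p)%:E)))%E).
  apply: ge0_le_integral => //.
  - by move=> x _; rewrite lee_fin powR_ge0.
  - under eq_fun do rewrite WE; apply: measurable_specnorm_powR; exact: mx_measurableB.
  - apply: measurable_funeM; apply: emeasurable_funD; exact: measurable_specnorm_powR.
  - move=> x _; rewrite WE -EFinD -EFinM lee_fin (le_trans _ (powRD_le p1 _ _)) ?specnorm_ge0 //.
    apply: ge0_ler_powR; rewrite ?nnegrE ?addr_ge0 ?specnorm_ge0 ?specnormB //; lra.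
rewrite ge0_integralZl //; last 2 first.
- by apply: emeasurable_funD; exact: measurable_specnorm_powR.
- by move=> x _; rewrite adde_ge0.
rewrite ge0_integralD //; [|exact: measurable_specnorm_powR..].
have D J := specnorm_drop J p1 iZ.
apply: (@le_trans _ _ ((2 `^ p / 2)%:E * (\int[M]_x (specnorm (\sum_j Z j (tnth x j)) `^ p)%:E
   + \int[M]_x (specnorm (\sum_j Z j (tnth x j)) `^ p)%:E))%E).
  apply: lee_wpmul2l; first exact: K0E.
  apply: leeD; first exact: (D (fun j => ~~ e j)).
  exact: (D (fun j => e j)).
rewrite /rad; set I := (\int[M]_x _)%E.
have I0 : (0 <= I)%E by apply: integral_ge0 => x _; rewrite lee_fin powR_ge0.
rewrite -mule2n -mule_natl muleA -EFinM divfK ?pnatr_eq0 //.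
Qed.

End IndependentSums.

Section AveragedBounds.
Context {R : realType}.

(** Turns an estimate valid for each sign vector into one by the average, to which Khintchine
    applies. *)
Lemma le_of_average (E : finType) (a c : \bar R) (b : E -> \bar R) : (0 < #|E|)%N ->
  (forall e, (a <= b e)%E) -> (\sum_e b e <= #|E|%:R%:E * c)%E -> (a <= c)%E.
Proof.
move=> E0 ab bc; have E0' : (0 < #|E|%:R :> R) by rewrite ltr0n.
rewrite -(@lee_pmul2l _ #|E|%:R%:E) ?lte_fin //; apply: le_trans bc.
have -> : (#|E|%:R%:E * a = \sum_(e : E) a)%E.
  by rewrite mule_natl big_const cardE -cardE iter_addr addr0.
by apply: lee_sum => e _; exact: ab.
Qed.

Lemma card_signs_gt0 n : (0 < #|{ffun 'I_n -> bool}|)%N.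
Proof. by apply/card_gt0P; exists [ffun=> true]. Qed.

Context {dT : measure_display} {T : measurableType dT}.
Implicit Type mu : {measure set T -> \bar R}.

Lemma ge0_integralZl_fin mu (f : T -> R) k : 0 <= k -> (forall x, 0 <= f x) ->
  measurable_fun setT f ->
  (\int[mu]_x (k * f x)%:E = k%:E * \int[mu]_x (f x)%:E)%E.
Proof.
move=> k0 f0 mf; rewrite -ge0_integralZl_EFin // => [x _|]; first by rewrite lee_fin.
exact/measurable_EFinP.
Qed.

Lemma ge0_le_integral_fin mu (f g : T -> R) : (forall x, 0 <= f x) ->
  measurable_fun setT f -> measurable_fun setT g -> (forall x, f x <= g x) ->
  (\int[mu]_x (f x)%:E <= \int[mu]_x (g x)%:E)%E.
Proof.
move=> f0 mf mg fg; apply: ge0_le_integral => //; try exact/measurable_EFinP.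
- by move=> x _; rewrite lee_fin.
- by move=> x _; rewrite lee_fin.
Qed.

Lemma measurable_powR_comp (f : T -> R) p : measurable_fun setT f ->
  measurable_fun setT (fun x => f x `^ p).
Proof. by move=> mf; apply: (measurableT_comp (f := @powR R ^~ p)). Qed.

End AveragedBounds.

(** * Deviation of a random Gram matrix from its mean *)

Section GramDeviation.
Context {R : realType} {dS : measure_display} {S : measurableType dS} {n : nat}.
Local Notation C := R[i].
Local Notation T := (n.-tuple S).
Variables (mu : probability S R) (M : probability T R).
Hypothesis iidM : iid_law mu M.
Variables (d : nat) (r q : R).
Hypotheses (r1 : 1 <= r) (dr : d%:R <= expR (r - 1)) (q1 : 1 <= q) (qr : q <= r).

(* No integrability is assumed: as [kap <= L], finiteness of the right-hand side forces
   the summands into L^q. *)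
Lemma gram_deviation k m (B : 'I_n -> S -> 'M[C]_(k, m)) (kap L : T -> R) :
  (forall j, mx_measurable (B j)) -> measurable_fun setT kap -> measurable_fun setT L ->
  (forall x, 0 <= kap x) -> (forall x, kap x <= L x) ->
  (forall x j, specnorm (adjmx (B j (tnth x j)) *m B j (tnth x j)) <= kap x) ->
  (forall x (v : 'cV[C]_m),
     \sum_j ip (B j (tnth x j) *m v) (B j (tnth x j) *m v) <= L x * ip v v) ->
  (forall x, \sum_j ip (B j (tnth x j)) (B j (tnth x j)) <= 2 * d%:R * L x) ->
  (\int[M]_x (specnorm (\sum_j (adjmx (B j (tnth x j)) *m B j (tnth x j)) -
      mx_expect M (fun y => \sum_j (adjmx (B j (tnth y j)) *m B j (tnth y j)))) `^ q)%:E
   <= \int[M]_x (2 `^ q * (9 / 2 * r * (kap x * L x)) `^ (q / 2))%:E)%E.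
Proof.
move=> mB mkap mL kap0 kapL hkap hL hT.
have q0 : 0 < q by rewrite (lt_le_trans ltr01).
have c92 : 0 <= 9 / 2 * r by rewrite mulr_ge0 ?divr_ge0 // (le_trans ler01 r1).
have L0 x : 0 <= L x by rewrite (le_trans (kap0 x)).
pose Y j s := adjmx (B j s) *m B j s.
have mY j : mx_measurable (Y j) by apply: mx_measurableM => //; exact: mx_measurable_adj.
pose h x := (9 / 2 * r * (kap x * L x)) `^ (q / 2).
have mh : measurable_fun setT h.
  apply: (measurableT_comp (f := @powR R ^~ (q / 2))); first exact: measurable_powR.
  by apply: measurable_funM => //; exact: measurable_funM.
have h0 x : 0 <= h x by exact: powR_ge0.
set I := (\int[M]_x (_ * _)%:E)%E.
have IE : (I = (2 `^ q)%:E * \int[M]_x (h x)%:E)%E.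
  by rewrite /I ge0_integralZl_fin // powR_ge0.
have I0 : (0 <= I)%E by apply: integral_ge0 => x _; rewrite lee_fin mulr_ge0 ?powR_ge0.
have [->|Ioo] := eqVneq I +oo%E; first by rewrite leey.
have iY j : mx_integrable mu (Y j).
  apply: (mx_integrable_specnorm q1) => //.
  rewrite -(iid_marginal iidM j (f := fun s => (specnorm (Y j s) `^ q)%:E)); last 2 first.
  - exact: measurable_specnorm_powR.
  - by move=> s; rewrite lee_fin powR_ge0.
  apply: (@le_lt_trans _ _ I); last by rewrite ltey.
  apply: ge0_le_integral => //.
  - by move=> x _; rewrite lee_fin powR_ge0.
  - exact/measurable_specnorm_powR/mx_measurable_tnth.
  - by apply/measurable_EFinP; exact: measurable_funM.
  - move=> x _; rewrite lee_fin.
    apply: (@le_trans _ _ (1 * h x)); last first.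
      rewrite ler_wpM2r //; have := @ler_powR R 2 _ 0 q (ltW q0).
      by rewrite powRr0; apply; rewrite ler1n.
    rewrite mul1r (_ : q = 2 * (q / 2)); last by field.
    rewrite powRrM (powR_mulrn 2) ?specnorm_ge0 // /h.
    have sk : specnorm (Y j (tnth x j)) <= kap x by exact: hkap.
    have kL0 : 0 <= kap x * L x by rewrite mulr_ge0.
    have c0 : 0 <= 9 / 2 * r * (kap x * L x) by exact: mulr_ge0 c92 kL0.
    apply: ge0_ler_powR; rewrite ?nnegrE ?sqr_ge0 //; first exact: divr_ge0 (ltW q0) _.
    apply: (@le_trans _ _ (kap x ^+ 2)).
      by rewrite ler_sqr // nnegrE ?specnorm_ge0.
    have kL : kap x ^+ 2 <= kap x * L x by rewrite expr2 ler_wpM2l.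
    apply: (le_trans kL); rewrite ler_peMl //.
    by rewrite -[leLHS]mul1r ler_pM // ler_pdivlMr // mul1r ler_nat.
have iYM j : mx_integrable M (fun y => Y j (tnth y j)) by exact: (iid_mx_integrable iidM).
have EY : mx_expect M (fun y => \sum_j Y j (tnth y j)) = \sum_j mx_expect mu (Y j).
  by rewrite mx_expect_sum //; apply: eq_bigr => j _; exact: (iid_mx_expect iidM).
rewrite -/(Y _ _) [mx_expect _ _]EY.
under eq_integral do rewrite -sumrB.
(* The signs are averaged only now and under the integral, where Khintchine applies at each sample
   point. *)
apply: (@le_of_average _ {ffun 'I_n -> bool} _ _ (fun e => (2 `^ q)%:E *
   \int[M]_x (specnorm (rad (fun j => Y j (tnth x j)) e) `^ q)%:E)%E).
- exact: card_signs_gt0.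
- by move=> e; exact: (specnorm_symmetrize iidM e q1 iY).
have mrad e : mx_measurable (fun x : T => rad (fun j => Y j (tnth x j)) e).
  by apply: (@mx_measurable_rad _ _ _ _ _ (fun j x => Y j (tnth x j))) => j;
     exact: mx_measurable_tnth.
rewrite -ge0_sume_distrr; last first.
  by move=> e _; apply: integral_ge0 => x _; rewrite lee_fin powR_ge0.
rewrite IE muleCA; apply: lee_wpmul2l; first by rewrite lee_fin powR_ge0.
rewrite -ge0_integral_sum //; last 2 first.
- by move=> e; exact: measurable_specnorm_powR.
- by move=> e x _; rewrite lee_fin powR_ge0.
rewrite -ge0_integralZl_fin //.
apply: ge0_le_integral => //.
- by move=> x _; apply: sume_ge0 => e _; rewrite lee_fin powR_ge0.
- by apply: emeasurable_sum => e; exact: measurable_specnorm_powR.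
- by apply/measurable_EFinP; exact: measurable_funM.
- move=> x _; rewrite sumEFin lee_fin.
  exact: (@rad_gram_khintchine _ d r r1 dr n m k (fun j => B j (tnth x j))).
Qed.

End GramDeviation.

(** * Decoupling *)

Lemma eq_integral_le {R : realType} d (T : measurableType d) (m : {measure set T -> \bar R})
  (f g : T -> \bar R) : f =1 g -> (\int[m]_x f x <= \int[m]_x g x)%E.
Proof. by move=> fg; rewrite (eq_integral g) // => x _; exact: fg. Qed.

Section DegenerateChaos.
Context {R : realType} {dS : measure_display} {S : measurableType dS} {n d : nat}.
Local Notation C := R[i].
Local Notation T := (n.-tuple S).
Variables (mu : probability S R) (M : probability T R).
Hypothesis iidM : iid_law mu M.
Variable K : 'I_n -> 'I_n -> S -> S -> 'M[C]_d.
Hypothesis mK : forall i j, mx_measurable (fun z : S * S => K i j z.1 z.2).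
Hypothesis sK : forall i j x y, K i j x y = K j i y x.
Hypothesis iK : forall i j x, mx_integrable mu (K i j x).
Hypothesis eK : forall i j x, mx_expect mu (K i j x) = 0.

(** [dbl z z] is the U-statistic and [dbl x y] the decoupled sum; full double sums are possible
    because the kernel will vanish on the diagonal. *)
Definition dbl (x y : T) := \sum_i \sum_j K i j (tnth x i) (tnth y j).

Lemma mx_measurable_kernel i j :
  mx_measurable (fun z : T * T => K i j (tnth z.1 i) (tnth z.2 j)).
Proof.
apply: (mx_measurable_comp (mK i j) (g := fun z : T * T => (tnth z.1 i, tnth z.2 j))).
apply: measurable_fun_pair.
  exact: (measurableT_comp (@measurable_tnth _ S n i) measurable_fst).
exact: (measurableT_comp (@measurable_tnth _ S n j) measurable_snd).
Qed.

Lemma integrable_kernelC i j y : mx_integrable mu (fun s => K i j s y).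
Proof.
rewrite (_ : (fun s => _) = K j i y); first exact: iK.
by apply/funext => s; rewrite sK.
Qed.

Lemma expect_kernelC i j y : mx_expect mu (fun s => K i j s y) = 0.
Proof.
rewrite (_ : (fun s => _) = K j i y); first exact: eK.
by apply/funext => s; rewrite sK.
Qed.

Section Swap.
Variables (F : T * T -> 'M[C]_d) (p : R).
Hypothesis mF : mx_measurable F.

Lemma measurable_section1 :
  measurable_fun setT (fun x => (\int[M]_y (specnorm (F (x, y)) `^ p)%:E)%E).
Proof.
apply: (measurable_fun_fubini_tonelli_F (fun z => (specnorm (F z) `^ p)%:E)).
  exact: measurable_specnorm_powR.
by move=> z; rewrite lee_fin powR_ge0.
Qed.

Lemma measurable_section2 :
  measurable_fun setT (fun y => (\int[M]_x (specnorm (F (x, y)) `^ p)%:E)%E).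
Proof.
apply: (measurable_fun_fubini_tonelli_G (fun z => (specnorm (F z) `^ p)%:E)).
  exact: measurable_specnorm_powR.
by move=> z; rewrite lee_fin powR_ge0.
Qed.

Lemma integral_swap :
  (\int[M]_x \int[M]_y (specnorm (F (x, y)) `^ p)%:E =
   \int[M]_y \int[M]_x (specnorm (F (x, y)) `^ p)%:E)%E.
Proof.
apply: (fubini_tonelli (fun z => (specnorm (F z) `^ p)%:E)).
  exact: measurable_specnorm_powR.
by move=> z; rewrite lee_fin powR_ge0.
Qed.

End Swap.

Lemma le_integral_section1 (F G : T * T -> 'M[C]_d) (p c : R) : 0 <= c ->
  mx_measurable F -> mx_measurable G ->
  (forall x, (\int[M]_y (specnorm (F (x, y)) `^ p)%:E <=
     c%:E * \int[M]_y (specnorm (G (x, y)) `^ p)%:E)%E) ->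
  (\int[M]_x \int[M]_y (specnorm (F (x, y)) `^ p)%:E <=
     c%:E * \int[M]_x \int[M]_y (specnorm (G (x, y)) `^ p)%:E)%E.
Proof.
move=> c0 mF mG h.
have pos D x : (0 <= \int[M]_y (@specnorm R d (D (x, y)) `^ p)%:E)%E.
  by apply: integral_ge0 => y _; rewrite lee_fin powR_ge0.
rewrite -ge0_integralZl_EFin //; last exact: measurable_section1.
apply: ge0_le_integral => //; first exact: measurable_section1.
by apply: measurable_funeM; exact: measurable_section1.
Qed.

Lemma le_integral_section2 (F G : T * T -> 'M[C]_d) (p c : R) : 0 <= c ->
  mx_measurable F -> mx_measurable G ->
  (forall y, (\int[M]_x (specnorm (F (x, y)) `^ p)%:E <=
     c%:E * \int[M]_x (specnorm (G (x, y)) `^ p)%:E)%E) ->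
  (\int[M]_x \int[M]_y (specnorm (F (x, y)) `^ p)%:E <=
     c%:E * \int[M]_x \int[M]_y (specnorm (G (x, y)) `^ p)%:E)%E.
Proof.
move=> c0 mF mG h; rewrite [leLHS](integral_swap p mF) [X in (_ * X)%E](integral_swap p mG).
have pos D y : (0 <= \int[M]_x (@specnorm R d (D (x, y)) `^ p)%:E)%E.
  by apply: integral_ge0 => x _; rewrite lee_fin powR_ge0.
rewrite -ge0_integralZl_EFin //; last exact: measurable_section2.
apply: ge0_le_integral => //; first exact: measurable_section2.
by apply: measurable_funeM; exact: measurable_section2.
Qed.

(** Degeneracy makes the sums over one index centred in the other variable, so [specnorm_drop]
    deletes columns with [x] frozen and then rows with [y] frozen. *)
Lemma drop_kernel (J1 J2 : pred 'I_n) (p : R) : 1 <= p ->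
  (\int[M]_x \int[M]_y (specnorm (\sum_(i | J1 i) \sum_(j | J2 j)
      K i j (tnth x i) (tnth y j)) `^ p)%:E <=
   \int[M]_x \int[M]_y (specnorm (dbl x y) `^ p)%:E)%E.
Proof.
move=> p1.
pose F (I J : pred 'I_n) (z : T * T) :=
  \sum_(i | I i) \sum_(j | J j) K i j (tnth z.1 i) (tnth z.2 j).
have mF I J : mx_measurable (F I J).
  by apply: mx_measurable_sum => i _; apply: mx_measurable_sum => j _;
     exact: mx_measurable_kernel.
have s1 := le_integral_section1 (p := p) (F := F J1 J2) (G := F J1 xpredT) ler01 (mF _ _) (mF _ _).
have s2 := le_integral_section2 (p := p) (F := F J1 xpredT) (G := F xpredT xpredT) ler01 (mF _ _) (mF _ _).
rewrite mul1e in s1; rewrite mul1e in s2.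
apply: (le_trans (s1 _)); last apply: (s2 _).
  move=> x; rewrite mul1e.
  pose Y j s := \sum_(i | J1 i) K i j (tnth x i) s.
  have iY j : mx_integrable mu (Y j) by apply: mx_integrable_sum => i _; exact: iK.
  have EY j : mx_expect mu (Y j) = 0.
    by rewrite mx_expect_sum => [|i _]; [rewrite big1|exact: iK].
  have E1 y : F J1 J2 (x, y) = \sum_j (if J2 j then Y j (tnth y j) else mx_expect mu (Y j)).
    rewrite /F exchange_big /= big_mkcond /=; apply: eq_bigr => j _.
    by rewrite EY.
  have E2 y : F J1 xpredT (x, y) = \sum_j Y j (tnth y j) by rewrite /F exchange_big.
  apply: (le_trans (eq_integral_le _ _)); first by move=> y; rewrite E1.
  apply: (le_trans (specnorm_drop iidM J2 p1 iY)).
  by apply: eq_integral_le => y; rewrite E2.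
move=> y; rewrite mul1e.
pose Y i s := \sum_j K i j s (tnth y j).
have iY i : mx_integrable mu (Y i) by apply: mx_integrable_sum => j _; exact: integrable_kernelC.
have EY i : mx_expect mu (Y i) = 0.
  by rewrite mx_expect_sum => [|j _]; [rewrite big1 // => j _; exact: expect_kernelC|
     exact: integrable_kernelC].
have E1 x : F J1 xpredT (x, y) = \sum_i (if J1 i then Y i (tnth x i) else mx_expect mu (Y i)).
  by rewrite /F big_mkcond /=; apply: eq_bigr => i _; rewrite EY.
apply: (le_trans (eq_integral_le _ _)); first by move=> x; rewrite E1.
exact: (specnorm_drop iidM J1 p1 iY).
Qed.

(** Flipping the signs at [i] and [j] groups the sign vectors in fours, and exactly one member of
    each group satisfies the condition. *)
Lemma sum_indicator_pair (i j : 'I_n) : i != j ->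
  4 * \sum_(e : {ffun 'I_n -> bool}) (e i && ~~ e j)%:R = #|{ffun 'I_n -> bool}|%:R :> R.
Proof.
move=> ij; pose w (e : {ffun 'I_n -> bool}) : R := (e i && ~~ e j)%:R.
have ri k (f : {ffun 'I_n -> bool} -> R) : \sum_e f e = \sum_e f (flip k e).
  by rewrite (reindex_inj (inv_inj (@flipK n k))).
have E : \sum_e (w e + w (flip i e) + (w (flip j e) + w (flip i (flip j e)))) =
    #|{ffun 'I_n -> bool}|%:R :> R.
  rewrite -sumr_const; apply: eq_bigr => e _.
  rewrite /w !ffunE !eqxx (negPf ij) eq_sym (negPf ij) /=.
  by case: (e i); case: (e j) => /=; ring.
rewrite -E !big_split /=.
by rewrite -(ri j (fun e => w (flip i e))) -(ri j w) -(ri i w); ring.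
Qed.

Hypothesis K0 : forall i x y, K i i x y = 0.

Lemma decoupling (p : R) : 1 <= p ->
  (\int[M]_z (specnorm (dbl z z) `^ p)%:E <=
   (4 `^ p)%:E * \int[M]_x \int[M]_y (specnorm (dbl x y) `^ p)%:E)%E.
Proof.
move=> p1; have p0 : 0 < p by rewrite (lt_le_trans ltr01).
pose E := {ffun 'I_n -> bool}.
have E0 : (0 < #|E|)%N by exact: card_signs_gt0.
pose Ue (e : E) (z : T) := \sum_(i | e i) \sum_(j | ~~ e j) K i j (tnth z i) (tnth z j).
have mKd i j : mx_measurable (fun z : T => K i j (tnth z i) (tnth z j)).
  by apply: (mx_measurable_comp (mx_measurable_kernel i j) (g := fun z : T => (z, z)));
     exact: measurable_fun_pair.
have mUe e : mx_measurable (Ue e).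
  by apply: mx_measurable_sum => i _; apply: mx_measurable_sum => j _.
have mD : mx_measurable (fun z => dbl z z).
  by apply: mx_measurable_sum => i _; apply: mx_measurable_sum => j _.
have sumU z : #|E|%:R%:C%C *: dbl z z = 4%:R *: \sum_e Ue e z.
  rewrite /dbl scaler_sumr.
  have -> : \sum_e Ue e z = \sum_i \sum_j \sum_(e : E)
     ((e i && ~~ e j)%:R : C) *: K i j (tnth z i) (tnth z j).
    rewrite [RHS](eq_bigr _ (fun i _ => exchange_big _ _ _ _ _ _)) /= exchange_big /=.
    apply: eq_bigr => e _; rewrite /Ue big_mkcond /=; apply: eq_bigr => i _.
    case: (e i) => /=; last by rewrite big1 // => j _; rewrite scale0r.
    rewrite big_mkcond; apply: eq_bigr => j _.
    by case: (e j); rewrite /= ?scale0r ?scale1r.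
  rewrite scaler_sumr; apply: eq_bigr => i _.
  rewrite !scaler_sumr; apply: eq_bigr => j _.
  have [->|ij] := eqVneq i j.
    by rewrite K0 scaler0 big1 ?scaler0 // => e _; rewrite scaler0.
  rewrite -scaler_suml scalerA; congr (_ *: _).
  rewrite -(sum_indicator_pair ij) rmorphM rmorph_sum /= rmorph_nat; congr (_ * _).
  by apply: eq_bigr => e _; rewrite rmorph_nat.
have spec z : #|E|%:R * specnorm (dbl z z) <= 4 * \sum_e specnorm (Ue e z).
  have E1 : #|E|%:R * specnorm (dbl z z) <= specnorm (#|E|%:R%:C%C *: dbl z z).
    have := @specnormZ R d #|E|%:R^-1 (#|E|%:R%:C%C *: dbl z z).
    rewrite scalerA -rmorphM mulVf ?pnatr_eq0 -?lt0n // scale1r => /(_ _) h.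
    by rewrite -ler_pdivlMl ?ltr0n // h // invr_ge0.
  apply: (le_trans E1); rewrite sumU (_ : (4%:R : C) = (4 : R)%:C%C); last by rewrite rmorph_nat.
  by apply: (le_trans (specnormZ _ _)) => //; rewrite ler_wpM2l // specnorm_sum.
have specp z : specnorm (dbl z z) `^ p <= 4 `^ p * (\sum_e (specnorm (Ue e z) `^ p) / #|E|%:R).
  rewrite -mulr_suml; set a := (\sum_e _) / _.
  have a0 : 0 <= a by rewrite divr_ge0 // sumr_ge0 // => e _; exact: powR_ge0.
  have EpR : (#|E|%:R : R) != 0 by rewrite pnatr_eq0 -lt0n.
  have : \sum_e (specnorm (Ue e z) `^ p) `^ p^-1 <= #|E|%:R * a `^ p^-1.
    apply: sum_powR_le => //; rewrite ?invr_gt0 ?invf_le1 //.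
      by move=> e; exact: powR_ge0.
    by rewrite /a mulrC divfK.
  under eq_bigr do rewrite -powRrM mulfV ?gt_eqF // powRr1 ?specnorm_ge0 //.
  move=> h.
  have h2 : specnorm (dbl z z) <= 4 * a `^ p^-1.
    rewrite -(@ler_pM2l _ #|E|%:R) ?ltr0n // (le_trans (spec z)) //.
    by rewrite mulrCA ler_wpM2l.
  apply: (@le_trans _ _ ((4 * a `^ p^-1) `^ p)).
    by apply: ge0_ler_powR; rewrite ?nnegrE ?specnorm_ge0 ?mulr_ge0 ?powR_ge0 // ltW.
  by rewrite powRM ?powR_ge0 // -powRrM mulVf ?gt_eqF // powRr1.
set V := (\int[M]_x \int[M]_y _)%E.
have UV e : (\int[M]_z (specnorm (Ue e z) `^ p)%:E <= V)%E.
  (* [Ue e] pairs an index of the set with one outside it; in the mixture these read [x] and [y]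
     respectively, which gives a partial decoupled sum. *)
  rewrite -(mix_law iidM (fun i => e i)); last 2 first.
  - exact: measurable_specnorm_powR.
  - by move=> z; rewrite lee_fin powR_ge0.
  apply: le_trans (drop_kernel (fun i => e i) (fun j => ~~ e j) p1).
  apply: eq_integral_le => x; apply: eq_integral => y _; congr ((specnorm _ `^ p)%:E).
  apply: eq_bigr => i ei; apply: eq_bigr => j ej.
  by rewrite !tnth_mix ei (negPf ej).
have V0 : (0 <= V)%E.
  by apply: integral_ge0 => x _; apply: integral_ge0 => y _; rewrite lee_fin powR_ge0.
apply: (@le_trans _ _ (\int[M]_z (4 `^ p * (\sum_e (specnorm (Ue e z) `^ p) / #|E|%:R))%:E)%E).
  apply: ge0_le_integral_fin => //.
  - by move=> z; exact: powR_ge0.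
  - exact/measurable_powR_comp/measurable_specnorm.
  - apply: measurable_funM => //; apply: measurable_sum => e; apply: measurable_funM => //.
    exact/measurable_powR_comp/measurable_specnorm.
rewrite ge0_integralZl_fin ?powR_ge0 //; last 2 first.
- by move=> z; apply: sumr_ge0 => e _; rewrite divr_ge0 ?powR_ge0.
- apply: measurable_sum => e; apply: measurable_funM => //.
  exact/measurable_powR_comp/measurable_specnorm.
apply: lee_wpmul2l; first by rewrite lee_fin powR_ge0.
under eq_integral do rewrite -sumEFin.
rewrite ge0_integral_sum //; last 2 first.
- move=> e; apply/measurable_EFinP; apply: measurable_funM => //.
  exact/measurable_powR_comp/measurable_specnorm.
- by move=> e z _; rewrite lee_fin divr_ge0 ?powR_ge0.
apply: (@le_trans _ _ (\sum_(e : E) (#|E|%:R^-1)%:E * V)%E).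
  apply: lee_sum => e _; under eq_integral do rewrite mulrC.
  rewrite ge0_integralZl_fin //.
  - by apply: lee_wpmul2l; rewrite ?lee_fin ?invr_ge0.
  - by move=> z; exact: powR_ge0.
  - exact/measurable_powR_comp/measurable_specnorm.
rewrite -ge0_sume_distrl; last by move=> e _; rewrite lee_fin invr_ge0.
rewrite sumEFin sumr_const -(mulr_natr (#|E|%:R^-1 : R)) mulVf ?mul1e //.
by rewrite pnatr_eq0 -lt0n.
Qed.

End DegenerateChaos.

(** * Block matrices *)

Section BlockMatrices.
Context {R : realType} {n d : nat}.
Local Notation C := R[i].
Implicit Type A : 'I_n -> 'I_n -> 'M[C]_d.

Definition blk A : 'M[C]_(\sum_(i < n) d) := \mxblock_(i < n, j < n) A i j.
Definition sqsum A : 'M[C]_d := \sum_i \sum_j A i j *m A i j.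
(** This is [N^2], the larger of the two variance parameters in [rad_chaos]. *)
Definition blkmax A : R := Num.max (specnorm (blk A *m adjmx (blk A))) (specnorm (sqsum A)).
Definition rowmax A : R := \big[Num.max/0]_i specnorm (\sum_j A i j *m A i j).
Definition colmax A : R := \big[Num.max/0]_j specnorm (\sum_i A i j *m A i j).

Lemma blkmax_ge0 A : 0 <= blkmax A.
Proof. by rewrite le_max specnorm_ge0. Qed.

Lemma rowmax_ge0 A : 0 <= rowmax A.
Proof. by apply: bigmax_ge_id. Qed.

Lemma colmax_ge0 A : 0 <= colmax A.
Proof. by apply: bigmax_ge_id. Qed.

Lemma specnorm_row_le A i : specnorm (\sum_j A i j *m A i j) <= rowmax A.
Proof. exact: (le_bigmax_cond _ (fun i => specnorm (\sum_j A i j *m A i j))). Qed.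

Lemma specnorm_col_le A j : specnorm (\sum_i A i j *m A i j) <= colmax A.
Proof. exact: (le_bigmax_cond _ (fun j => specnorm (\sum_i A i j *m A i j))). Qed.

Variable A : 'I_n -> 'I_n -> 'M[C]_d.
Hypothesis hA : forall i j, hermitian_mx (A i j).

Lemma ip_sq_hermitian (B : 'M[C]_d) (v : 'cV[C]_d) : hermitian_mx B ->
  ip (B *m v) (B *m v) = ip v (B *m B *m v).
Proof. by move=> hB; rewrite ip_mull hB mulmxA. Qed.

Lemma sum_sq_quad (I : finType) (B : I -> 'M[C]_d) (v : 'cV[C]_d) :
  (forall i, hermitian_mx (B i)) ->
  \sum_i ip (B i *m v) (B i *m v) = ip v ((\sum_i B i *m B i) *m v).
Proof.
move=> hB; rewrite mulmx_suml ip_sumr; apply: eq_bigr => i _.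
exact: ip_sq_hermitian.
Qed.

Lemma sqsum_pair : sqsum A = \sum_(z : 'I_n * 'I_n) A z.1 z.2 *m A z.1 z.2.
Proof. by rewrite /sqsum pair_bigA. Qed.

Lemma sqsum_quad (v : 'cV[C]_d) :
  \sum_i \sum_j ip (A i j *m v) (A i j *m v) <= specnorm (sqsum A) * ip v v.
Proof.
rewrite pair_bigA /= (@sum_sq_quad _ (fun z => A z.1 z.2)) // -sqsum_pair.
exact: ip_quad_specnorm.
Qed.

Lemma sqsum_blkmax (v : 'cV[C]_d) :
  \sum_i \sum_j ip (A i j *m v) (A i j *m v) <= blkmax A * ip v v.
Proof.
by rewrite (le_trans (sqsum_quad v)) // ler_wpM2r ?ip_ge0 // le_max lexx orbT.
Qed.

Lemma adjblk_quad (v : 'cV[C]_(\sum_(i < n) d)) : ip (adjmx (blk A) *m v) (adjmx (blk A) *m v) <= blkmax A * ip v v.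
Proof.
have := ip_quad_gram_le (adjmx (blk A)) v; rewrite adjmxK => /le_trans; apply.
by rewrite ler_wpM2r ?ip_ge0 // le_max lexx.
Qed.

Lemma blk_quad (v : 'cV[C]_(\sum_(i < n) d)) : ip (blk A *m v) (blk A *m v) <= blkmax A * ip v v.
Proof.
by rewrite -{1 2}(adjmxK (blk A)); apply: ip_adj_le; [exact: blkmax_ge0|exact: adjblk_quad].
Qed.

Lemma gram_mxcol j : adjmx (\mxcol_i A i j : 'M[C]_(\sum_(i < n) d, d)) *m (\mxcol_i A i j)
  = \sum_i A i j *m A i j.
Proof.
rewrite adjmx_mxcol mul_mxrow_mxcol; apply: eq_bigr => i _; by rewrite hA.
Qed.

Lemma adjmx_colblk j : adjmx (\mxrow_i A i j : 'M[C]_(d, \sum_(i < n) d)) = \mxcol_i A i j.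
Proof. by rewrite adjmx_mxrow; apply: eq_mxcol => i; exact: hA. Qed.

Lemma adjmx_blk : adjmx (blk A) = \mxcol_j \mxrow_i A i j.
Proof.
rewrite /blk mxblockEh adjmx_mxrow; apply: eq_mxcol => j.
by rewrite adjmx_mxcol; apply: eq_mxrow => i; exact: hA.
Qed.

Lemma blk_gram : blk A *m adjmx (blk A) =
  \sum_j adjmx (\mxrow_i A i j : 'M[C]_(d, \sum_(i < n) d)) *m (\mxrow_i A i j).
Proof.
rewrite adjmx_blk /blk mxblockEh mul_mxrow_mxcol; apply: eq_bigr => j _.
by rewrite adjmx_colblk.
Qed.

Lemma specnorm_sumsq_le (I J : finType) (B : I -> 'M[C]_d) (D : J -> 'M[C]_d) :
  (forall i, hermitian_mx (B i)) -> (forall j, hermitian_mx (D j)) ->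
  (forall v : 'cV[C]_d, \sum_i ip (B i *m v) (B i *m v) <= \sum_j ip (D j *m v) (D j *m v)) ->
  specnorm (\sum_i B i *m B i) <= specnorm (\sum_j D j *m D j).
Proof.
move=> hB hD h; apply: specnorm_psd_le; first exact: specnorm_ge0.
- by apply: hermitian_sum => i _; rewrite /hermitian_mx adjmxM hB.
- by move=> v; rewrite -sum_sq_quad // sumr_ge0 // => i _; exact: ip_ge0.
- by move=> v; rewrite -sum_sq_quad // (le_trans (h v)) // sum_sq_quad // ip_quad_specnorm.
Qed.

Lemma specnorm_col_sqsum j : specnorm (\sum_i A i j *m A i j) <= specnorm (sqsum A).
Proof.
rewrite sqsum_pair.
apply: (@specnorm_sumsq_le _ _ (fun i => A i j) (fun z => A z.1 z.2)) => // v.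
rewrite -(pair_bigA _ (fun i k => ip (A i k *m v) (A i k *m v))) /=.
apply: ler_sum => i _; rewrite (bigD1 j) //= lerDl sumr_ge0 // => k _; exact: ip_ge0.
Qed.

Lemma colmax_le_blkmax : colmax A <= blkmax A.
Proof.
apply/bigmax_leP; split=> [|j _]; first exact: blkmax_ge0.
by rewrite (le_trans (specnorm_col_sqsum j)) // le_max lexx orbT.
Qed.

Lemma sum_ip_blkmax : \sum_j \sum_i ip (A i j) (A i j) <= 2 * d%:R * blkmax A.
Proof.
have := @sum_ip_trace_le R ('I_n * 'I_n)%type d (fun z => A z.1 z.2) (blkmax A).
rewrite exchange_big pair_bigA /= => h; apply: le_trans (h _) _ => [v|].
  by apply: le_trans (sqsum_blkmax v); rewrite pair_bigA.
by rewrite ler_wpM2r ?blkmax_ge0 //; have := ler0n R d; lra.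
Qed.

(** The factor is crude but enters no constant: the bound only makes the moment of [blkmax] finite
    when that of [rowmax] is. *)
Lemma blkmax_le_rowmax : blkmax A <= (n * d.+1)%:R * rowmax A.
Proof.
have r0 := rowmax_ge0 A.
have row i : \sum_j ip (A i j) (A i j) <= d%:R * rowmax A.
  apply: sum_ip_trace_le => v; rewrite sum_sq_quad //.
  by rewrite (le_trans (ip_quad_specnorm _ _)) // ler_wpM2r ?ip_ge0 // specnorm_row_le.
have nat_sum (c : R) : \sum_(i < n) c = n%:R * c by rewrite sumr_const card_ord mulr_natl.
rewrite ge_max; apply/andP; split.
  have h : ip (adjmx (blk A)) (adjmx (blk A)) <= n%:R * (d%:R * rowmax A).
    rewrite adjmx_blk ip_mxcol.
    under eq_bigr do rewrite ip_mxrow.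
    by rewrite exchange_big -nat_sum; apply: ler_sum => i _; exact: row.
  rewrite -{1}(adjmxK (blk A)); apply: specnorm_gram_le => [|v]; first exact: mulr_ge0.
  rewrite (le_trans (ip_mulmx_le _ _)) // ler_wpM2r ?ip_ge0 // (le_trans h) //.
  by rewrite mulrA -natrM ler_wpM2r // ler_nat leq_mul.
rewrite (le_trans (specnorm_sum _ _ _)) //.
apply: (@le_trans _ _ (n%:R * rowmax A)).
  by rewrite -nat_sum; apply: ler_sum => i _; exact: specnorm_row_le.
by rewrite ler_wpM2r // ler_nat leq_pmulr.
Qed.

End BlockMatrices.

Section BlockTranspose.
Context {R : realType} {n d : nat}.
Variable A : 'I_n -> 'I_n -> 'M[R[i]]_d.
Hypothesis hA : forall i j, hermitian_mx (A i j).

Lemma blk_flip : blk (fun i j => A j i) = adjmx (blk A).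
Proof. by rewrite adjmx_blk // /blk mxblockEv. Qed.

Lemma sqsum_flip : sqsum (fun i j => A j i) = sqsum A.
Proof. exact: exchange_big. Qed.

Lemma blkmax_flip : blkmax (fun i j => A j i) = blkmax A.
Proof.
have g1 := specnorm_gramC (blk A).
have g2 := specnorm_gramC (adjmx (blk A)); rewrite adjmxK in g2.
have E : specnorm (adjmx (blk A) *m blk A) = specnorm (blk A *m adjmx (blk A)).
  by apply: le_anti; apply/andP; split; [exact: g2|exact: g1].
transitivity (Num.max (specnorm (adjmx (blk A) *m blk A)) (specnorm (sqsum A))).
  by rewrite [LHS]/blkmax blk_flip adjmxK; congr (Num.max _ (specnorm _)); exact: sqsum_flip.
by rewrite E.
Qed.

End BlockTranspose.

(** * The product of two probability measures *)

Section ProductProbability.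
Context {R : realType} {d1 d2 : measure_display} {T1 : measurableType d1} {T2 : measurableType d2}.
Variables (P1 : probability T1 R) (P2 : probability T2 R).

Let product_setT : (P1 \x P2)%E setT = 1%E.
Proof.
rewrite -setXTT product_measure1E //.
by rewrite (_ : (_ * _)%E = (P1 setT * P2 setT)%E) // !probability_setT mule1.
Qed.

(** Lets results on probability measures, such as [mx_integrable_specnorm], apply to [M \x M]. *)
HB.instance Definition _ := Measure_isProbability.Build _ _ _ (P1 \x P2)%E product_setT.

End ProductProbability.

Section BlockMeasurability.
Context {R : realType} {dT : measure_display} {T : measurableType dT} {n : nat}.
Local Notation C := R[i].

Lemma mx_measurable_mxrow k l (F : 'I_n -> T -> 'M[C]_(k, l)) :
  (forall i, mx_measurable (F i)) ->
  mx_measurable (fun x => \mxrow_i F i x : 'M[C]_(k, \sum_(i < n) l)).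
Proof.
move=> mF a b; have [F1 F2] := mF (tagnat.sig1 b) a (tagnat.sig2 b); split.
  by rewrite (_ : (fun x => _) = fun x => complex.Re (F (tagnat.sig1 b) x a (tagnat.sig2 b))) //;
     apply/funext => x; rewrite mxE.
by rewrite (_ : (fun x => _) = fun x => complex.Im (F (tagnat.sig1 b) x a (tagnat.sig2 b))) //;
   apply/funext => x; rewrite mxE.
Qed.

Lemma mx_measurable_mxcol k l (F : 'I_n -> T -> 'M[C]_(k, l)) :
  (forall i, mx_measurable (F i)) ->
  mx_measurable (fun x => \mxcol_i F i x : 'M[C]_(\sum_(i < n) k, l)).
Proof.
move=> mF a b; have [F1 F2] := mF (tagnat.sig1 a) (tagnat.sig2 a) b; split.
  by rewrite (_ : (fun x => _) = fun x => complex.Re (F (tagnat.sig1 a) x (tagnat.sig2 a) b)) //;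
     apply/funext => x; rewrite mxE.
by rewrite (_ : (fun x => _) = fun x => complex.Im (F (tagnat.sig1 a) x (tagnat.sig2 a) b)) //;
   apply/funext => x; rewrite mxE.
Qed.

Lemma mx_measurable_blk d (F : 'I_n -> 'I_n -> T -> 'M[C]_d) :
  (forall i j, mx_measurable (F i j)) -> mx_measurable (fun x => blk (fun i j => F i j x)).
Proof.
move=> mF; rewrite (_ : (fun x => _) =
  (fun x => \mxcol_i \mxrow_j F i j x : 'M[C]_(\sum_(i < n) d, \sum_(i < n) d))).
  by apply: mx_measurable_mxcol => i; exact: mx_measurable_mxrow.
by apply/funext => x; rewrite /blk mxblockEv.
Qed.

Lemma measurable_bigmaxr I (s : seq I) (f : I -> T -> R) :
  (forall i, measurable_fun setT (f i)) ->
  measurable_fun setT (fun x => \big[Num.max/0]_(i <- s) f i x).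
Proof.
move=> mf; elim: s => [|i s IH].
  by under eq_fun do rewrite big_nil; exact: measurable_cst.
under eq_fun do rewrite big_cons; exact: measurable_maxr.
Qed.

Variables (d : nat) (F : 'I_n -> 'I_n -> T -> 'M[C]_d).
Hypothesis mF : forall i j, mx_measurable (F i j).

Lemma mx_measurable_sqsum : mx_measurable (fun x => sqsum (fun i j => F i j x)).
Proof.
by apply: mx_measurable_sum => i _; apply: mx_measurable_sum => j _; exact: mx_measurableM.
Qed.

Lemma mx_measurable_blk_gram :
  mx_measurable (fun x => blk (fun i j => F i j x) *m adjmx (blk (fun i j => F i j x))).
Proof.
by apply: mx_measurableM; [|apply: mx_measurable_adj]; exact: mx_measurable_blk.
Qed.

Lemma measurable_blkmax : measurable_fun setT (fun x => blkmax (fun i j => F i j x)).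
Proof.
apply: measurable_maxr; apply: measurable_specnorm.
  exact: mx_measurable_blk_gram.
exact: mx_measurable_sqsum.
Qed.

Lemma measurable_rowmax : measurable_fun setT (fun x => rowmax (fun i j => F i j x)).
Proof.
apply: measurable_bigmaxr => i; apply: measurable_specnorm.
by apply: mx_measurable_sum => j _; exact: mx_measurableM.
Qed.

Lemma measurable_colmax : measurable_fun setT (fun x => colmax (fun i j => F i j x)).
Proof.
apply: measurable_bigmaxr => j; apply: measurable_specnorm.
by apply: mx_measurable_sum => i _; exact: mx_measurableM.
Qed.

End BlockMeasurability.

(** * Moments of the decoupled chaos *)

Section ChaosMoments.
Context {R : realType} {dS : measure_display} {S : measurableType dS} {n d : nat}.
Local Notation C := R[i].
Local Notation T := (n.-tuple S).
Variables (mu : probability S R) (M : probability T R).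
Hypothesis iidM : iid_law mu M.
Variable K : 'I_n -> 'I_n -> S -> S -> 'M[C]_d.
Hypothesis mK : forall i j, mx_measurable (fun z : S * S => K i j z.1 z.2).
Hypothesis hK : forall i j x y, hermitian_mx (K i j x y).
Hypothesis sK : forall i j x y, K i j x y = K j i y x.
Hypothesis iK : forall i j x, mx_integrable mu (K i j x).
Hypothesis eK : forall i j x, mx_expect mu (K i j x) = 0.
Variables (r q : R).
Hypotheses (r1 : 1 <= r) (dr : d%:R <= expR (r - 1)) (q1 : 1 <= q) (qr : q <= r).

Definition kmx (x y : T) i j := K i j (tnth x i) (tnth y j).

Lemma kmx_flip x y : kmx y x = fun i j => kmx x y j i.
Proof. by apply/funext => i; apply/funext => j; rewrite /kmx sK. Qed.

Lemma mx_measurable_kmx i j : mx_measurable (fun z : T * T => kmx z.1 z.2 i j).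
Proof. exact: mx_measurable_kernel. Qed.

Lemma measurable_sec1 (x : T) : measurable_fun setT (fun y : T => (x, y)).
Proof. exact: measurable_fun_pair. Qed.

Lemma integral_prod (F : T * T -> \bar R) : measurable_fun setT F -> (forall z, 0 <= F z)%E ->
  (\int[M]_x \int[M]_y F (x, y) = \int[M \x M]_z F z)%E.
Proof. by move=> mF F0; rewrite fubini_tonelli1. Qed.

Lemma integral_prod_specnorm m (F : T * T -> 'M[C]_m) p : mx_measurable F ->
  (\int[M]_x \int[M]_y (specnorm (F (x, y)) `^ p)%:E = \int[M \x M]_z (specnorm (F z) `^ p)%:E)%E.
Proof.
move=> mF; apply: (integral_prod (F := fun z => (specnorm (F z) `^ p)%:E)).
  exact: measurable_specnorm_powR.
by move=> z; rewrite lee_fin powR_ge0.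
Qed.

(** One factor [2^p] per family: [y] is frozen while [x] receives the signs [e], then [x] is frozen
    while [y] receives [e']. Degeneracy makes the subtracted means vanish. *)
Lemma chaos_symmetrize (e e' : {ffun 'I_n -> bool}) p : 1 <= p ->
  (\int[M \x M]_z (specnorm (dbl K z.1 z.2) `^ p)%:E <=
   (2 `^ p * 2 `^ p)%:E * \int[M \x M]_z (specnorm
      (rad (fun j => rad (fun i => kmx z.1 z.2 i j) e) e') `^ p)%:E)%E.
Proof.
move=> p1.
pose F0 (z : T * T) := dbl K z.1 z.2.
pose F1 (z : T * T) := \sum_j rad (fun i => kmx z.1 z.2 i j) e.
pose F2 (z : T * T) := rad (fun j => rad (fun i => kmx z.1 z.2 i j) e) e'.
have mF0 : mx_measurable F0.
  by apply: mx_measurable_sum => i _; apply: mx_measurable_sum => j _; exact: mx_measurable_kmx.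
have mr j : mx_measurable (fun z : T * T => rad (fun i => kmx z.1 z.2 i j) e).
  by apply: (@mx_measurable_rad _ _ _ _ _ (fun i z => kmx z.1 z.2 i j)) => i;
     exact: mx_measurable_kmx.
have mF1 : mx_measurable F1 by apply: mx_measurable_sum => j _.
have mF2 : mx_measurable F2.
  exact: (@mx_measurable_rad _ _ _ _ _ (fun j z => rad (fun i => kmx z.1 z.2 i j) e)).
have c0 : 0 <= 2 `^ p :> R by exact: powR_ge0.
have s1 := le_integral_section2 (M := M) (p := p) (F := F0) (G := F1) c0 mF0 mF1.
have s2 := le_integral_section1 (M := M) (p := p) (F := F1) (G := F2) c0 mF1 mF2.
rewrite -[leLHS](integral_prod_specnorm p mF0) -[X in (_ * X)%E](integral_prod_specnorm p mF2).
apply: (le_trans (s1 _)); last first.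
  rewrite EFinM -muleA; apply: lee_wpmul2l; first by rewrite lee_fin.
  apply: s2 => x.
  pose Y j s := rad (fun i => K i j (tnth x i) s) e.
  have iY j : mx_integrable mu (Y j).
    by apply: mx_integrable_sum => i _; apply: mx_integrable_sign; exact: iK.
  have EY j : mx_expect mu (Y j) = 0.
    rewrite mx_expect_sum => [|i _]; last by apply: mx_integrable_sign; exact: iK.
    by rewrite big1 // => i _; rewrite mx_expect_sign ?eK ?scaler0 //; exact: iK.
  apply: (le_trans (eq_integral_le _ _)); last exact: (specnorm_symmetrize iidM e' p1 iY).
  by move=> y; congr ((specnorm _ `^ p)%:E); apply: eq_bigr => j _; rewrite EY subr0.
move=> y.
pose Y i s := \sum_j K i j s (tnth y j).
have iY i : mx_integrable mu (Y i).
  by apply: mx_integrable_sum => j _; exact: (integrable_kernelC sK iK).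
have EY i : mx_expect mu (Y i) = 0.
  rewrite mx_expect_sum => [|j _]; last exact: (integrable_kernelC sK iK).
  by rewrite big1 // => j _; exact: (expect_kernelC sK eK).
apply: (le_trans (eq_integral_le _ _)).
- move=> x; rewrite (_ : F0 (x, y) = \sum_i (Y i (tnth x i) - mx_expect mu (Y i))) //.
  by apply: eq_bigr => i _; rewrite EY subr0.
- apply: (le_trans (specnorm_symmetrize iidM e p1 iY)).
  apply: lee_wpmul2l; first by rewrite lee_fin.
  apply: eq_integral_le => x; congr ((specnorm _ `^ p)%:E).
  by rewrite /F1 exchange_big /=; apply: eq_bigr => i _; rewrite -scaler_sumr.
Qed.

Lemma chaos_moment :
  (\int[M \x M]_z (specnorm (dbl K z.1 z.2) `^ (2 * q))%:E <=
   (4 `^ (2 * q))%:E * \int[M \x M]_z (((9 / 2 * r) ^+ 2 * blkmax (kmx z.1 z.2)) `^ q)%:E)%E.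
Proof.
have q0 : 0 < q by rewrite (lt_le_trans ltr01).
have p1 : 1 <= 2 * q by rewrite -[leLHS]mul1r ler_pM // ler1n.
pose E := {ffun 'I_n -> bool}.
pose F (e : E * E) (z : T * T) := rad (fun j => rad (fun i => kmx z.1 z.2 i j) e.1) e.2.
have mF e : mx_measurable (F e).
  apply: (@mx_measurable_rad _ _ _ _ _ (fun j z => rad (fun i => kmx z.1 z.2 i j) e.1)) => j.
  by apply: (@mx_measurable_rad _ _ _ _ _ (fun i z => kmx z.1 z.2 i j)) => i;
     exact: mx_measurable_kmx.
have c4 : 2 `^ (2 * q) * 2 `^ (2 * q) = 4 `^ (2 * q) :> R.
  by rewrite -powRM // -natrM.
have mN : measurable_fun setT (fun z : T * T => ((9 / 2 * r) ^+ 2 * blkmax (kmx z.1 z.2)) `^ q).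
  apply: measurable_powR_comp; apply: measurable_funM => //.
  exact: (measurable_blkmax mx_measurable_kmx).
apply: (@le_of_average _ (E * E)%type _ _
  (fun e => (4 `^ (2 * q))%:E * \int[M \x M]_z (specnorm (F e z) `^ (2 * q))%:E)%E).
- by rewrite card_prod muln_gt0 !card_signs_gt0.
- by move=> [e e']; rewrite -c4; exact: chaos_symmetrize.
rewrite -ge0_sume_distrr; last first.
  by move=> e _; apply: integral_ge0 => z _; rewrite lee_fin powR_ge0.
rewrite muleCA; apply: lee_wpmul2l; first by rewrite lee_fin powR_ge0.
rewrite -ge0_integral_sum //; last 2 first.
- by move=> e; exact: measurable_specnorm_powR.
- by move=> e z _; rewrite lee_fin powR_ge0.
rewrite -ge0_integralZl_fin //; last by move=> z; exact: powR_ge0.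
apply: ge0_le_integral => //.
- by move=> z _; apply: sume_ge0 => e _; rewrite lee_fin powR_ge0.
- by apply: emeasurable_sum => e; exact: measurable_specnorm_powR.
- by apply/measurable_EFinP; exact: measurable_funM.
move=> z _; rewrite sumEFin lee_fin card_prod natrM -expr2.
have := @rad_chaos _ d r r1 dr n (kmx z.1 z.2) (fun i j => hK _ _ _ _) (blkmax (kmx z.1 z.2)) q
  (blkmax_ge0 _) q0 qr.
move=> h; apply: le_trans (h _ _).
- by rewrite pair_bigA.
- by move=> v; apply: sqsum_blkmax => i j; exact: hK.
- by move=> v; exact: blk_quad.
Qed.

End ChaosMoments.

(** * Partial expectation and Fubini's theorem for matrices *)

Section PartialExpectation.
Context {R : realType} {d1 d2 : measure_display} {T1 : measurableType d1} {T2 : measurableType d2}.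
Local Notation C := R[i].
Variables (M1 : probability T1 R) (M2 : probability T2 R).

(** Holds even when sections are not integrable: the integral is [fine] of a difference of two
    Tonelli integrals. *)
Lemma measurable_Rintegral_section (f : T1 * T2 -> R) : measurable_fun setT f ->
  measurable_fun setT (fun x => Rintegral M2 setT (fun y => f (x, y))).
Proof.
move=> mf; apply: (measurableT_comp (f := fine)) => //.
have mE : measurable_fun setT (fun z => (f z)%:E) by exact/measurable_EFinP.
rewrite (_ : (fun x => _) = (fun x => \int[M2]_y ((fun z => (f z)%:E)^\+ (x, y)))%E \-
    (fun x => \int[M2]_y ((fun z => (f z)%:E)^\- (x, y)))%E)%E.
  apply: emeasurable_funB.
    apply: (measurable_fun_fubini_tonelli_F ((fun z => (f z)%:E)^\+)%E) => //.
    exact: measurable_funepos.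
  apply: (measurable_fun_fubini_tonelli_F ((fun z => (f z)%:E)^\-)%E) => //.
  exact: measurable_funeneg.
apply/funext => x; rewrite [LHS]integralE; congr (_ - _)%E.
  by apply: eq_integral => y _; rewrite !funeposE.
by apply: eq_integral => y _; rewrite !funenegE.
Qed.

Lemma mx_measurable_expect m k (F : T1 * T2 -> 'M[C]_(m, k)) : mx_measurable F ->
  mx_measurable (fun x => mx_expect M2 (fun y => F (x, y))).
Proof.
move=> mF a b; have [F1 F2] := mF a b; split.
  rewrite (_ : (fun x => _) = fun x => Rintegral M2 setT (fun y => complex.Re (F (x, y) a b))).
    exact: (measurable_Rintegral_section F1).
  by apply/funext => x; rewrite mxE.
rewrite (_ : (fun x => _) = fun x => Rintegral M2 setT (fun y => complex.Im (F (x, y) a b))).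
  exact: (measurable_Rintegral_section F2).
by apply/funext => x; rewrite mxE.
Qed.

Lemma Rintegral_fubini (f : T1 * T2 -> R) : (M1 \x M2)%E.-integrable setT (EFin \o f) ->
  M1.-integrable setT (EFin \o (fun x => Rintegral M2 setT (fun y => f (x, y)))) /\
  Rintegral M1 setT (fun x => Rintegral M2 setT (fun y => f (x, y))) =
  Rintegral (M1 \x M2)%E setT f.
Proof.
move=> intf; have mf : measurable_fun setT f.
  by apply/measurable_EFinP; exact: measurable_int intf.
have inth := integrable_fubini_F intf; pose h := fubini_F M2 (EFin \o f).
have mg := measurable_Rintegral_section mf.
have gh x : Rintegral M2 setT (fun y => f (x, y)) = fine (h x) by [].
split.
  apply: le_integrable inth => //; first exact/measurable_EFinP.
  move=> x _; rewrite /= gh -/(h x).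
  by case: (h x) => //= ; rewrite ?normr0 ?leey.
rewrite /Rintegral -(integral12_prod_meas1 intf); congr fine.
apply: ae_eq_integral => //; first exact/measurable_EFinP.
  exact: measurable_int inth.
(* On a null set the section integral may be infinite, where [fine] returns 0; the comparison
   therefore holds almost everywhere only. *)
have := integrable_ae measurableT inth; apply: filterS => x /(_ I) hx _.
by rewrite -/(Rintegral _ _ _) gh fineK.
Qed.

Lemma mx_fubini m k (F : T1 * T2 -> 'M[C]_(m, k)) : mx_integrable (M1 \x M2)%E F ->
  mx_integrable M1 (fun x => mx_expect M2 (fun y => F (x, y))) /\
  mx_expect M1 (fun x => mx_expect M2 (fun y => F (x, y))) = mx_expect (M1 \x M2)%E F.
Proof.
move=> iF; split.
  move=> a b; have [F1 F2] := iF a b.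
  have [G1 _] := Rintegral_fubini F1; have [G2 _] := Rintegral_fubini F2; split.
    by apply: eq_integrable G1 => // x _; rewrite /= mxE.
  by apply: eq_integrable G2 => // x _; rewrite /= mxE.
apply/matrixP => a b; have [F1 F2] := iF a b.
have [_ G1] := Rintegral_fubini F1; have [_ G2] := Rintegral_fubini F2.
rewrite !mxE /cexpect -G1 -G2.
congr Complex; apply: eq_Rintegral => x _; by rewrite mxE.
Qed.

End PartialExpectation.

(** * Deviations of the block matrices *)

Section KernelDeviations.
Context {R : realType} {dS : measure_display} {S : measurableType dS} {n d : nat}.
Local Notation C := R[i].
Local Notation T := (n.-tuple S).
Variables (mu : probability S R) (M : probability T R).
Hypothesis iidM : iid_law mu M.
Variable K : 'I_n -> 'I_n -> S -> S -> 'M[C]_d.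
Hypothesis mK : forall i j, mx_measurable (fun z : S * S => K i j z.1 z.2).
Hypothesis hK : forall i j x y, hermitian_mx (K i j x y).
Hypothesis sK : forall i j x y, K i j x y = K j i y x.
Variables (r q : R).
Hypotheses (r1 : 1 <= r) (dr : d%:R <= expR (r - 1)) (q1 : 1 <= q) (qr : q <= r).

Local Notation kmx := (kmx K).
Definition gmx (z : T * T) := blk (kmx z.1 z.2) *m adjmx (blk (kmx z.1 z.2)).
Definition smx (z : T * T) := sqsum (kmx z.1 z.2).
Definition devbound (a b : R) : R := 2 `^ q * (9 / 2 * r * (a * b)) `^ (q / 2).

Lemma devbound_ge0 a b : 0 <= devbound a b.
Proof. by rewrite mulr_ge0 ?powR_ge0. Qed.

Lemma hermitian_kmx x y i j : hermitian_mx (kmx x y i j).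
Proof. exact: hK. Qed.

Lemma mx_measurable_gmx : mx_measurable gmx.
Proof. exact: (mx_measurable_blk_gram (mx_measurable_kmx mK)). Qed.

Lemma mx_measurable_smx : mx_measurable smx.
Proof. exact: (mx_measurable_sqsum (mx_measurable_kmx mK)). Qed.

Lemma measurable_kblkmax : measurable_fun setT (fun z : T * T => blkmax (kmx z.1 z.2)).
Proof. exact: (measurable_blkmax (mx_measurable_kmx mK)). Qed.

Lemma measurable_kcolmax : measurable_fun setT (fun z : T * T => colmax (kmx z.1 z.2)).
Proof. exact: (measurable_colmax (mx_measurable_kmx mK)). Qed.

Lemma measurable_krowmax : measurable_fun setT (fun z : T * T => rowmax (kmx z.1 z.2)).
Proof. exact: (measurable_rowmax (mx_measurable_kmx mK)). Qed.

Lemma measurable_devbound (f g : T * T -> R) : measurable_fun setT f -> measurable_fun setT g ->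
  measurable_fun setT (fun z => devbound (f z) (g z)).
Proof.
move=> mf mg; apply: measurable_funM => //; apply: measurable_powR_comp.
by apply: measurable_funM => //; exact: measurable_funM.
Qed.

Lemma mx_measurable_kernel1 i j (x : S) : mx_measurable (K i j x).
Proof.
apply: (mx_measurable_comp (mK i j) (g := fun s : S => (x, s))).
exact: measurable_fun_pair.
Qed.

(** With [x] fixed, the Gram matrix is a sum over [j] of terms depending on [tnth y j] alone, hence
    independent. The norm of such a term is unchanged by swapping the factors, which gives a column
    sum of squares and so [colmax]. *)
Lemma gmx_deviation x :
  (\int[M]_y (specnorm (gmx (x, y) - mx_expect M (fun y => gmx (x, y))) `^ q)%:E <=
   \int[M]_y (devbound (colmax (kmx x y)) (blkmax (kmx x y)))%:E)%E.
Proof.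
pose B j s : 'M[C]_(d, \sum_(i < n) d) := \mxrow_i K i j (tnth x i) s.
have gE y : gmx (x, y) = \sum_j adjmx (B j (tnth y j)) *m B j (tnth y j).
  exact: (blk_gram (hermitian_kmx x y)).
have EE : mx_expect M (fun y => gmx (x, y)) =
    mx_expect M (fun y => \sum_j adjmx (B j (tnth y j)) *m B j (tnth y j)).
  by congr (mx_expect M _); apply/funext => y; exact: gE.
apply: (le_trans (eq_integral_le _ _)); first by move=> y; rewrite gE EE.
apply: (gram_deviation iidM r1 dr q1 qr (B := B)
  (kap := fun y => colmax (kmx x y)) (L := fun y => blkmax (kmx x y))).
- by move=> j; apply: mx_measurable_mxrow => i; exact: mx_measurable_kernel1.
- exact: (measurableT_comp measurable_kcolmax (measurable_sec1 x)).
- exact: (measurableT_comp measurable_kblkmax (measurable_sec1 x)).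
- by move=> y; exact: colmax_ge0.
- by move=> y; exact: (colmax_le_blkmax (hermitian_kmx x y)).
- move=> y j; apply: le_trans (specnorm_col_le _ j).
  have := specnorm_gramC (adjmx (B j (tnth y j))); rewrite adjmxK => /le_trans; apply.
  rewrite (adjmx_colblk (hermitian_kmx x y)).
  have := gram_mxcol (hermitian_kmx x y) j.
  by rewrite -(adjmx_colblk (hermitian_kmx x y)) adjmxK => ->.
- move=> y v; apply: le_trans (adjblk_quad _ v).
  by rewrite (adjmx_blk (hermitian_kmx x y)) mxcol_mul ip_mxcol.
- move=> y; apply: le_trans (sum_ip_blkmax (hermitian_kmx x y)).
  by apply: ler_sum => j _; rewrite ip_mxrow.
Qed.

Lemma smx_deviation x :
  (\int[M]_y (specnorm (smx (x, y) - mx_expect M (fun y => smx (x, y))) `^ q)%:E <=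
   \int[M]_y (devbound (colmax (kmx x y)) (blkmax (kmx x y)))%:E)%E.
Proof.
pose B j s : 'M[C]_(\sum_(i < n) d, d) := \mxcol_i K i j (tnth x i) s.
have BB y j : adjmx (B j (tnth y j)) *m B j (tnth y j) = \sum_i kmx x y i j *m kmx x y i j.
  exact: (gram_mxcol (hermitian_kmx x y)).
have sE y : smx (x, y) = \sum_j adjmx (B j (tnth y j)) *m B j (tnth y j).
  by rewrite /smx /sqsum exchange_big /=; apply: eq_bigr => j _; rewrite BB.
have EE : mx_expect M (fun y => smx (x, y)) =
    mx_expect M (fun y => \sum_j adjmx (B j (tnth y j)) *m B j (tnth y j)).
  by congr (mx_expect M _); apply/funext => y; exact: sE.
apply: (le_trans (eq_integral_le _ _)); first by move=> y; rewrite sE EE.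
apply: (gram_deviation iidM r1 dr q1 qr (B := B)
  (kap := fun y => colmax (kmx x y)) (L := fun y => blkmax (kmx x y))).
- by move=> j; apply: mx_measurable_mxcol => i; exact: mx_measurable_kernel1.
- exact: (measurableT_comp measurable_kcolmax (measurable_sec1 x)).
- exact: (measurableT_comp measurable_kblkmax (measurable_sec1 x)).
- by move=> y; exact: colmax_ge0.
- by move=> y; exact: (colmax_le_blkmax (hermitian_kmx x y)).
- by move=> y j; rewrite BB; exact: (specnorm_col_le (kmx x y)).
- move=> y v; apply: le_trans (sqsum_blkmax (hermitian_kmx x y) v).
  rewrite exchange_big /=; apply: ler_sum => j _.
  by rewrite mxcol_mul ip_mxcol.
- move=> y; apply: le_trans (sum_ip_blkmax (hermitian_kmx x y)).
  by apply: ler_sum => j _; rewrite ip_mxcol.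
Qed.

Lemma integral_deviation m (F : T * T -> 'M[C]_m) (b : T * T -> R) : mx_measurable F ->
  measurable_fun setT b -> (forall z, 0 <= b z) ->
  (forall x, \int[M]_y (specnorm (F (x, y) - mx_expect M (fun y => F (x, y))) `^ q)%:E <=
     \int[M]_y (b (x, y))%:E)%E ->
  (\int[M \x M]_z (specnorm (F z - mx_expect M (fun y => F (z.1, y))) `^ q)%:E <=
   \int[M \x M]_z (b z)%:E)%E.
Proof.
move=> mF mb b0 h.
have mD : mx_measurable (fun z : T * T => F z - mx_expect M (fun y => F (z.1, y))).
  apply: mx_measurableB => //.
  exact: (mx_measurable_comp (mx_measurable_expect M mF) measurable_fst).
have mbE : measurable_fun setT (fun z => (b z)%:E) by exact/measurable_EFinP.
have b0E z : (0 <= (b z)%:E)%E by rewrite lee_fin.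
rewrite -[leLHS](integral_prod_specnorm M q mD) -[leRHS](integral_prod M mbE b0E).
apply: ge0_le_integral => //.
- by move=> x _; apply: integral_ge0 => y _; rewrite lee_fin powR_ge0.
- apply: (measurable_fun_fubini_tonelli_F (fun z => (specnorm (F z -
    mx_expect M (fun y => F (z.1, y))) `^ q)%:E)).
    exact: measurable_specnorm_powR.
  by move=> z; rewrite lee_fin powR_ge0.
- exact: (measurable_fun_fubini_tonelli_F (fun z => (b z)%:E)).
Qed.

Lemma smxC x y : smx (x, y) = smx (y, x).
Proof. by rewrite /smx /= (kmx_flip sK x y) sqsum_flip. Qed.

Lemma colmax_kmxC x y : colmax (kmx y x) = rowmax (kmx x y).
Proof. by rewrite (kmx_flip sK x y). Qed.

Lemma blkmax_kmxC x y : blkmax (kmx y x) = blkmax (kmx x y).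
Proof. by rewrite (kmx_flip sK x y) (blkmax_flip (hermitian_kmx x y)). Qed.

Definition smxE x := mx_expect M (fun y => smx (x, y)).

Hypothesis finS : (\int[M \x M]_z (specnorm (smx z) `^ q)%:E < +oo)%E.

Lemma mx_integrable_smx : mx_integrable (M \x M)%E smx.
Proof. exact: (mx_integrable_specnorm q1 mx_measurable_smx finS). Qed.

(* Jensen in [y]: [smxE x - E smx = E_y (smx (x, y) - smxE y)], as [smx] is symmetric. *)
Lemma smxE_deviation :
  (\int[M]_x (specnorm (smxE x - mx_expect (M \x M)%E smx) `^ q)%:E <=
   \int[M \x M]_z (devbound (rowmax (kmx z.1 z.2)) (blkmax (kmx z.1 z.2)))%:E)%E.
Proof.
have [iV EV] := mx_fubini mx_integrable_smx.
have mV : mx_measurable smxE by exact: (mx_measurable_expect M mx_measurable_smx).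
pose D (z : T * T) := smx z - smxE z.2.
have mD : mx_measurable D.
  apply: mx_measurableB; first exact: mx_measurable_smx.
  exact: (mx_measurable_comp mV measurable_snd).
have step1 : (\int[M]_x (specnorm (smxE x - mx_expect (M \x M)%E smx) `^ q)%:E <=
    \int[M]_x \int[M]_y (specnorm (D (x, y)) `^ q)%:E)%E.
  apply: ae_ge0_le_integral => //.
  - by move=> x _; rewrite lee_fin powR_ge0.
  - apply: measurable_specnorm_powR; apply: mx_measurableB => //; exact: mx_measurable_cst.
  - by move=> x _; apply: integral_ge0 => y _; rewrite lee_fin powR_ge0.
  - apply: (measurable_fun_fubini_tonelli_F (fun z => (specnorm (D z) `^ q)%:E)).
      exact: measurable_specnorm_powR.
    by move=> z; rewrite lee_fin powR_ge0.
  have intS : (M \x M)%E.-integrable setT (fun z => (specnorm (smx z) `^ q)%:E).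
    apply/integrableP; split; first exact: (measurable_specnorm_powR q mx_measurable_smx).
    apply: le_lt_trans finS; apply: eq_integral_le => z.
    by rewrite gee0_abs // lee_fin powR_ge0.
  (* Finiteness on the product makes the sections integrable for almost every [x] only, whence the
     almost-everywhere comparison. *)
  have := ae_integrable1 intS; apply: filterS => x /integrableP[_ fx] _.
  have ix : mx_integrable M (fun y => smx (x, y)).
    apply: (mx_integrable_specnorm q1).
      exact: (mx_measurable_comp mx_measurable_smx (measurable_sec1 x)).
    apply: le_lt_trans fx; apply: eq_integral_le => y.
    by rewrite gee0_abs // lee_fin powR_ge0.
  have E : smxE x - mx_expect (M \x M)%E smx = mx_expect M (fun y => D (x, y)).
    rewrite mx_expectD //; last exact: mx_integrableN.
    by rewrite mx_expectN // EV.
  rewrite E; apply: specnorm_powR_expect_le => //.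
  by apply: mx_integrableD => //; exact: mx_integrableN.
apply: (le_trans step1); rewrite [leLHS](integral_swap M q mD).
have mb : measurable_fun setT (fun z : T * T =>
    devbound (rowmax (kmx z.1 z.2)) (blkmax (kmx z.1 z.2))).
  by apply: measurable_devbound; [exact: measurable_krowmax|exact: measurable_kblkmax].
have mbE : measurable_fun setT (fun z : T * T =>
    (devbound (rowmax (kmx z.1 z.2)) (blkmax (kmx z.1 z.2)))%:E) by exact/measurable_EFinP.
rewrite -[leRHS](integral_prod M mbE); last by move=> z; rewrite lee_fin devbound_ge0.
rewrite [leRHS](fubini_tonelli _ mbE); last by move=> z; rewrite lee_fin devbound_ge0.
apply: ge0_le_integral => //.
- by move=> y _; apply: integral_ge0 => x _; rewrite lee_fin powR_ge0.
- exact: (measurable_section2 M q mD).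
- apply: (measurable_fun_fubini_tonelli_G _ mbE).
  by move=> z; rewrite lee_fin devbound_ge0.
(* Symmetry of [smx] exchanges the variables, so the fixed-[x] deviation applies at [y], and
   transposition turns [colmax] into [rowmax]. *)
move=> y _; apply: (le_trans (eq_integral_le _ _)).
  by move=> x; rewrite /D /= smxC.
apply: (le_trans (smx_deviation y)); apply: eq_integral_le => x.
by rewrite colmax_kmxC blkmax_kmxC.
Qed.

End KernelDeviations.

(** * Moments *)

Section Moments.
Context {R : realType} {dT : measure_display} {T : measurableType dT}.
Variable P : probability T R.

Definition mom (q : R) (f : T -> R) : \bar R := (\int[P]_x (f x `^ q)%:E)%E.

Lemma mom_ge0 q f : (0 <= mom q f)%E.
Proof. by apply: integral_ge0 => x _; rewrite lee_fin powR_ge0. Qed.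

Lemma adde_thrice (a b c : \bar R) : (a + (b + (b + (b + c))) = a + c + 3%:E * b)%E.
Proof.
have -> : (3%:E * b = b + (b + b))%E by rewrite mule_natl.
by rewrite -addeA (addeC c) !addeA.
Qed.

Lemma poweR_le (a b : \bar R) s : 0 <= s -> (0 <= a)%E -> (a <= b)%E -> (a `^ s <= b `^ s)%E.
Proof.
move=> s0 a0 ab; have b0 := le_trans a0 ab.
by apply: gt0_ler_poweR => //; rewrite in_itv /= ?a0 ?b0 leey.
Qed.

Lemma Lnorm_mom q (f : T -> R) : (forall x, 0 <= f x) ->
  Lnorm P q%:E (EFin \o f) = (mom q f `^ q^-1)%E.
Proof.
move=> f0; rewrite Lnorm.unlock.
have -> // : (\int[P]_x (`|(EFin \o f) x| `^ q) = mom q f)%E.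
by apply: eq_integral => x _; rewrite gee0_abs ?lee_fin // poweR_EFin.
Qed.

Lemma mom_le q (f g : T -> R) : 0 <= q -> (forall x, 0 <= f x) -> (forall x, f x <= g x) ->
  measurable_fun setT f -> measurable_fun setT g -> (mom q f <= mom q g)%E.
Proof.
move=> q0 f0 fg mf mg; apply: ge0_le_integral_fin.
- by move=> x; exact: powR_ge0.
- exact: measurable_powR_comp.
- exact: measurable_powR_comp.
- by move=> x; apply: ge0_ler_powR; rewrite ?nnegrE // (le_trans (f0 x)).
Qed.

Lemma mom_minkowski q (f g : T -> R) : 1 <= q -> (forall x, 0 <= f x) -> (forall x, 0 <= g x) ->
  measurable_fun setT f -> measurable_fun setT g ->
  (mom q (fun x => (f x + g x)%R) `^ q^-1 <= mom q f `^ q^-1 + mom q g `^ q^-1)%E.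
Proof.
move=> q1 f0 g0 mf mg.
have := @minkowski_EFin _ _ _ P f g q mf mg q1.
rewrite (Lnorm_mom q f0) (Lnorm_mom q g0).
by rewrite (@Lnorm_mom q (f \+ g)%R) // => x; rewrite addr_ge0.
Qed.

Lemma mom_cst q (c : R) : 0 < q -> 0 <= c -> (mom q (fun=> c) `^ q^-1 = c%:E)%E.
Proof.
move=> q0 c0; rewrite /mom integral_cst // [X in (_ * X)%E](probability_setT P) mule1.
by rewrite poweR_EFin -powRrM mulfV ?gt_eqF // powRr1.
Qed.

Lemma mom_cauchy q (f g : T -> R) : (forall x, 0 <= f x) -> (forall x, 0 <= g x) ->
  measurable_fun setT f -> measurable_fun setT g ->
  (mom (q / 2) (fun x => (f x * g x)%R) <= mom q f `^ 2^-1 * mom q g `^ 2^-1)%E.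
Proof.
move=> f0 g0 mf mg.
pose u x := f x `^ (q / 2); pose v x := g x `^ (q / 2).
have mu' : measurable_fun setT u by exact: measurable_powR_comp.
have mv : measurable_fun setT v by exact: measurable_powR_comp.
have u0 x : 0 <= u x by exact: powR_ge0.
have v0 x : 0 <= v x by exact: powR_ge0.
have h2 : (2^-1 + 2^-1 = 1 :> R) by field.
have := @hoelder _ _ _ P u v 2 2 mu' mv (ltr0n _ 2) (ltr0n _ 2) h2.
rewrite Lnorm1 (Lnorm_mom 2 u0) (Lnorm_mom 2 v0).
have sq (w : T -> R) : mom 2 (fun x => w x `^ (q / 2)) = mom q w.
  by apply: eq_integral => x _; rewrite -powRrM divfK ?pnatr_eq0.
rewrite (sq f) (sq g); apply: le_trans; apply: eq_integral_le => x.
by rewrite gee0_abs ?lee_fin ?mulr_ge0 // powRM.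
Qed.

End Moments.

(** * Moment of the variance parameter *)

Section NormBound.
Context {R : realType} {dS : measure_display} {S : measurableType dS} {n d : nat}.
Local Notation C := R[i].
Local Notation T := (n.-tuple S).
Variables (mu : probability S R) (M : probability T R).
Hypothesis iidM : iid_law mu M.
Variable K : 'I_n -> 'I_n -> S -> S -> 'M[C]_d.
Hypothesis mK : forall i j, mx_measurable (fun z : S * S => K i j z.1 z.2).
Hypothesis hK : forall i j x y, hermitian_mx (K i j x y).
Hypothesis sK : forall i j x y, K i j x y = K j i y x.
Variables (r q : R).
Hypotheses (r1 : 1 <= r) (dr : d%:R <= expR (r - 1)) (q1 : 1 <= q) (qr : q <= r).

Local Notation kmx := (kmx K).
Local Notation MM := (M \x M)%E.
Let q0 : 0 < q := lt_le_trans ltr01 q1.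
Let kb (z : T * T) := blkmax (kmx z.1 z.2).
Let kr (z : T * T) := rowmax (kmx z.1 z.2).
Let kc (z : T * T) := colmax (kmx z.1 z.2).
Let mkb : measurable_fun setT kb := measurable_kblkmax mK.
Let mkr : measurable_fun setT kr := measurable_krowmax mK.
Let mkc : measurable_fun setT kc := measurable_kcolmax mK.
Let kb0 z : 0 <= kb z := blkmax_ge0 _.
Let kr0 z : 0 <= kr z := rowmax_ge0 _.
Let kc0 z : 0 <= kc z := colmax_ge0 _.

(** Exchanging the identically distributed samples transposes the block matrix; so column maxima,
    which the deviations produce, may be replaced by the row maxima of [T1]. *)
Lemma mom_colmax : mom MM q kc = mom MM q kr.
Proof.
have mc : measurable_fun setT (fun z : T * T => (kc z `^ q)%:E).
  by apply/measurable_EFinP; exact: (measurable_powR_comp q mkc).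
have mr : measurable_fun setT (fun z : T * T => (kr z `^ q)%:E).
  by apply/measurable_EFinP; exact: (measurable_powR_comp q mkr).
have c0 (z : T * T) : (0 <= (kc z `^ q)%:E)%E by rewrite lee_fin powR_ge0.
have r0 (z : T * T) : (0 <= (kr z `^ q)%:E)%E by rewrite lee_fin powR_ge0.
rewrite /mom -[LHS](integral_prod M mc c0) -[RHS](integral_prod M mr r0).
rewrite [LHS](fubini_tonelli _ mc c0).
apply: eq_integral => x _; apply: eq_integral => y _.
by rewrite /kc /kr /= (colmax_kmxC sK).
Qed.

Lemma mom_blkmax_lty : (mom MM q kr < +oo)%E -> (mom MM q kb < +oo)%E.
Proof.
move=> fr; pose c : R := (n * d.+1)%:R; have c0 : 0 <= c by [].
have mck : measurable_fun setT (fun z => c * kr z).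
  exact: (measurable_funM (measurable_cst c) mkr).
apply: (@le_lt_trans _ _ (mom MM q (fun z => c * kr z))).
  apply: (mom_le MM (ltW q0) kb0 _ mkb mck).
  by move=> z; exact: (blkmax_le_rowmax (hermitian_kmx hK z.1 z.2)).
apply: (@le_lt_trans _ _ ((c `^ q)%:E * mom MM q kr)%E); last first.
  by rewrite lte_mul_pinfty ?lee_fin ?powR_ge0.
rewrite -(ge0_integralZl_fin MM (powR_ge0 c q) (fun z => powR_ge0 (kr z) q)
  (measurable_powR_comp q mkr)).
by apply: eq_integral_le => z; rewrite powRM.
Qed.

Definition devconst : R := 2 `^ q * (9 / 2 * r) `^ (q / 2).

Let c92 : 0 <= 9 / 2 * r.
Proof. by rewrite mulr_ge0 ?divr_ge0 // (le_trans ler01 r1). Qed.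

Lemma integral_devbound (f : T * T -> R) : (forall z, 0 <= f z) -> measurable_fun setT f ->
  (\int[MM]_z (devbound r q (f z) (kb z))%:E <=
   devconst%:E * (mom MM q f `^ 2^-1 * mom MM q kb `^ 2^-1))%E.
Proof.
move=> f0 mf; have dc0 : 0 <= devconst by rewrite /devconst mulr_ge0 ?powR_ge0.
apply: (@le_trans _ _ (devconst%:E * mom MM (q / 2) (fun z => (f z * kb z)%R))%E).
  rewrite -(ge0_integralZl_fin MM dc0 (fun z => powR_ge0 (f z * kb z) (q / 2))
    (measurable_powR_comp (q / 2) (measurable_funM mf mkb))).
  apply: eq_integral_le => z.
  by rewrite /devbound (powRM _ c92) ?mulr_ge0 // mulrA.
apply: lee_wpmul2l; first by rewrite lee_fin.
exact: (mom_cauchy MM q f0 kb0 mf mkb).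
Qed.

Let A := mom MM q kr.
Let B := mom MM q kb.
Let Q := ((devconst%:E * (A `^ 2^-1 * B `^ 2^-1)) `^ q^-1)%E.

Hypothesis finA : (A < +oo)%E.

Let g1 (x : T) := mx_expect M (fun y => gmx K (x, y)).
Let EF := mx_expect MM (smx K).

(** The maximum is bounded by the sum of the two decompositions: [GG^*] is its partial mean plus one
    deviation, and the sum of squares is its full mean plus two, one per variable. Each of the three
    deviations costs [Q]. *)
Lemma blkmax_moment_bound :
  (B `^ q^-1 <= (\int[M]_x (specnorm (g1 x) `^ q)%:E) `^ q^-1 + (specnorm EF)%:E + 3%:E * Q)%E.
Proof.
have mg := mx_measurable_gmx mK; have ms := mx_measurable_smx mK.
have mg1 : mx_measurable g1 by exact: (mx_measurable_expect M mg).
have mE : mx_measurable (smxE M K) by exact: (mx_measurable_expect M ms).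
have finB : (B < +oo)%E by exact: mom_blkmax_lty.
have finS : (\int[MM]_z (specnorm (smx K z) `^ q)%:E < +oo)%E.
  apply: le_lt_trans finB; apply: (@mom_le _ _ _ MM q (fun z => specnorm (smx K z)) kb).
  - exact: ltW.
  - by move=> z; exact: specnorm_ge0.
  - by move=> z; rewrite /kb /blkmax le_max lexx orbT.
  - exact: measurable_specnorm.
  - exact: mkb.
pose f1 (z : T * T) := specnorm (g1 z.1).
pose f2 (z : T * T) := specnorm (gmx K z - g1 z.1).
pose f3 (z : T * T) := specnorm (smx K z - smxE M K z.1).
pose f4 (z : T * T) := specnorm (smxE M K z.1 - EF).
have mf1 : measurable_fun setT f1.
  exact: (measurable_specnorm (mx_measurable_comp mg1 measurable_fst)).
have mf2 : measurable_fun setT f2.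
  exact: (measurable_specnorm (mx_measurableB mg (mx_measurable_comp mg1 measurable_fst))).
have mf3 : measurable_fun setT f3.
  exact: (measurable_specnorm (mx_measurableB ms (mx_measurable_comp mE measurable_fst))).
have mf4 : measurable_fun setT f4.
  exact: (measurable_specnorm (mx_measurableB (mx_measurable_comp mE measurable_fst)
    (mx_measurable_cst EF))).
have f10 z : 0 <= f1 z by exact: specnorm_ge0.
have f20 z : 0 <= f2 z by exact: specnorm_ge0.
have f30 z : 0 <= f3 z by exact: specnorm_ge0.
have f40 z : 0 <= f4 z by exact: specnorm_ge0.
have EF0 : 0 <= specnorm EF by exact: specnorm_ge0.
have mfst (h : T -> R) : measurable_fun setT h ->
    mom MM q (fun z => h z.1) = (\int[M]_x (h x `^ q)%:E)%E.
  move=> mh; rewrite /mom.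
  have mhz : measurable_fun setT (fun z : T * T => (h z.1 `^ q)%:E).
    by apply/measurable_EFinP/measurable_powR_comp; exact: measurableT_comp mh measurable_fst.
  rewrite -[LHS](integral_prod M mhz); last by move=> z; rewrite lee_fin powR_ge0.
  apply: eq_integral => x _; transitivity (\int[M]_y cst (h x `^ q)%:E y)%E => //.
  by rewrite integral_cst // [X in (_ * X)%E](probability_setT M) mule1.
have iq0 : 0 <= q^-1 by rewrite invr_ge0 ltW.
have F1 : mom MM q f1 = (\int[M]_x (specnorm (g1 x) `^ q)%:E)%E.
  exact: (mfst _ (measurable_specnorm mg1)).
have F2 : (mom MM q f2 `^ q^-1 <= Q)%E.
  apply: poweR_le => //; first exact: mom_ge0.
  apply: (@le_trans _ _ (\int[MM]_z (devbound r q (kc z) (kb z))%:E)%E).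
    apply: (integral_deviation mg (measurable_devbound r q mkc mkb)
      (fun z => devbound_ge0 r q _ _)).
    by move=> x; exact: (gmx_deviation iidM mK hK r1 dr q1 qr x).
  by apply: (le_trans (integral_devbound kc0 mkc)); rewrite mom_colmax.
have F3 : (mom MM q f3 `^ q^-1 <= Q)%E.
  apply: poweR_le => //; first exact: mom_ge0.
  apply: (@le_trans _ _ (\int[MM]_z (devbound r q (kc z) (kb z))%:E)%E).
    apply: (integral_deviation ms (measurable_devbound r q mkc mkb)
      (fun z => devbound_ge0 r q _ _)).
    by move=> x; exact: (smx_deviation iidM mK hK r1 dr q1 qr x).
  by apply: (le_trans (integral_devbound kc0 mkc)); rewrite mom_colmax.
have F4 : (mom MM q f4 `^ q^-1 <= Q)%E.
  apply: poweR_le => //; first exact: mom_ge0.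
  rewrite (mfst _ (measurable_specnorm (mx_measurableB mE (mx_measurable_cst EF)))).
  apply: (le_trans (smxE_deviation iidM mK hK sK r1 dr q1 qr finS)).
  exact: integral_devbound kr0 mkr.
have D0 (u v : T * T -> R) : (forall z, 0 <= u z) -> (forall z, 0 <= v z) ->
  forall z, 0 <= u z + v z by move=> u0 v0 z; rewrite addr_ge0.
have mfD (u v : T * T -> R) : measurable_fun setT u -> measurable_fun setT v ->
    measurable_fun setT (fun z => u z + v z) by exact: measurable_funD.
pose h4 z := f4 z + specnorm EF.
pose h3 z := f3 z + h4 z.
pose h2 z := f2 z + h3 z.
pose h1 z := f1 z + h2 z.
have mh4 : measurable_fun setT h4 := mfD _ _ mf4 (measurable_cst _).
have mh3 : measurable_fun setT h3 := mfD _ _ mf3 mh4.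
have mh2 : measurable_fun setT h2 := mfD _ _ mf2 mh3.
have mh1 : measurable_fun setT h1 := mfD _ _ mf1 mh2.
have h40 : forall z, 0 <= h4 z := D0 _ _ f40 (fun=> EF0).
have h30 : forall z, 0 <= h3 z := D0 _ _ f30 h40.
have h20 : forall z, 0 <= h2 z := D0 _ _ f20 h30.
have H4 : (mom MM q h4 `^ q^-1 <= Q + (specnorm EF)%:E)%E.
  have H5 : (mom MM q (fun=> specnorm EF) `^ q^-1 <= (specnorm EF)%:E)%E.
    by rewrite [leLHS](mom_cst MM q0 EF0).
  exact: (le_trans (mom_minkowski MM q1 f40 (fun=> EF0) mf4 (measurable_cst _)) (leeD F4 H5)).
have H3 : (mom MM q h3 `^ q^-1 <= Q + (Q + (specnorm EF)%:E))%E.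
  by apply: (le_trans (mom_minkowski MM q1 f30 h40 mf3 mh4)); exact: (leeD F3 H4).
have H2 : (mom MM q h2 `^ q^-1 <= Q + (Q + (Q + (specnorm EF)%:E)))%E.
  by apply: (le_trans (mom_minkowski MM q1 f20 h30 mf2 mh3)); exact: (leeD F2 H3).
have H1 : (mom MM q h1 `^ q^-1 <= (\int[M]_x (specnorm (g1 x) `^ q)%:E) `^ q^-1 +
    (Q + (Q + (Q + (specnorm EF)%:E))))%E.
  apply: (le_trans (mom_minkowski MM q1 f10 h20 mf1 mh2)).
  by rewrite -F1; exact: (leeD (lexx _) H2).
have kh z : kb z <= h1 z.
  have gle : specnorm (gmx K z) <= f1 z + f2 z.
    by rewrite addrC -[X in specnorm X](subrK (g1 z.1)) specnormD.
  have sle : specnorm (smx K z) <= f3 z + h4 z.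
    rewrite -[X in specnorm X](subrK (smxE M K z.1)) (le_trans (specnormD _ _)) // lerD2l.
    by rewrite -[X in specnorm X](subrK EF) specnormD.
  have l1 : f1 z + f2 z <= f1 z + f2 z + h3 z by rewrite lerDl; exact: h30.
  have l2 : h3 z <= f1 z + f2 z + h3 z by rewrite lerDr; exact: addr_ge0 (f10 z) (f20 z).
  have -> : h1 z = f1 z + f2 z + h3 z by rewrite /h1 /h2 addrA.
  by rewrite /kb /blkmax ge_max; apply/andP; split; [exact: le_trans gle l1|exact: le_trans sle l2].
apply: (@le_trans _ _ (mom MM q h1 `^ q^-1)%E).
  apply: poweR_le => //; first exact: mom_ge0.
  exact: (mom_le MM (ltW q0) kb0 kh mkb mh1).
by rewrite -adde_thrice.
Qed.

End NormBound.

(** * Assembly *)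

Section RealEstimates.
Context {R : realType}.

(** If [s] exceeded the claimed bound, [(s - t1) * s] would exceed [(t2 + t3)^2], hence also
    [t2^2 + t3^2]. *)
Lemma quadratic_root_le (s t1 t2 t3 : R) : 0 <= s -> 0 <= t1 -> 0 <= t2 -> 0 <= t3 ->
  s ^+ 2 <= t3 ^+ 2 + t2 ^+ 2 + t1 * s -> s <= t2 + t3 + t1.
Proof.
move=> s0 t10 t20 t30 h; rewrite leNgt; apply/negP => lt.
have h2 : (s - t1) * s <= t3 ^+ 2 + t2 ^+ 2 by lra.
have c0 : 0 <= t2 + t3 by lra.
have h3 : (t2 + t3) * (t2 + t3) < (s - t1) * s by apply: ltr_pM => //; lra.
have h4 : 0 <= t2 * t3 by exact: mulr_ge0.
lra.
Qed.

Lemma final_constant (r t1 t2 t3 s : R) : 1 <= r -> 0 <= t1 -> 0 <= t2 -> 0 <= t3 ->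
  s <= t2 + t3 + 6 * (9 / 2 * r) `^ 2^-1 * t1 ->
  4 * (4 * (9 / 2 * r) * s) <=
  128 / Num.sqrt (expR 1) * (16 * r `^ (3 / 2) * t1 + r * t2 + r * t3).
Proof.
move=> r1 t10 t20 t30 hs; have r0 : 0 < r by lra.
have e0 : 0 < Num.sqrt (expR 1) :> R by rewrite sqrtr_gt0 expR_gt0.
(* [72 = 4 * 4 * 9/2]; since [sqrt 3 <= 16/9], the bound [e <= 3] is precise enough. *)
have e1 : 72 <= 128 / Num.sqrt (expR 1) :> R.
  rewrite ler_pdivlMr // -ler_pdivlMl //.
  have -> : 72^-1 * 128 = Num.sqrt ((16 / 9) ^+ 2) :> R.
    by rewrite sqrtr_sqr ger0_norm //; lra.
  by rewrite ler_sqrt ?sqr_ge0 // (le_trans expR1_le3) //; lra.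
have rr : r `^ (3 / 2) = r * r `^ 2^-1.
  rewrite (_ : 3 / 2 = 1 + 2^-1); last by lra.
  rewrite powRD ?powRr1 ?ltW //; apply/implyP => /eqP; lra.
(* The value [8/3] is chosen so that [6 * 8/3] is the 16 of the statement. *)
have s2 : (9 / 2 * r) `^ 2^-1 <= 8 / 3 * r `^ 2^-1.
  rewrite powRM ?ler_wpM2r ?powR_ge0 //; try lra.
  rewrite powR12_sqrt; last by lra.
  have -> : 8 / 3 = Num.sqrt ((8 / 3) ^+ 2) :> R by rewrite sqrtr_sqr ger0_norm //; lra.
  by rewrite ler_sqrt ?sqr_ge0 //; lra.
set w := r `^ 2^-1 in rr s2 *; set u := (9 / 2 * r) `^ 2^-1 in hs s2.
have w0 : 0 <= w by exact: powR_ge0.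
have X0 : 0 <= 16 * r `^ (3 / 2) * t1 + r * t2 + r * t3.
  by rewrite !addr_ge0 ?mulr_ge0 ?powR_ge0 // ltW.
apply: le_trans (ler_wpM2r X0 e1); rewrite rr.
have h1 : u * t1 <= 8 / 3 * w * t1 by exact: ler_wpM2r.
have h2 : s <= t2 + t3 + 16 * w * t1 by lra.
have := ler_wpM2l (ltW r0) h2; lra.
Qed.

(** Here [al], [be], [a] are the moments of [rowmax], [blkmax] and the partial mean of [GG^*], and
    [f] is the norm of the mean sum of squares. In terms of [s = be^(1/2q)] the hypothesis is
    quadratic. *)
Lemma moment_root_bound (r q al be a f : R) : 1 <= r -> 1 <= q ->
  0 <= al -> 0 <= be -> 0 <= a -> 0 <= f ->
  be `^ q^-1 <= a `^ q^-1 + f + 3 * (devconst r q * (al `^ 2^-1 * be `^ 2^-1)) `^ q^-1 ->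
  4 * (4 `^ (2 * q) * (((9 / 2 * r) ^+ 2) `^ q * be)) `^ (2 * q)^-1 <=
  128 / Num.sqrt (expR 1) *
    (16 * r `^ (3 / 2) * al `^ (2 * q)^-1 + r * f `^ 2^-1 + r * a `^ (2 * q)^-1).
Proof.
move=> r1 q1 al0 be0 a0 f0 main.
have q0 : 0 < q by lra.
have qn : q != 0 by rewrite gt_eqF.
have c0 : 0 <= 9 / 2 * r by lra.
have sq (x : R) : 0 <= x -> (x `^ (2 * q)^-1) ^+ 2 = x `^ q^-1.
  by move=> x0; rewrite -powR_mulrn ?powR_ge0 // -powRrM; congr (_ `^ _); field.
pose t1 := al `^ (2 * q)^-1; pose s := be `^ (2 * q)^-1; pose t3 := a `^ (2 * q)^-1.
pose t2 := f `^ 2^-1.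
have hQ : (devconst r q * (al `^ 2^-1 * be `^ 2^-1)) `^ q^-1 =
    2 * (9 / 2 * r) `^ 2^-1 * (t1 * s).
  have e1 : 2^-1 * q^-1 = (2 * q)^-1 :> R by field.
  have e2 : q / 2 * q^-1 = 2^-1 :> R by field.
  rewrite powRM ?mulr_ge0 ?powR_ge0 // /devconst [X in X * _]powRM ?powR_ge0 //.
  rewrite [X in _ * X]powRM ?powR_ge0 //.
  by rewrite -4!powRrM mulfV // powRr1 // e1 e2.
have mainR : s ^+ 2 <= t3 ^+ 2 + t2 ^+ 2 + 6 * (9 / 2 * r) `^ 2^-1 * t1 * s.
  have t2E : t2 ^+ 2 = f by rewrite /t2 -powR_mulrn ?powR_ge0 // -powRrM mulVf // powRr1.
  move: main; rewrite hQ t2E /s /t3 !sq // -/s; lra.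
have hs : s <= t2 + t3 + 6 * (9 / 2 * r) `^ 2^-1 * t1.
  by apply: quadratic_root_le; rewrite ?powR_ge0 ?mulr_ge0 ?powR_ge0.
have -> : (4 `^ (2 * q) * (((9 / 2 * r) ^+ 2) `^ q * be)) `^ (2 * q)^-1 = 4 * (9 / 2 * r) * s.
  have e3 : 2 * q / (2 * q) = 1 :> R by field.
  rewrite powRM ?mulr_ge0 ?powR_ge0 // [X in _ * X]powRM ?powR_ge0 //.
  have e4 : 2 * (q * (2 * q)^-1) = 1 :> R by field.
  by rewrite -(powR_mulrn 2 c0) -!powRrM e3 e4 !powRr1 // mulrA.
by apply: final_constant; rewrite ?powR_ge0.
Qed.

End RealEstimates.

Section ChaosBound.
Context {R : realType} {dS : measure_display} {S : measurableType dS} {n d : nat}.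
Local Notation C := R[i].
Local Notation T := (n.-tuple S).
Variables (mu : probability S R) (M : probability T R).
Hypothesis iidM : iid_law mu M.
Variable K : 'I_n -> 'I_n -> S -> S -> 'M[C]_d.
Hypothesis mK : forall i j, mx_measurable (fun z : S * S => K i j z.1 z.2).
Hypothesis hK : forall i j x y, hermitian_mx (K i j x y).
Hypothesis sK : forall i j x y, K i j x y = K j i y x.
Hypothesis iK : forall i j x, mx_integrable mu (K i j x).
Hypothesis eK : forall i j x, mx_expect mu (K i j x) = 0.
Variables (r q : R).
Hypotheses (r1 : 1 <= r) (dr : d%:R <= expR (r - 1)) (q1 : 1 <= q) (qr : q <= r).
Local Notation MM := (M \x M)%E.

(** [F] is identified with the mean sum of squares only when [A] is finite: otherwise those entries
    need not be integrable and their expectations are default values, but the right-hand side is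
    infinite. *)
Lemma chaos_bound (F : 'M[C]_d) :
  let A := mom MM q (fun z => rowmax (kmx K z.1 z.2)) in
  ((A < +oo)%E -> F = mx_expect MM (smx K)) ->
  (4%:E * (\int[MM]_z (specnorm (dbl K z.1 z.2) `^ (2 * q))%:E) `^ (2 * q)^-1 <=
   (128 / Num.sqrt (expR 1))%:E *
     ((16 * r `^ (3 / 2))%:E * A `^ (2 * q)^-1 + (r * specnorm F `^ 2^-1)%:E +
      r%:E * (\int[M]_x (specnorm (mx_expect M (fun y => gmx K (x, y))) `^ q)%:E) `^ (2 * q)^-1))%E.
Proof.
move=> A hF.
have q0 : 0 < q by exact: lt_le_trans ltr01 q1.
have r0 : 0 < r by exact: lt_le_trans ltr01 r1.
have qq0 : 0 < 2 * q by rewrite mulr_gt0.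
have iq : (2 * q)^-1 != 0 by rewrite invr_eq0 gt_eqF.
have e0 : 0 < 128 / Num.sqrt (expR 1) :> R by rewrite divr_gt0 // sqrtr_gt0 expR_gt0.
have w0 : 0 < 16 * r `^ (3 / 2) by rewrite mulr_gt0 // powR_gt0.
set a3 := (\int[M]_x _)%E.
have a30 : (0 <= a3)%E by apply: integral_ge0 => x _; rewrite lee_fin powR_ge0.
have A0 : (0 <= A)%E by exact: mom_ge0.
have t20 : 0 <= r * specnorm F `^ 2^-1 by rewrite mulr_ge0 ?powR_ge0 // ltW.
have t30 : (0 <= r%:E * a3 `^ (2 * q)^-1)%E by rewrite mule_ge0 ?poweR_ge0 // lee_fin ltW.
have t10 : (0 <= (16 * r `^ (3 / 2))%:E * A `^ (2 * q)^-1)%E.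
  by rewrite mule_ge0 ?poweR_ge0 // lee_fin ltW.
have [Ay|Afin] := eqVneq A +oo%E.
  rewrite [X in (_ <= _ * X)%E](_ : _ = +oo%E).
    by rewrite gt0_muley ?lte_fin // leey.
  rewrite Ay poweRyr // gt0_muley ?lte_fin // addye ?addye //.
  by rewrite gt_eqF // (lt_le_trans _ t30) // ltNy0.
have [a3y|a3fin] := eqVneq a3 +oo%E.
  rewrite [X in (_ <= _ * X)%E](_ : _ = +oo%E).
    by rewrite gt0_muley ?lte_fin // leey.
  rewrite a3y poweRyr // gt0_muley ?lte_fin // addey //.
  by rewrite gt_eqF // (lt_le_trans ltNy0) // adde_ge0 // lee_fin.
have {}Afin : (A < +oo)%E by rewrite ltey.
rewrite (hF Afin) in t20 *; set EF := mx_expect _ _ in t20 *.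
have Bfin := mom_blkmax_lty mK hK q1 Afin.
set B := mom _ _ _ in Bfin.
have B0 : (0 <= B)%E by exact: mom_ge0.
have main := blkmax_moment_bound iidM mK hK sK r1 dr q1 qr Afin.
pose al := fine A; pose be := fine B; pose a := fine a3.
have fin (x : \bar R) : (0 <= x)%E -> (x < +oo)%E -> x = (fine x)%:E.
  by move=> x0 xy; rewrite fineK // ge0_fin_numE.
have alE : A = al%:E := fin _ A0 Afin.
have beE : B = be%:E := fin _ B0 Bfin.
have aE : a3 = a%:E by apply: fin a30 _; rewrite ltey.
have al0 : 0 <= al := fine_ge0 A0.
have be0 : 0 <= be := fine_ge0 B0.
have a0 : 0 <= a := fine_ge0 a30.
have mainR : be `^ q^-1 <= a `^ q^-1 + specnorm EF +
    3 * (devconst r q * (al `^ 2^-1 * be `^ 2^-1)) `^ q^-1.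
  by rewrite -lee_fin; move: main; rewrite -/B -/A -/a3 -/EF alE beE aE.
have := moment_root_bound r1 q1 al0 be0 a0 (specnorm_ge0 EF) mainR.
set X := 4 `^ _ * _ => hX.
have cm : (\int[MM]_z (specnorm (dbl K z.1 z.2) `^ (2 * q))%:E <= X%:E)%E.
  apply: (le_trans (chaos_moment iidM mK hK sK iK eK r1 dr q1 qr)).
  rewrite /X EFinM; apply: lee_wpmul2l; first by rewrite lee_fin powR_ge0.
  rewrite EFinM -beE.
  rewrite -(ge0_integralZl_fin MM (powR_ge0 _ q) (fun z => powR_ge0 _ q)
      (measurable_powR_comp q (measurable_kblkmax mK))).
  by apply: eq_integral_le => z; rewrite powRM ?sqr_ge0 // blkmax_ge0.
apply: (@le_trans _ _ (4 * X `^ (2 * q)^-1)%:E).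
  rewrite EFinM; apply: lee_wpmul2l; first by rewrite lee_fin.
  rewrite -poweR_EFin; apply: poweR_le cm; first by rewrite invr_ge0 ltW.
  by apply: integral_ge0 => z _; rewrite lee_fin powR_ge0.
by rewrite alE aE -lee_fin in hX *.
Qed.

End ChaosBound.

(** * Transfer to the underlying probability space *)

Section Transfer.
Context {R : realType} {dO dS : measure_display} {O : measurableType dO}
  {S : measurableType dS} {n : nat}.
Local Notation C := R[i].
Local Notation T := (n.-tuple S).
Variables (P : probability O R) (mu : probability S R).

(** [M] is the distribution of the given sample, which spares building an [n]-fold product
    measure. *)
Lemma exists_iid_law (X : 'I_n -> O -> S) :
  (forall i, measurable_fun setT (X i)) -> (forall i, has_law P (X i) mu) ->
  mutually_independent P X -> exists M : probability T R, iid_law mu M.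
Proof.
move=> mX lX iX; have mt := measurable_tup mX.
pose Z : {mfun O >-> T} := HB.pack (tup X) (isMeasurableFun.Build _ _ _ _ _ mt).
by exists (distribution P Z) => B mB; exact: (iid_tup lX iX).
Qed.

Variable M : probability T R.
Hypothesis iidM : iid_law mu M.
Variables X1 X2 : 'I_n -> O -> S.
Hypotheses (mX1 : forall i, measurable_fun setT (X1 i))
  (mX2 : forall i, measurable_fun setT (X2 i))
  (lX1 : forall i, has_law P (X1 i) mu) (lX2 : forall i, has_law P (X2 i) mu)
  (iX : mutually_independent P
     (fun k : 'I_n + 'I_n => match k with inl i => X1 i | inr i => X2 i end)).
Local Notation MM := (M \x M)%E.

Lemma joint_integral (f : T * T -> R) : measurable_fun setT f ->
  (\int[P]_w (f (tup X1 w, tup X2 w))%:E = \int[MM]_z (f z)%:E)%E.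
Proof.
move=> mf; have mfE : measurable_fun setT (fun z => (f z)%:E) by exact/measurable_EFinP.
rewrite [LHS]integralE [RHS]integralE; congr (_ - _)%E.
  rewrite -(joint_law iidM mX1 mX2 lX1 lX2 iX (measurable_funepos mfE)) //.
  by apply: eq_integral => w _; rewrite !funeposE.
rewrite -(joint_law iidM mX1 mX2 lX1 lX2 iX (measurable_funeneg mfE)) //.
by apply: eq_integral => w _; rewrite !funenegE.
Qed.

Lemma joint_mx_expect m k (F : T * T -> 'M[C]_(m, k)) : mx_measurable F ->
  mx_expect P (fun w => F (tup X1 w, tup X2 w)) = mx_expect MM F.
Proof.
move=> mF; apply/matrixP => a b; have [F1 F2] := mF a b; rewrite !mxE /cexpect /Rintegral.
by rewrite (joint_integral F1) (joint_integral F2).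
Qed.

Lemma mx_expect_snd m k (F : T -> 'M[C]_(m, k)) : mx_measurable F ->
  mx_expect MM (fun z => F z.2) = mx_expect M F.
Proof.
have key (f : T -> R) : measurable_fun setT f ->
    (\int[MM]_z (f z.2)%:E = \int[M]_y (f y)%:E)%E.
  move=> mf.
  have gen (g : T -> \bar R) : measurable_fun setT g -> (forall x, 0 <= g x)%E ->
      (\int[MM]_z g z.2 = \int[M]_y g y)%E.
    move=> mg g0.
    have mg2 : measurable_fun setT (fun z : T * T => g z.2).
      exact: (measurableT_comp mg measurable_snd).
    rewrite -[LHS](integral_prod M mg2) //.
    transitivity (\int[M]_x cst (\int[M]_y g y) x)%E => //.
    by rewrite integral_cst // [X in (_ * X)%E](probability_setT M) mule1.
  have mfE : measurable_fun setT (fun y => (f y)%:E) by exact/measurable_EFinP.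
  rewrite [LHS]integralE [RHS]integralE; congr (_ - _)%E.
    rewrite -(gen _ (measurable_funepos mfE)) //.
    by apply: eq_integral => w _; rewrite !funeposE.
  rewrite -(gen _ (measurable_funeneg mfE)) //.
  by apply: eq_integral => w _; rewrite !funenegE.
move=> mF; apply/matrixP => a b; have [F1 F2] := mF a b; rewrite !mxE /cexpect /Rintegral.
by rewrite (key _ F1) (key _ F2).
Qed.

Lemma integral_fst (h : T -> \bar R) : measurable_fun setT h -> (forall x, 0 <= h x)%E ->
  (\int[P]_w h (tup X1 w) = \int[M]_x h x)%E.
Proof.
move=> mh h0.
have mh1 : measurable_fun setT (fun z : T * T => h z.1).
  exact: (measurableT_comp mh measurable_fst).
rewrite (joint_law iidM mX1 mX2 lX1 lX2 iX mh1) // -[LHS](integral_prod M mh1) //.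
apply: eq_integral => x _; transitivity (\int[M]_y cst (h x) y)%E => //.
by rewrite integral_cst // [X in (_ * X)%E](probability_setT M) mule1.
Qed.

End Transfer.

(** The left-hand side depends only on the law of [X], the other terms on the joint law of [X1] and
    [X2]; both are expressed through [M], where the estimates were made. *)
Theorem theorem3p1 (R : realType) (dO dS : measure_display)
  (Omega : measurableType dO) (S : measurableType dS)
  (P : probability Omega R) (mu : probability S R)
  (n d : nat) (hn : (2 <= n)%N)
  (X X1 X2 : 'I_n -> Omega -> S)
  (hXm : forall i, measurable_fun setT (X i))
  (hX1m : forall i, measurable_fun setT (X1 i))
  (hX2m : forall i, measurable_fun setT (X2 i))
  (hXlaw : forall i, has_law P (X i) mu)
  (hX1law : forall i, has_law P (X1 i) mu)
  (hX2law : forall i, has_law P (X2 i) mu)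
  (hXind : mutually_independent P X)
  (hX12ind : mutually_independent P
     (fun k : 'I_n + 'I_n => match k with inl i => X1 i | inr i => X2 i end))
  (H : 'I_n -> 'I_n -> S -> S -> 'M[R[i]]_d)
  (hHm : forall i j, i != j ->
     mx_measurable (fun p : S * S => H i j p.1 p.2))
  (hHherm : forall (i j : 'I_n) (x y : S), i != j -> hermitian_mx (H i j x y))
  (hHsym : forall (i j : 'I_n) (x y : S), i != j -> H i j x y = H j i y x)
  (hHdeg : forall (i j : 'I_n) (x : S), i != j ->
     mx_integrable mu (H i j x) /\ mx_expect mu (H i j x) = 0)
  (q : R) (hq : 1 <= q) :
  let r := Num.max q (ln (expR 1 * d%:R)) in
  let U := fun w => \sum_(i < n) \sum_(j < n | j != i) H i j (X i w) (X j w) in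
  let V := fun w => \sum_(i < n) \sum_(j < n | j != i) H i j (X1 i w) (X2 j w) in
  let G := fun (x y : 'I_n -> S) =>
     (\mxblock_(i < n, j < n) (if i == j then 0 else H i j (x i) (y j)) :
        'M[R[i]]_(\sum_(i < n) d)) in
  let E2GG := fun w => mx_expect P (fun w' =>
     G (fun i => X1 i w) (fun j => X2 j w') *m
     adjmx (G (fun i => X1 i w) (fun j => X2 j w'))) in
  let LHS := ((\int[P]_w (specnorm (U w) `^ (2 * q))%:E) `^ (2 * q)^-1)%E in
  let MID := ((\int[P]_w (specnorm (V w) `^ (2 * q))%:E) `^ (2 * q)^-1)%E in
  let T1 := ((\int[P]_w ((\big[Num.max/0]_(i < n)
        specnorm (\sum_(j < n | j != i)
          (H i j (X1 i w) (X2 j w) *m H i j (X1 i w) (X2 j w)))) `^ q)%:E)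
        `^ (2 * q)^-1)%E in
  let T2 := (specnorm (\sum_(i < n) \sum_(j < n | j != i)
        mx_expect P (fun w => H i j (X1 i w) (X2 j w) *m H i j (X1 i w) (X2 j w))))
        `^ (2^-1) in
  let T3 := ((\int[P]_w (specnorm (E2GG w) `^ q)%:E) `^ (2 * q)^-1)%E in
  (LHS <= 4%:E * MID)%E /\
  (4%:E * MID <= (128 / Num.sqrt (expR 1))%:E *
     ((16 * r `^ (3 / 2))%:E * T1 + (r * T2)%:E + r%:E * T3))%E.
Proof.
move=> r U V G E2GG LHS MID T1 T2 T3.
have r1 : 1 <= r by rewrite le_max hq.
have qr : q <= r by rewrite le_max lexx.
have dr : d%:R <= expR (r - 1).
  (* For [d = 0] the argument of the logarithm is 0 and the bound is trivial. *)
  have [->|d0] := posnP d; first exact: expR_ge0.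
  rewrite expRB ler_pdivlMr ?expR_gt0 // mulrC.
  have p0 : 0 < expR 1 * d%:R :> R by rewrite mulr_gt0 ?expR_gt0 ?ltr0n.
  rewrite -[leLHS](lnK (x := _)) ?posrE // ler_expR.
  by rewrite le_max lexx orbT.
have q0 : 0 < q := lt_le_trans ltr01 hq.
have qq0 : 0 < 2 * q by rewrite mulr_gt0.
have qq1 : 1 <= 2 * q by rewrite -[leLHS]mul1r ler_pM // ler1n.
have [M iidM] := exists_iid_law hXm hXlaw hXind.
(* Extension by zero on the diagonal keeps symmetry and degeneracy, and turns the sums over [j != i]
   into full ones. *)
pose K i j x y : 'M[R[i]]_d := if i == j then 0 else H i j x y.
have mK i j : mx_measurable (fun z : S * S => K i j z.1 z.2).
  by rewrite /K; case: eqVneq => ij; [exact: mx_measurable_cst|exact: hHm].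
have hK i j x y : hermitian_mx (K i j x y).
  by rewrite /K; case: eqVneq => ij; [exact: hermitian0|exact: hHherm].
have sK i j x y : K i j x y = K j i y x.
  by rewrite /K eq_sym; case: eqVneq => // ij; apply: hHsym; rewrite eq_sym.
have iK i j x : mx_integrable mu (K i j x).
  rewrite /K; case: eqVneq => ij; first exact: mx_integrable0.
  by have [] := hHdeg i j x ij.
have eK i j x : mx_expect mu (K i j x) = 0.
  rewrite /K; case: eqVneq => ij; first exact: mx_expect0.
  by have [] := hHdeg i j x ij.
have K0 i x y : K i i x y = 0 by rewrite /K eqxx.
have kE (Y1 Y2 : 'I_n -> Omega -> S) w w' :
    kmx K (tup Y1 w) (tup Y2 w') = fun i j => K i j (Y1 i w) (Y2 j w').
  by apply/funext => i; apply/funext => j; rewrite /kmx !tnth_mktuple.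
have sumE (W : zmodType) i (f : 'I_n -> W) (g : 'I_n -> W) :
    (forall j, j != i -> g j = f j) -> g i = 0 -> \sum_(j < n | j != i) f j = \sum_j g j.
  move=> gf g0; rewrite [RHS](bigD1 i) //= g0 add0r.
  by apply: eq_bigr => j ji; rewrite gf.
have dblE (Y1 Y2 : 'I_n -> Omega -> S) w :
    \sum_(i < n) \sum_(j < n | j != i) H i j (Y1 i w) (Y2 j w) = dbl K (tup Y1 w) (tup Y2 w).
  apply: eq_bigr => i _; apply: sumE => [j ji|]; rewrite !tnth_mktuple //.
  by rewrite /K eq_sym (negPf ji).
have mdbl : mx_measurable (fun z : n.-tuple S * n.-tuple S => dbl K z.1 z.2).
  by apply: mx_measurable_sum => i _; apply: mx_measurable_sum => j _;
     exact: mx_measurable_kernel.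
have pos (TT : Type) (m : nat) (F : TT -> 'M[R[i]]_m) s z : (0 <= (specnorm (F z) `^ s)%:E)%E.
  by rewrite lee_fin powR_ge0.
have EV : (\int[P]_w (specnorm (V w) `^ (2 * q))%:E =
    \int[M \x M]_z (specnorm (dbl K z.1 z.2) `^ (2 * q))%:E)%E.
  have posd (z : n.-tuple S * n.-tuple S) : (0 <= (specnorm (dbl K z.1 z.2) `^ (2 * q))%:E)%E.
    by rewrite lee_fin powR_ge0.
  rewrite -[RHS](joint_law iidM hX1m hX2m hX1law hX2law hX12ind
    (measurable_specnorm_powR (2 * q) mdbl) posd).
  by apply: eq_integral => w _; rewrite /V dblE.
split.
  have mdd : mx_measurable (fun z : n.-tuple S => dbl K z z).
    apply: (mx_measurable_comp mdbl (g := fun z => (z, z))); exact: measurable_fun_pair.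
  have EU : (\int[P]_w (specnorm (U w) `^ (2 * q))%:E =
      \int[M]_z (specnorm (dbl K z z) `^ (2 * q))%:E)%E.
    have posd (z : n.-tuple S) : (0 <= (specnorm (dbl K z z) `^ (2 * q))%:E)%E.
      by rewrite lee_fin powR_ge0.
    rewrite -[RHS](tup_law iidM hXm hXlaw hXind (measurable_specnorm_powR (2 * q) mdd) posd).
    by apply: eq_integral => w _; rewrite /U dblE.
  have dec : (\int[P]_w (specnorm (U w) `^ (2 * q))%:E <=
      (4 `^ (2 * q))%:E * \int[P]_w (specnorm (V w) `^ (2 * q))%:E)%E.
    rewrite [leLHS]EU [X in (_ * X)%E]EV -[X in (_ * X)%E](integral_prod_specnorm M (2 * q) mdbl).
    exact: (decoupling iidM mK sK iK eK K0 qq1).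
  have I0 : (0 <= \int[P]_w (specnorm (V w) `^ (2 * q))%:E)%E.
    by apply: integral_ge0 => w _; exact: pos.
  apply: (@le_trans _ _ (((4 `^ (2 * q))%:E * \int[P]_w (specnorm (V w) `^ (2 * q))%:E)
      `^ (2 * q)^-1)%E).
    apply: poweR_le dec; first by rewrite invr_ge0 ltW.
    by apply: integral_ge0 => w _; exact: pos.
  rewrite poweRM ?lee_fin ?powR_ge0 // poweR_EFin -powRrM mulfV ?gt_eqF // powRr1 //.
pose A := mom (M \x M)%E q (fun z => rowmax (kmx K z.1 z.2)).
have mrow := measurable_krowmax mK.
have EA : (\int[P]_w ((\big[Num.max/0]_(i < n) specnorm (\sum_(j < n | j != i)
     (H i j (X1 i w) (X2 j w) *m H i j (X1 i w) (X2 j w)))) `^ q)%:E = A)%E.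
  have mrE : measurable_fun setT (fun z : n.-tuple S * n.-tuple S =>
      (rowmax (kmx K z.1 z.2) `^ q)%:E).
    by apply/measurable_EFinP; exact: (measurable_powR_comp q mrow).
  have r0E (z : n.-tuple S * n.-tuple S) : (0 <= (rowmax (kmx K z.1 z.2) `^ q)%:E)%E.
    by rewrite lee_fin powR_ge0.
  have ER w : \big[Num.max/0]_(i < n) specnorm (\sum_(j < n | j != i)
      (H i j (X1 i w) (X2 j w) *m H i j (X1 i w) (X2 j w))) = rowmax (kmx K (tup X1 w) (tup X2 w)).
    rewrite /rowmax kE; apply: eq_bigr => i _; congr specnorm; apply: sumE => [j ji|].
      by rewrite /K eq_sym (negPf ji).
    by rewrite K0 mulmx0.
  rewrite /A /mom -[RHS](joint_law iidM hX1m hX2m hX1law hX2law hX12ind mrE r0E).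
  by apply: eq_integral => w _; rewrite ER.
have E3 : (\int[P]_w (specnorm (E2GG w) `^ q)%:E =
    \int[M]_x (specnorm (mx_expect M (fun y => gmx K (x, y))) `^ q)%:E)%E.
  have mg := mx_measurable_gmx mK.
  have mE := mx_measurable_expect M mg.
  have posg x : (0 <= (specnorm (mx_expect M (fun y => gmx K (x, y))) `^ q)%:E)%E.
    by rewrite lee_fin powR_ge0.
  (* With [X1] frozen at [w] the integrand in [w'] depends on [X2] alone, so its expectation is one
     over the second factor of [M \x M]. *)
  have EW w : E2GG w = mx_expect M (fun y => gmx K (tup X1 w, y)).
    pose F y := gmx K (tup X1 w, y).
    have mF : mx_measurable F by exact: (mx_measurable_comp mg (measurable_sec1 _)).
    rewrite -/F -(mx_expect_snd M mF).
    rewrite -(joint_mx_expect iidM hX1m hX2m hX1law hX2law hX12ind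
      (mx_measurable_comp mF measurable_snd)).
    congr (mx_expect P _); apply/funext => w'.
    by rewrite /= /F /gmx /= kE.
  rewrite -[RHS](integral_fst iidM hX1m hX2m hX1law hX2law hX12ind
    (measurable_specnorm_powR q mE) posg).
  by apply: eq_integral => w _; rewrite EW.
have := @chaos_bound R _ S n d mu M iidM K mK hK sK iK eK r q r1 dr hq qr
  (\sum_(i < n) \sum_(j < n | j != i)
        mx_expect P (fun w => H i j (X1 i w) (X2 j w) *m H i j (X1 i w) (X2 j w))).
rewrite /MID /T1 /T2 /T3 EV EA E3; apply => Afin.
(* Exchanging sum and expectation needs each square to be integrable; it is dominated by its row
   sum, whose maximum has a finite [q]-th moment. *)
have iKK i j : mx_integrable (M \x M)%E
    (fun z : n.-tuple S * n.-tuple S => kmx K z.1 z.2 i j *m kmx K z.1 z.2 i j).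
  have mk := mx_measurable_kmx mK i j.
  have mkk := mx_measurableM mk mk.
  apply: (mx_integrable_specnorm hq mkk); apply: le_lt_trans Afin.
  apply: (mom_le (M \x M)%E (ltW q0) _ _ (measurable_specnorm mkk) mrow) => z.
    exact: specnorm_ge0.
  apply: le_trans (specnorm_row_le _ i).
  have h := @specnorm_sumsq_le R d 'I_1 'I_n (fun=> kmx K z.1 z.2 i j)
    (fun k => kmx K z.1 z.2 i k) (fun=> hK _ _ _ _) (fun=> hK _ _ _ _).
  rewrite big_ord1 in h; apply: h => v.
  by rewrite big_ord1 (bigD1 j) //= lerDl sumr_ge0 // => k _; exact: ip_ge0.
rewrite /smx /sqsum mx_expect_sum => [|i _]; last exact: mx_integrable_sum.
apply: eq_bigr => i _; rewrite mx_expect_sum //; apply: sumE => [j ji|].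
  rewrite -(joint_mx_expect iidM hX1m hX2m hX1law hX2law hX12ind
    (mx_integrable_measurable (iKK i j))).
  congr (mx_expect P _); apply/funext => w /=.
  by rewrite kE /K eq_sym (negPf ji).
rewrite (_ : (fun z => _) = fun=> 0) ?mx_expect0 //.
by apply/funext => z; rewrite /kmx K0 mulmx0.
Qed.
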